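(* Let $n\ge 1$, $I=\{1,\dots,n\}$, let $A=(a_{ij})_{n\times n}$ be a real matrix that is symmetric, entrywise nonnegative, irreducible and invertible, and let $\beta_1,\dots,\beta_n>-2$ be constants. Consider the system $$\Delta u_i+\sum_{j=1}^n a_{ij}|x|^{\beta_j}e^{u_j(x)}=0\ \text{ in }\mathbb R^2,\qquad \int_{\mathbb R^2}|x|^{\beta_i}e^{u_i(x)}\,dx<\infty,\qquad i\in I. \quad ( * )$$ For $\sigma=(\sigma_1,\dots,\sigma_n)\in\mathbb R^n$ and $J\subset I$ put $$\Lambda_J(\sigma)=2\sum_{i\in J}(\beta_i+2)\sigma_i-\sum_{i,j\in J}a_{ij}\sigma_i\sigma_j .$$ 1. If $u=(u_1,\dots,u_n)$ is a radial solution of $( * )$ and $\sigma=(\sigma_1,\dots,\sigma_n)$ is its energy, then $$\Lambda_I(\sigma)=0\quad\text{and}\quad \Lambda_J(\sigma)>0\ \text{ for all } \emptyset\subsetneq J\subsetneq I. \quad ( ** )$$ 2. For each $\sigma=(\sigma_1,\dots,\sigma_n)$ with $\sigma_i>0$ for all $i\in I$ satisfying $( ** )$, there exists a radial solution $u$ of $( * )$ whose energy is $\sigma$. 3. If $u$ and $v$ are both radial solutions of $( * )$ with $$\int_0^\infty r^{\beta_i+1}e^{u_i(r)}\,dr=\int_0^\infty r^{\beta_i+1}e^{v_i(r)}\,dr\quad\text{for all } i\in I,$$ then there is $\delta>0$ such that $u_i(r)=v_i(\delta r)+(2+\beta_i)\log\delta$ for all $r$ and all $i\in I$.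
   Context: Irreducible means there is no partition of $I$ into two disjoint nonempty sets $I_1,I_2$ with $a_{ij}=0$ for all $i\in I_1$, $j\in I_2$. A solution $u=(u_1,\dots,u_n)$ of $( * )$ consists of real-valued functions continuous on $\mathbb R^2$ and $C^2$ on $\mathbb R^2\setminus\{0\}$, satisfying the equations (pointwise away from $0$ and in the distributional sense on $\mathbb R^2$). It is radial if every $u_i$ is radially symmetric about the origin; one then writes $u_i(r)$ with $r=|x|$. The energy of a solution $u$ is $\sigma=(\sigma_1,\dots,\sigma_n)$ with $\sigma_i=\frac1{2\pi}\int_{\mathbb R^2}|x|^{\beta_i}e^{u_i(x)}\,dx$; for radial $u$ this equals $\int_0^\infty r^{\beta_i+1}e^{u_i(r)}\,dr$. *)

(* Defs.v *)
From HB Require Import structures.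
From mathcomp Require Import all_boot all_order all_algebra.
From mathcomp Require Import all_classical all_reals all_analysis.

Set Implicit Arguments.
Unset Strict Implicit.
Unset Printing Implicit Defensive.

Import Order.TTheory GRing.Theory Num.Theory.
Import numFieldNormedType.Exports.

Local Open Scope classical_set_scope.
Local Open Scope ring_scope.

(* The plane is R * R. The library norm on R * R is the max norm, so the
   Euclidean norm has to be introduced separately; both give the same topology. *)
Definition enorm (R : realType) (x : R * R) : R :=
  Num.sqrt (x.1 ^+ 2 + x.2 ^+ 2).

Notation lebesgue2 R := (@lebesgue_measure R \x @lebesgue_measure R)%E.

Definition e1 (R : realType) : R * R := (1, 0).
Definition e2 (R : realType) : R * R := (0, 1).

(* [O] is meant to be open. *)
Fixpoint Ck (R : realType) (k : nat) (O : set (R * R)) (f : R * R -> R) : Prop :=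
  (forall x, O x -> {for x, continuous f}) /\
  if k is k'.+1 then
    forall v, v = e1 R \/ v = e2 R ->
      (forall x, O x -> derivable f x v) /\ Ck k' O (fun x => 'D_v f x)
  else True.

Definition laplacian (R : realType) (f : R * R -> R) (x : R * R) : R :=
  'D_(e1 R) (fun y => 'D_(e1 R) f y) x + 'D_(e2 R) (fun y => 'D_(e2 R) f y) x.

Definition test_function (R : realType) (phi : R * R -> R) : Prop :=
  (forall k, Ck k setT phi) /\ compact (closure [set x | phi x != 0]).

Definition irreducible_mx (R : realType) (n : nat) (A : 'M[R]_n) : Prop :=
  ~ exists I1 I2 : {set 'I_n},
      [/\ I1 != finset.set0, I2 != finset.set0, (I1 :&: I2)%SET = finset.set0,
          (I1 :|: I2)%SET = [set: 'I_n]%SET &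
          forall i j, i \in I1 -> j \in I2 -> A i j = 0].

Definition density (R : realType) (n : nat) (beta : 'I_n -> R)
    (u : 'I_n -> R * R -> R) (i : 'I_n) (x : R * R) : R :=
  enorm x `^ beta i * expR (u i x).

(* The distributional equation is an identity of extended reals: +oo - +oo is
   -oo in this library, so a non-integrable integrand cannot satisfy it. *)
Definition is_solution (R : realType) (n : nat) (A : 'M[R]_n)
    (beta : 'I_n -> R) (u : 'I_n -> R * R -> R) : Prop :=
  forall i : 'I_n,
    [/\ continuous (u i),
        Ck 2 [set x | x != 0] (u i),
        (forall x, x != 0 ->
           laplacian (u i) x + \sum_j A i j * density beta u j x = 0),
        (forall phi, test_function phi ->
           (\int[lebesgue2 R]_x
              (u i x * laplacian phi x
               + (\sum_j A i j * density beta u j x) * phi x)%:E = 0)%E) &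
        (\int[lebesgue2 R]_x (density beta u i x)%:E < +oo)%E].

Definition is_radial (R : realType) (n : nat) (u : 'I_n -> R * R -> R) : Prop :=
  forall (i : 'I_n) (x y : R * R), enorm x = enorm y -> u i x = u i y.

(* The function r |-> u_i(r) attached to a radial [u]; meaningful for 0 <= r. *)
Definition profile (R : realType) (n : nat) (u : 'I_n -> R * R -> R)
    (i : 'I_n) (r : R) : R := u i (r, 0).

Definition energy (R : realType) (n : nat) (beta : 'I_n -> R)
    (u : 'I_n -> R * R -> R) (i : 'I_n) : R :=
  (2 * pi)^-1 * \int[lebesgue2 R]_x density beta u i x.

Definition Lambda (R : realType) (n : nat) (A : 'M[R]_n) (beta : 'I_n -> R)
    (J : {set 'I_n}) (sigma : 'I_n -> R) : R :=
  2 * (\sum_(i in J) (beta i + 2) * sigma i)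
  - \sum_(i in J) \sum_(j in J) A i j * sigma i * sigma j.

Definition Lambda_cond (R : realType) (n : nat) (A : 'M[R]_n)
    (beta : 'I_n -> R) (sigma : 'I_n -> R) : Prop :=
  Lambda A beta [set: 'I_n]%SET sigma = 0 /\
  forall J : {set 'I_n}, J != finset.set0 -> J != [set: 'I_n]%SET ->
    0 < Lambda A beta J sigma.

(* Main.v *)
(* With t = ln r, b_i = beta_i + 2 and w_i = u_i + b_i t, a radial solution is an
   orbit of the autonomous system m_i' = e^{w_i}, w_i' = b_i - sum_j a_ij m_j
   along which m increases from 0 to sigma.

   (1) The derivative of 2 sum_{i in J} e^{w_i} - Lambda_J(m) is
   -2 sum_{i in J, j notin J} a_ij e^{w_i} m_j, which vanishes for J = I and is
   nonpositive, not identically 0, for a proper J; integrate over the line.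

   (3) Given two orbits m and p with the same sigma, m(t) <= p(t + h) for large h.
   At the least such h the two orbits touch, and then they coincide.

   (2) On [0, L] a monotone iteration solves the system with m(0) = 0 and
   m(L) = sigma, and sum_i e^{w_i} = E + Lambda_I(m) / 2 there. Normalise time so
   that half of the mass is reached at t = 0 and let L tend to infinity. In the
   limit E = 0, so Lambda_I vanishes at both end points of the limiting orbit;
   condition (**) makes Lambda_I positive on the box [0, sigma] except at 0 and
   sigma, so these are the end points. *)
Require Import Defs.
From HB Require Import structures.
From mathcomp Require Import all_boot all_order all_algebra.
From mathcomp Require Import all_classical all_reals all_analysis.
From mathcomp Require Import measurable_realfun.
From mathcomp Require Import ring lra.

Set Implicit Arguments.
Unset Strict Implicit.
Unset Printing Implicit Defensive.

Import Order.TTheory GRing.Theory Num.Theory.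
Import numFieldNormedType.Exports.

Local Open Scope classical_set_scope.
Local Open Scope ring_scope.

(** * One-variable calculus and limits *)

(** In the variable [t] the origin lies at [-oo], and regularity there becomes asymptotic
    information: continuity of [u] at [0] removes the constant of integration in the equation for
    [w], and conversely the boundedness of [w i t - b i * t] as [t -> -oo] yields the value at [0].
    In (2) the energy is a property of the whole orbit and cannot be prescribed through initial
    data; the two-point problem prescribes it at once, at the price of showing that no mass is lost
    as [L] grows. Limits are taken along an ultrafilter finer than [\oo], so that all pointwise
    limits exist simultaneously; uniform bounds on second-order Taylor remainders carry the
    differential equations over. In (3), reversing time exchanges the two ends of an orbit, so the
    comparison near an end is proved only at [-oo]. For the distributional equation, where the
    weight may be singular, the point is that the second derivatives of [u] near [0] are dominated
    by a multiple of the right-hand side, which is integrable. *)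

Section RealAnalysis.
Context {R : realType}.
Implicit Types (f g h : R -> R) (a b s t k C : R).

Lemma is_derive_add f g t a b :
  is_derive t 1 f a -> is_derive t 1 g b ->
  is_derive t 1 (fun x => f x + g x) (a + b).
Proof. by move=> ? ?; exact: is_deriveD. Qed.

Lemma is_derive_opp f t a :
  is_derive t 1 f a -> is_derive t 1 (fun x => - f x) (- a).
Proof. by move=> ?; exact: is_deriveN. Qed.

Lemma is_derive_sub f g t a b :
  is_derive t 1 f a -> is_derive t 1 g b ->
  is_derive t 1 (fun x => f x - g x) (a - b).
Proof. by move=> ? ?; exact: is_deriveB. Qed.

Lemma is_derive_mul f g t a b :
  is_derive t 1 f a -> is_derive t 1 g b ->
  is_derive t 1 (fun x => f x * g x) (f t * b + g t * a).
Proof. by move=> ? ?; exact: is_deriveM. Qed.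

Lemma is_derive_scale f t a k :
  is_derive t 1 f a -> is_derive t 1 (fun x => k * f x) (k * a).
Proof. by move=> ?; exact: is_deriveZ. Qed.

Lemma is_derive_const k t : is_derive t 1 (fun _ : R => k) 0.
Proof. exact: is_derive_cst. Qed.

Lemma is_derive_idfun t : is_derive t 1 (fun x : R => x) 1.
Proof. exact: is_derive_id. Qed.

Lemma is_derive_exp f t a :
  is_derive t 1 f a -> is_derive t 1 (fun x => expR (f x)) (expR (f t) * a).
Proof.
by move=> df; apply: (@is_derive1_comp _ expR f); exact: is_derive_expR.
Qed.

Lemma is_derive_comp f g t a b :
  is_derive (g t) 1 f a -> is_derive t 1 g b ->
  is_derive t 1 (fun x => f (g x)) (a * b).
Proof. by move=> ? ?; apply: (@is_derive1_comp _ f g). Qed.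

Lemma is_derive_bigsum (n : nat) (P : pred 'I_n) (F : 'I_n -> R -> R) (dF : 'I_n -> R) t :
  (forall i, is_derive t 1 (F i) (dF i)) ->
  is_derive t 1 (fun x => \sum_(i | P i) F i x) (\sum_(i | P i) dF i).
Proof.
move=> dFi.
suff : forall s : seq 'I_n, is_derive t 1 (fun x => \sum_(i <- s | P i) F i x)
   (\sum_(i <- s | P i) dF i) by exact.
elim=> [|i l IH].
  rewrite big_nil.
  by under eq_fun do rewrite big_nil; exact: is_derive_const.
rewrite big_cons; under eq_fun do rewrite big_cons.
by case: (P i) => //; exact: is_derive_add.
Qed.

Lemma is_derive_shiftr f c t a :
  is_derive (t + c) 1 f a -> is_derive t 1 (fun x => f (x + c)) a.
Proof.
move=> df; rewrite -[a]mulr1; apply: is_derive_comp => //.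
by have := is_derive_add (is_derive_idfun t) (is_derive_const c t); rewrite addr0.
Qed.

Lemma is_derive_reflect f t a :
  is_derive (- t) 1 f a -> is_derive t 1 (fun x => f (- x)) (- a).
Proof.
move=> df; rewrite -[- a]mulrN1; apply: is_derive_comp => //.
Qed.

Lemma is_derive_continuous f t a : is_derive t 1 f a -> {for t, continuous f}.
Proof. by move=> df; apply: differentiable_continuous; apply/derivable1_diffP. Qed.

Lemma mean_value f g a b : a <= b ->
  (forall t, a <= t <= b -> is_derive t 1 f (g t)) ->
  exists2 c, a <= c <= b & f b - f a = g c * (b - a).
Proof.
move=> ab df; have [||c] := @MVT_segment R f g a b ab.
- by move=> x; rewrite in_itv/= => /andP[ax xb]; apply: df; rewrite !ltW.
- apply: continuous_in_subspaceT => x; rewrite inE/= in_itv/= => xab.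
  exact: is_derive_continuous (df _ xab).
- by rewrite in_itv/= => cab E; exists c.
Qed.

Lemma derive_ge0_le f g a b : a <= b ->
  (forall t, a <= t <= b -> is_derive t 1 f (g t)) ->
  (forall t, a <= t <= b -> 0 <= g t) -> f a <= f b.
Proof.
move=> ab df g0; have [c cab E] := mean_value ab df.
by rewrite -subr_ge0 E mulr_ge0 ?g0 ?subr_ge0.
Qed.

Lemma derive_le0_ge f g a b : a <= b ->
  (forall t, a <= t <= b -> is_derive t 1 f (g t)) ->
  (forall t, a <= t <= b -> g t <= 0) -> f b <= f a.
Proof.
move=> ab df g0; have [c cab E] := mean_value ab df.
by rewrite -subr_le0 E mulr_le0_ge0 ?g0 ?subr_ge0.
Qed.

Lemma derive_gt0_lt f g a b : a < b ->
  (forall t, a <= t <= b -> is_derive t 1 f (g t)) ->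
  (forall t, a <= t <= b -> 0 < g t) -> f a < f b.
Proof.
move=> ab df g0; have [c cab E] := mean_value (ltW ab) df.
by rewrite -subr_gt0 E mulr_gt0 ?g0 ?subr_gt0.
Qed.

Lemma derive_lipschitz f g C a b : a <= b ->
  (forall t, a <= t <= b -> is_derive t 1 f (g t)) ->
  (forall t, a <= t <= b -> `|g t| <= C) -> `|f b - f a| <= C * (b - a).
Proof.
move=> ab df gC; have [c cab ->] := mean_value ab df.
by rewrite normrM (ger0_norm (x := b - a)) ?subr_ge0// ler_wpM2r ?subr_ge0// gC.
Qed.

Lemma derive_lipschitz_sym f g C a b :
  (forall t, Num.min a b <= t <= Num.max a b -> is_derive t 1 f (g t)) ->
  (forall t, Num.min a b <= t <= Num.max a b -> `|g t| <= C) ->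
  `|f b - f a| <= C * `|b - a|.
Proof.
case: (leP a b) => ab df gC.
  by rewrite (ger0_norm (x := b - a)) ?subr_ge0//; exact: (derive_lipschitz ab df gC).
rewrite distrC (distrC b) (ger0_norm (x := a - b)) ?subr_ge0 ?(ltW ab)//.
exact: (derive_lipschitz (ltW ab) df gC).
Qed.

Lemma derive0_const f a b : (forall t, is_derive t 1 f 0) -> f a = f b.
Proof. by move=> df; exact: is_derive_0_is_cst. Qed.

(** Mean value inequality for [f x - g a * x], whose derivative [g x - g a] is at most [C * |b - a|]
    between [a] and [b]. The factor 1/2 of the sharp remainder is given up. *)
Lemma taylor_bound f g C a b : 0 <= C ->
  (forall t, Num.min a b <= t <= Num.max a b -> is_derive t 1 f (g t)) ->
  (forall t, Num.min a b <= t <= Num.max a b -> `|g t - g a| <= C * `|t - a|) ->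
  `|f b - f a - (b - a) * g a| <= C * (b - a) ^+ 2.
Proof.
move=> C0 df gL.
have -> : f b - f a - (b - a) * g a = (f b - g a * b) - (f a - g a * a) by ring.
have -> : C * (b - a) ^+ 2 = C * `|b - a| * `|b - a|.
  by rewrite -mulrA -expr2 real_normK ?num_real.
apply: (@derive_lipschitz_sym (fun x => f x - g a * x) (fun x => g x - g a * 1)) => t tab.
  exact: is_derive_sub (df _ tab) (is_derive_scale (g a) (is_derive_idfun t)).
rewrite mulr1; apply: le_trans (gL _ tab) _; apply: ler_wpM2l => //.
move: tab; case: (leP a b) => ab /andP[h1 h2].
  by rewrite !ger0_norm ?subr_ge0 // lerB.
by rewrite !ler0_norm ?subr_le0 // ?(ltW ab)// lerN2 lerB.
Qed.

End RealAnalysis.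

(** * Limits of monotone functions and decay of densities *)

Section Limits.
Context {R : realType}.
Implicit Types (f g h : R -> R) (a b s t k C l : R).

Lemma cvg_ge_of_near {T : Type} {F : set_system T} {FF : ProperFilter F} (f : T -> R) a l :
  f x @[x --> F] --> l -> (\forall x \near F, a <= f x) -> a <= l.
Proof.
move=> fl af; rewrite -(cvg_lim (@Rhausdorff R) fl).
by apply: limr_ge => //; apply/cvg_ex; exists l.
Qed.

Lemma cvg_le_of_near {T : Type} {F : set_system T} {FF : ProperFilter F} (f : T -> R) a l :
  f x @[x --> F] --> l -> (\forall x \near F, f x <= a) -> l <= a.
Proof.
move=> fl af; rewrite -(cvg_lim (@Rhausdorff R) fl).
by apply: limr_le => //; apply/cvg_ex; exists l.
Qed.

Lemma cvg_eq_unique {T : Type} {F : set_system T} {FF : ProperFilter F} (f : T -> R) l l' :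
  f x @[x --> F] --> l -> f x @[x --> F] --> l' -> l = l'.
Proof. by move=> h h'; apply: (cvg_unique _ h h'); exact: Rhausdorff. Qed.

Lemma cvg_bigsum {T : Type} {F : set_system T} {FF : Filter F} (n : nat) (P : pred 'I_n)
    (f : 'I_n -> T -> R) (l : 'I_n -> R) :
  (forall i, f i x @[x --> F] --> l i) ->
  \sum_(i | P i) f i x @[x --> F] --> \sum_(i | P i) l i.
Proof.
move=> fl.
suff : forall s : seq 'I_n,
    \sum_(i <- s | P i) f i x @[x --> F] --> \sum_(i <- s | P i) l i by exact.
elim=> [|i s IH].
  rewrite big_nil.
  by under eq_fun do rewrite big_nil; exact: cvg_cst.
rewrite big_cons; under eq_fun do rewrite big_cons.
by case: (P i) => //; exact: cvgD.
Qed.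

Lemma cvg_shift_pinfty f c l :
  f t @[t --> +oo] --> l -> f (t + c) @[t --> +oo] --> l.
Proof.
move=> fl; apply: (cvg_comp _ f _ fl); apply/cvgryPge => A.
near=> t; rewrite -lerBlDr; near: t; exact: nbhs_pinfty_ge (num_real _).
Unshelve. all: by end_near. Qed.

Lemma cvg_shift_ninfty f c l :
  f t @[t --> -oo] --> l -> f (t + c) @[t --> -oo] --> l.
Proof.
move=> fl; apply: (cvg_comp _ f _ fl); apply/cvgrNyPle => A.
near=> t; rewrite -lerBrDr; near: t; exact: nbhs_ninfty_le (num_real _).
Unshelve. all: by end_near. Qed.

Lemma cvg_reflect_pinfty f l : f t @[t --> -oo] --> l -> f (- t) @[t --> +oo] --> l.
Proof. by move=> fl; exact: (proj1 (cvgNy_compNP f (nbhs l)) fl). Qed.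

Lemma cvg_reflect_ninfty f l : f t @[t --> +oo] --> l -> f (- t) @[t --> -oo] --> l.
Proof. by move=> fl; exact: (proj1 (cvgy_compNP f (nbhs l)) fl). Qed.

Lemma nondecreasing_bounded_cvg f B :
  {homo f : x y / x <= y} -> (forall t, f t <= B) ->
  exists2 l, f t @[t --> +oo] --> l & forall t, f t <= l.
Proof.
move=> fh fB; exists (sup (range f)).
  by apply: nondecreasing_cvgr => //; exists B => _ [t _ <-].
move=> t; apply: ub_le_sup; last by exists t.
by exists B => _ [s _ <-].
Qed.

Lemma nondecreasing_bounded_cvgN f B :
  {homo f : x y / x <= y} -> (forall t, B <= f t) ->
  exists2 l, f t @[t --> -oo] --> l & forall t, l <= f t.
Proof.
move=> fh fB.
have [|t|l fl lb] := @nondecreasing_bounded_cvg (fun t => - f (- t)) (- B).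
- by move=> x y xy; rewrite lerN2; apply: fh; rewrite lerN2.
- by rewrite lerN2.
exists (- l); last by move=> t; rewrite lerNl; have := lb (- t); rewrite opprK.
apply: cvg_trans (cvgN (cvg_reflect_ninfty fl)).
by apply: near_eq_cvg; apply: nearW => t /=; rewrite fctE !opprK.
Qed.

Lemma nondecreasing_le_lim f l :
  {homo f : x y / x <= y} -> f t @[t --> +oo] --> l -> forall t, f t <= l.
Proof.
move=> fh fl t; apply: (cvg_ge_of_near fl); near=> s; apply: fh.
by near: s; exact: nbhs_pinfty_ge (num_real _).
Unshelve. all: by end_near. Qed.

Lemma nondecreasing_ge_lim f l :
  {homo f : x y / x <= y} -> f t @[t --> -oo] --> l -> forall t, l <= f t.
Proof.
move=> fh fl t; apply: (cvg_le_of_near fl); near=> s; apply: fh.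
by near: s; exact: nbhs_ninfty_le (num_real _).
Unshelve. all: by end_near. Qed.

Lemma derive_homo f g :
  (forall t, is_derive t 1 f (g t)) -> (forall t, 0 <= g t) -> {homo f : x y / x <= y}.
Proof. by move=> df g0 x y xy; apply: (derive_ge0_le xy). Qed.

(* A density with bounded logarithmic derivative cannot drop by more than a
   constant factor over a unit of time, so it is controlled by the mass of a
   unit interval. *)
Lemma density_le_increment (m V g : R -> R) C t :
  (forall t, is_derive t 1 m (V t)) ->
  (forall t, is_derive t 1 V (V t * g t)) ->
  (forall t, 0 <= V t) -> (forall t, `|g t| <= C) ->
  V t * expR (- C) <= m (t + 1) - m t.
Proof.
move=> dm dV V0 gC.
have t1 : t <= t + 1 by rewrite lerDl.
have [c /andP[tc ct] ->] := mean_value t1 (fun s _ => dm s).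
rewrite addrAC subrr add0r mulr1.
(* The factor [expR (C * s)] compensates the fastest possible decay of [V], so the product is
   nondecreasing. *)
have H : V t * expR (C * t) <= V c * expR (C * c).
  apply: (@derive_ge0_le _ (fun s => V s * expR (C * s))
    (fun s => V s * (expR (C * s) * (C * 1)) + expR (C * s) * (V s * g s))) => // s _.
    exact: is_derive_mul (dV s) (is_derive_exp (is_derive_scale C (is_derive_idfun s))).
  rewrite mulr1; have -> : V s * (expR (C * s) * C) + expR (C * s) * (V s * g s) =
    V s * expR (C * s) * (C + g s) by ring.
  rewrite mulr_ge0// ?mulr_ge0// ?expR_ge0//.
  by have := gC s; rewrite ler_norml => /andP[? _]; lra.
have C0 : 0 <= C by apply: le_trans (gC t).
have -> : V c = V c * expR (C * c) * expR (- (C * c)) by rewrite -mulrA -expRD subrr expR0 mulr1.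
apply: le_trans (ler_wpM2r (expR_ge0 _) H).
rewrite -mulrA -expRD ler_wpM2l// ler_expR.
have : C * (c - t) <= C * 1 by apply: ler_wpM2l => //; lra.
lra.
Qed.

(** The increment of [m] over a unit of time tends to [0] as soon as [m t] and [m (t + 1)] have the
    same limit, and it dominates [V t] up to the factor [expR C]. The filter is arbitrary so that
    both ends of the line are covered. *)
Lemma density_cvg0 {F : set_system R} {FF : Filter F} (m V g : R -> R) C l :
  (forall t, is_derive t 1 m (V t)) ->
  (forall t, is_derive t 1 V (V t * g t)) ->
  (forall t, 0 <= V t) -> (forall t, `|g t| <= C) ->
  m t @[t --> F] --> l -> m (t + 1) @[t --> F] --> l ->
  V t @[t --> F] --> 0.
Proof.
move=> dm dV V0 gC ml ml1.
have H : expR C * (m (t + 1) - m t) @[t --> F] --> 0.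
  rewrite -(mulr0 (expR C)) -(subrr l).
  by apply: cvgM; [exact: cvg_cst|exact: cvgB].
apply: (squeeze_cvgr _ (cvg_cst 0) H); apply: nearW => t.
rewrite V0/= mulrC -ler_pdivrMr ?expR_gt0// -expRN.
exact: density_le_increment dm dV V0 gC.
Qed.

End Limits.

(** * Primitives of continuous functions on the line *)

Section Primitive.
Context {R : realType}.
Implicit Types (f F : R -> R).

(** The integral from a base point is differentiated only to the right of it. The base point [-1]
    rather than [0] leaves an overlap []-1, 1[] in which two such halves can be glued. *)
Let half_primitive f : continuous f ->
  exists F, forall t : R, -1 < t -> is_derive t 1 F (f t).
Proof.
move=> cf; exists (fun x => \int[@lebesgue_measure R]_(s in `[-1, x]) f s)%R => t t1.
have int : (@lebesgue_measure R).-integrable `[-1, t + 1] (EFin \o f).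
  apply: continuous_compact_integrable; first exact: segment_compact.
  exact: continuous_subspaceT.
have [|dF E] := continuous_FTC1_closed _ int t1 (cf t); first by rewrite ltrDl.
by apply: (DeriveDef dF); rewrite -derive1E.
Qed.

(** The half line on the left is obtained by reflection. On the overlap both candidates have
    derivative [f], hence differ by the constant [c], and the glued function is differentiable at
    [0] as well. *)
Lemma continuous_primitive f : continuous f ->
  exists F, forall t : R, is_derive t 1 F (f t).
Proof.
move=> cf; have [F dF] := half_primitive cf.
have cfN : continuous (fun x => f (- x)).
  by move=> x; apply: continuous_comp; [exact: opp_continuous|exact: cf].
have [G dG] := half_primitive cfN.
have dGN (t : R) : t < 1 -> is_derive t 1 (fun x => - G (- x)) (f t).
  move=> t1; rewrite -[f t]opprK; apply: is_derive_opp; apply: is_derive_reflect.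
  by rewrite -[in f t](opprK t); apply: dG; rewrite ltrN2.
pose c := F 0 + G 0.
exists (fun x => if 0 <= x then F x else - G (- x) + c) => t.
have [t0|t0] := ltP t 0.
  apply: (near_eq_is_derive (f := fun x => - G (- x) + c)).
    by near=> x; rewrite leNgt ifN// negbK; near: x; exact: lt_nbhsl.
  have t1 : t < 1 by lra.
  by have := is_derive_add (dGN t t1) (is_derive_const c t); rewrite addr0.
apply: (near_eq_is_derive (f := F)); last by apply: dF; lra.
have tm : -1 < t by lra.
near=> x; case: (leP 0 x) => // x0.
have x1 : -1 < x by near: x; exact: lt_nbhsr.
pose D y := F y - (- G (- y) + c).
have dD (y : R) : x <= y <= 0 -> is_derive y 1 D 0.
  move=> /andP[xy y0]; have y1 : -1 < y by lra.
  have y1' : y < 1 by lra.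
  have := is_derive_sub (dF y y1) (is_derive_add (dGN y y1') (is_derive_const c y)).
  by rewrite addr0 subrr.
have [s _] := mean_value (ltW x0) dD.
rewrite mul0r {1}/D oppr0 /c => H; apply/eqP; rewrite -subr_eq0 -/(D x); apply/eqP.
by move: H; rewrite /D /c; lra.
Unshelve. all: by end_near. Qed.

End Primitive.

(** * Limits along an ultrafilter *)

Section UltraLimits.
Context {R : realType}.
Variables (U : set_system nat).
Hypothesis (UU : UltraFilter U).

(** Compactness of [[- B, B]] gives a cluster point, and a cluster point of an ultrafilter is a
    limit: otherwise the complement of a neighbourhood would belong to the ultrafilter and still
    have to meet that neighbourhood. *)
Lemma ultra_bounded_cvg (x : nat -> R) (B : R) :
  (\forall k \near U, `|x k| <= B) -> exists l : R, x k @[k --> U] --> l.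
Proof.
move=> xB; have FU : ProperFilter U by exact: ultra_proper.
have [l [_ lU]] : `[- B, B] `&` cluster (fmap x U : set_system R) !=set0.
  apply: (@segment_compact _ (- B) B (fmap x U)).
  by apply: filterS xB => k /=; rewrite in_itv/= -ler_norml.
exists l => N Nl /=.
have [//|NU] := in_ultra_setVsetC (x @^-1` N) UU.
have [y [Ny Ny']] := lU (~` N) N NU Nl.
by [].
Qed.

(* The second order Taylor remainder survives a pointwise limit, so that
   differentiability of the limit needs no uniform convergence. *)
Lemma ultra_derive (f : nat -> R -> R) (F : R -> R) (g : nat -> R) (G t0 d C : R) :
  0 < d -> 0 <= C ->
  (forall t, `|t - t0| < d -> f k t @[k --> U] --> F t) ->
  g k @[k --> U] --> G ->
  (\forall k \near U, forall t, `|t - t0| < d ->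
     `|f k t - f k t0 - (t - t0) * g k| <= C * (t - t0) ^+ 2) ->
  is_derive t0 1 F G.
Proof.
move=> d0 C0 fF gG Hk; have FU : ProperFilter U by exact: ultra_proper.
have H (t : R) : `|t - t0| < d -> `|F t - F t0 - (t - t0) * G| <= C * (t - t0) ^+ 2.
  move=> td.
  have : `|f k t - f k t0 - (t - t0) * g k| @[k --> U] --> `|F t - F t0 - (t - t0) * G|.
    apply: cvg_norm; apply: cvgB; last by apply: cvgM gG; exact: cvg_cst.
    by apply: cvgB; apply: fF => //; rewrite subrr normr0.
  move=> /cvg_le_of_near; apply.
  by apply: filterS Hk => k; exact.
have dF : h^-1 *: (F (h *: 1 + t0) - F t0) @[h --> 0^'] --> G.
  apply/cvgrPdist_le => e e0.
  (* Below [d] the remainder estimate applies; below [e / (C + 1)] its quotient by [|h|], at most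
     [C * |h|], does not exceed [e]. The [+ 1] covers [C = 0]. *)
  have dd : 0 < Num.min d (e / (C + 1)).
    by rewrite lt_min d0/= divr_gt0//; lra.
  near=> h.
  have h0 : h != 0 by near: h; exact: nbhs_dnbhs_neq.
  have hd : `|h| < Num.min d (e / (C + 1)).
    by near: h; apply: dnbhs0_lt.
  move: hd; rewrite lt_min => /andP[hd he].
  have := H (h *: 1 + t0); rewrite /GRing.scale/= mulr1 addrK => /(_ hd) Hh.
  have -> : G - h^-1 * (F (h + t0) - F t0) = - (h^-1 * (F (h + t0) - F t0 - h * G)).
    by field.
  rewrite normrN normrM normfV ler_pdivrMl ?normr_gt0//.
  apply: le_trans Hh _.
  rewrite -real_normK ?num_real// expr2 mulrA mulrC ler_wpM2l// ?normr_ge0//.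
  move: he; rewrite ltr_pdivlMr; last lra.
  have := normr_ge0 h; nra.
apply: DeriveDef; first by apply/cvg_ex; exists G.
exact: (cvg_lim (@Rhausdorff R) dF).
Unshelve. all: by end_near. Qed.

End UltraLimits.

(** * The autonomous system and the Pohozaev identity *)

Section Lambda.
Context {R : realType} {n : nat}.
Variables (A : 'M[R]_n) (beta : 'I_n -> R).
Hypothesis A_sym : A^T = A.
Hypothesis A_ge0 : forall i j, 0 <= A i j.
Implicit Types (J : {set 'I_n}) (m : 'I_n -> R -> R) (x : 'I_n -> R).

Lemma mx_symE i j : A i j = A j i.
Proof. by rewrite -[in LHS]A_sym mxE. Qed.

(** If every entry from [J] to its complement vanished, the two sets would form a decomposition
    excluded by irreducibility; nonnegativity turns a nonzero entry into a positive one. *)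
Lemma irreducible_edge J : irreducible_mx A -> J != finset.set0 -> J != [set: 'I_n]%SET ->
  exists i j, [/\ i \in J, j \notin J & 0 < A i j].
Proof.
move=> irr J0 JT; apply: contrapT => H; apply: irr; exists J, (~: J)%SET; split => //.
- by apply: contra_neq JT => /(congr1 (@finset.setC _)); rewrite finset.setCK finset.setC0.
- exact: finset.setICr.
- exact: finset.setUCr.
- move=> i j iJ; rewrite inE => jJ; apply/eqP; rewrite eq_le A_ge0 andbT leNgt.
  by apply/negP => Aij; apply: H; exists i, j.
Qed.

(** Symmetry of [A] makes the two terms of the product rule equal, whence the common factor 2. *)
Lemma is_derive_Lambda J m (v : 'I_n -> R) (t : R) :
  (forall i, is_derive t 1 (m i) (v i)) ->
  is_derive t 1 (fun s => Lambda A beta J (fun i => m i s))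
    (2 * \sum_(i in J) v i * (beta i + 2 - \sum_(j in J) A i j * m j t)).
Proof.
move=> dm.
have d1 := is_derive_scale 2 (is_derive_bigsum (fun i => i \in J)
  (fun i => is_derive_scale (beta i + 2) (dm i))).
have d2 := is_derive_bigsum (fun i => i \in J) (fun i =>
  is_derive_bigsum (fun j => j \in J) (fun j =>
    is_derive_mul (is_derive_scale (A i j) (dm i)) (dm j))).
have := is_derive_sub d1 d2; rewrite /Lambda; set X := (X in is_derive _ _ _ X -> _).
suff -> : X = 2 * \sum_(i in J) v i * (beta i + 2 - \sum_(j in J) A i j * m j t) by [].
rewrite {}/X.
under [X in _ - X]eq_bigr do rewrite big_split/=.
rewrite big_split/=.
have -> : \sum_(i in J) \sum_(j in J) A i j * m i t * v j =
          \sum_(i in J) \sum_(j in J) m j t * (A i j * v i).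
  rewrite exchange_big/=; apply: eq_bigr => i _; apply: eq_bigr => j _.
  by rewrite mx_symE; ring.
have E (x y : R) : 2 * x - (y + y) = 2 * (x - y) by ring.
rewrite E -sumrB; congr (2 * _).
apply: eq_bigr => i _; rewrite mulrBr mulrC; congr (_ - _).
by rewrite mulr_sumr; apply: eq_bigr => j _; ring.
Qed.

Lemma cvg_Lambda {T : Type} {F : set_system T} {FF : Filter F} J (m : 'I_n -> T -> R) x :
  (forall i, m i s @[s --> F] --> x i) ->
  Lambda A beta J (fun i => m i s) @[s --> F] --> Lambda A beta J x.
Proof.
move=> mx; apply: cvgB.
  apply: cvgM; first exact: cvg_cst.
  by apply: cvg_bigsum => i; apply: cvgM; [exact: cvg_cst|exact: mx].
apply: cvg_bigsum => i; apply: cvg_bigsum => j.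
by apply: cvgM; [apply: cvgM; [exact: cvg_cst|exact: mx]|exact: mx].
Qed.

Lemma Lambda0 J : Lambda A beta J (fun=> 0) = 0.
Proof.
rewrite /Lambda big1 ?mulr0 ?sub0r => [|i _]; last by rewrite mulr0.
by rewrite big1 ?oppr0// => i _; rewrite big1// => j _; rewrite mulr0.
Qed.

End Lambda.

(* In the variable t = ln r, with w i t = u i r + b i * t and b i = beta i + 2,
   the radial system becomes this autonomous one, m i being the mass of
   component i inside the disc of radius r. *)
Definition flow {R : realType} {n : nat} (A : 'M[R]_n) (b sigma : 'I_n -> R)
    (m w : 'I_n -> R -> R) : Prop :=
  forall i,
    [/\ forall t : R, is_derive t 1 (m i) (expR (w i t)),
        forall t : R, is_derive t 1 (w i) (b i - \sum_j A i j * m j t),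
        m i t @[t --> -oo] --> 0 &
        m i t @[t --> +oo] --> sigma i].

Section Flow.
Context {R : realType} {n : nat}.
Variables (A : 'M[R]_n) (b sigma : 'I_n -> R) (m w : 'I_n -> R -> R).
Hypothesis A_ge0 : forall i j, 0 <= A i j.
Hypothesis mw : flow A b sigma m w.
Implicit Types (i j : 'I_n) (s t : R).

Lemma flow_mass_derive i t : is_derive t 1 (m i) (expR (w i t)).
Proof. by have [] := mw i. Qed.

Lemma flow_log_derive i t : is_derive t 1 (w i) (b i - \sum_j A i j * m j t).
Proof. by have [] := mw i. Qed.

Lemma flow_homo i : {homo m i : x y / x <= y}.
Proof. by have [dm _ _ _] := mw i; apply: derive_homo dm _ => t; exact: expR_ge0. Qed.

Lemma flow_ge0 i t : 0 <= m i t.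
Proof. by have [_ _ m0 _] := mw i; exact: nondecreasing_ge_lim (@flow_homo i) m0 t. Qed.

Lemma flow_le i t : m i t <= sigma i.
Proof. by have [_ _ _ mS] := mw i; exact: nondecreasing_le_lim (@flow_homo i) mS t. Qed.

Lemma flow_lt i s t : s < t -> m i s < m i t.
Proof.
by have [dm _ _ _] := mw i; move=> st; apply: (derive_gt0_lt st) => // x _; exact: expR_gt0.
Qed.

Lemma flow_gt0 i t : 0 < m i t.
Proof. by apply: le_lt_trans (flow_ge0 i (t - 1)) (flow_lt _ _); lra. Qed.

Lemma flow_lt_total i t : m i t < sigma i.
Proof. by apply: lt_le_trans (flow_lt _ _) (flow_le i (t + 1)); lra. Qed.

(** The masses stay between [0] and [sigma], so the logarithmic derivatives of the densities are
    bounded on the whole line; summing the bounds over the components gives one constant for all. *)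
Lemma flow_slope_bound :
  exists2 C, 0 <= C & forall i t, `|b i - \sum_j A i j * m j t| <= C.
Proof.
pose B i := `|b i| + \sum_j A i j * sigma j.
have B0 i : 0 <= B i.
  rewrite addr_ge0// sumr_ge0// => j _; rewrite mulr_ge0//.
  exact: le_trans (flow_ge0 j 0) (flow_le j 0).
exists (\sum_i B i); first exact: sumr_ge0.
move=> i t; apply: (@le_trans _ _ (B i)); last first.
  by rewrite (bigD1 i)//= lerDl sumr_ge0.
rewrite (le_trans (ler_normB _ _))// lerD2l ger0_norm.
  by apply: ler_sum => j _; rewrite ler_wpM2l// flow_le.
by apply: sumr_ge0 => j _; rewrite mulr_ge0// flow_ge0.
Qed.

Lemma flow_density_derive i t :
  is_derive t 1 (fun s => expR (w i s))
    (expR (w i t) * (b i - \sum_j A i j * m j t)).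
Proof. by have [_ dw _ _] := mw i; exact: is_derive_exp. Qed.

Lemma flow_density_cvgN i : expR (w i t) @[t --> -oo] --> 0.
Proof.
have [C C0 wC] := flow_slope_bound; have [dm _ m0 _] := mw i.
apply: (density_cvg0 dm (flow_density_derive i) _ (wC i) m0) => [t|].
  exact: expR_ge0.
exact: cvg_shift_ninfty.
Qed.

Lemma flow_density_cvgy i : expR (w i t) @[t --> +oo] --> 0.
Proof.
have [C C0 wC] := flow_slope_bound; have [dm _ _ mS] := mw i.
apply: (density_cvg0 dm (flow_density_derive i) _ (wC i) mS) => [t|].
  exact: expR_ge0.
exact: cvg_shift_pinfty.
Qed.

End Flow.

Section Pohozaev.
Context {R : realType} {n : nat}.
Variables (A : 'M[R]_n) (beta sigma : 'I_n -> R) (m w : 'I_n -> R -> R).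
Hypothesis A_sym : A^T = A.
Hypothesis A_ge0 : forall i j, 0 <= A i j.
Hypothesis mw : flow A (fun i => beta i + 2) sigma m w.
Implicit Types (J : {set 'I_n}).

(** Defect in the Pohozaev identity of [J]: it vanishes at [-oo] and tends to
    [Lambda A beta J sigma] at [+oo], because the densities vanish at both ends. Its growth measures
    the coupling between [J] and its complement. *)
Let H J t := Lambda A beta J (fun i => m i t) - 2 * \sum_(i in J) expR (w i t).

Let dH J (t : R) : is_derive t 1 (H J)
  (2 * \sum_(i in J) expR (w i t) * \sum_(j | j \notin J) A i j * m j t).
Proof.
have d1 := is_derive_Lambda beta A_sym J (fun i => flow_mass_derive mw i t).
have d2 := is_derive_scale 2 (is_derive_bigsum (fun i => i \in J)
  (fun i => flow_density_derive mw i t)).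
have := is_derive_sub d1 d2; rewrite -mulrBr -sumrB.
set X := (X in is_derive _ _ _ X -> _); set Y := (Y in _ -> is_derive _ _ _ Y).
suff -> : X = Y by [].
rewrite /X /Y; congr (2 * _); apply: eq_bigr => i _; rewrite -mulrBr; congr (_ * _).
(* The coupling inside [J] cancels between the two derivatives; the coupling with the complement is
   what remains. *)
rewrite [X in _ - (_ - X)](bigID (fun j => j \in J))/=; lra.
Qed.

Let H_cvgN J : H J t @[t --> -oo] --> 0.
Proof.
have -> : 0 = Lambda A beta J (fun=> 0) - 2 * \sum_(i in J) 0 :> R.
  by rewrite Lambda0 big1// mulr0 subr0.
apply: cvgB; first by apply: cvg_Lambda => i; have [] := mw i.
apply: cvgM; first exact: cvg_cst.
by apply: cvg_bigsum => i; exact: flow_density_cvgN A_ge0 mw i.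
Qed.

Let H_cvgy J : H J t @[t --> +oo] --> Lambda A beta J sigma.
Proof.
have -> : Lambda A beta J sigma = Lambda A beta J sigma - 2 * \sum_(i in J) 0 :> R.
  by rewrite big1// mulr0 subr0.
apply: cvgB; first by apply: cvg_Lambda => i; have [] := mw i.
apply: cvgM; first exact: cvg_cst.
by apply: cvg_bigsum => i; exact: flow_density_cvgy A_ge0 mw i.
Qed.

Let dH_ge0 J (t : R) : 0 <= 2 * \sum_(i in J) expR (w i t) * \sum_(j | j \notin J) A i j * m j t.
Proof.
rewrite mulr_ge0// sumr_ge0// => i _; rewrite mulr_ge0 ?expR_ge0// sumr_ge0// => j _.
by rewrite mulr_ge0// (flow_ge0 mw).
Qed.

Lemma flow_Lambda_cond : irreducible_mx A -> Lambda_cond A beta sigma.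
Proof.
move=> irr; split.
  pose J := [set: 'I_n]%SET.
  have HJ (t : R) : is_derive t 1 (H J) 0.
    have := dH J t; rewrite big1 ?mulr0// => i _.
    by rewrite big_pred0 ?mulr0// => j; rewrite !inE.
  have cH t : H J t = H J 0 by exact: derive0_const.
  apply: (@cvg_eq_unique _ _ +oo _ (H J)); first exact: H_cvgy.
  have -> : 0 = H J 0.
    apply: (@cvg_eq_unique _ _ -oo _ (H J)) => //.
    by under eq_fun do rewrite cH; exact: cvg_cst.
  by under eq_fun do rewrite cH; exact: cvg_cst.
move=> J J0 JT.
have [i [j [iJ jJ Aij]]] := irreducible_edge A_ge0 irr J0 JT.
have Hh : {homo H J : x y / x <= y} by exact: derive_homo (dH J) (dH_ge0 J).
(* Strict growth on [[-1, 0]] is enough, monotonicity takes care of the two half lines; the edge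
   leaving [J] contributes a positive term. *)
apply: lt_le_trans (nondecreasing_le_lim Hh (@H_cvgy J) 0).
apply: le_lt_trans (nondecreasing_ge_lim Hh (@H_cvgN J) (-1)) _.
apply: (derive_gt0_lt _ (fun t _ => dH J t)); first lra.
move=> t _; rewrite mulr_gt0// (bigD1 i)//= ltr_pwDl//.
  rewrite mulr_gt0 ?expR_gt0// (bigD1 j)//= ltr_pwDl//.
    by rewrite mulr_gt0// (flow_gt0 mw).
  by rewrite sumr_ge0// => k _; rewrite mulr_ge0// (flow_ge0 mw).
rewrite sumr_ge0// => k _; rewrite mulr_ge0 ?expR_ge0// sumr_ge0// => l _.
by rewrite mulr_ge0// (flow_ge0 mw).
Qed.

End Pohozaev.

(** * Uniqueness up to translation *)

Section HalfLine.
Context {R : realType}.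
Implicit Types (f g : R -> R) (t T l C c : R).

Lemma derive_ge0_ge_limN f g T l :
  (forall t, t <= T -> is_derive (t : R) 1 f (g t)) -> (forall t, t <= T -> 0 <= g t) ->
  f t @[t --> -oo] --> l -> forall t, t <= T -> l <= f t.
Proof.
move=> df g0 fl t tT; apply: (cvg_le_of_near fl); near=> s.
have st : s <= t by near: s; exact: nbhs_ninfty_le (num_real _).
apply: (derive_ge0_le st (g := g)) => x /andP[_ xt].
  by apply: df; exact: le_trans tT.
by apply: g0; exact: le_trans tT.
Unshelve. all: by end_near. Qed.

Lemma derive_le0_ge_limy f g T l :
  (forall t, T <= t -> is_derive (t : R) 1 f (g t)) -> (forall t, T <= t -> g t <= 0) ->
  f t @[t --> +oo] --> l -> forall t, T <= t -> l <= f t.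
Proof.
move=> df g0 fl t tT; apply: (cvg_le_of_near fl); near=> s.
have st : t <= s by near: s; exact: nbhs_pinfty_ge (num_real _).
apply: (derive_le0_ge st (g := g)) => x /andP[tx _].
  by apply: df; exact: le_trans tx.
by apply: g0; exact: le_trans tx.
Unshelve. all: by end_near. Qed.

Lemma near0_mul_le C c : 0 <= C -> 0 < c -> \forall e \near 0^'+, C * e <= c.
Proof.
move=> C0 c0; near=> e.
have : e <= c / (C + 1) by near: e; apply: nbhs_right_le; rewrite divr_gt0//; lra.
have e0 : 0 < e by near: e; exact: nbhs_right_gt.
by rewrite ler_pdivlMr; [nra|lra].
Unshelve. all: by end_near. Qed.

End HalfLine.

Section FlowSymmetries.
Context {R : realType} {n : nat}.
Variables (A : 'M[R]_n) (b sigma : 'I_n -> R) (m w : 'I_n -> R -> R).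
Hypothesis mw : flow A b sigma m w.

Lemma flow_shift c : flow A b sigma (fun i t => m i (t + c)) (fun i t => w i (t + c)).
Proof.
move=> i; have [dm dw m0 mS] := mw i; split.
- by move=> t; exact: is_derive_shiftr.
- by move=> t; exact: is_derive_shiftr.
- exact: cvg_shift_ninfty.
- exact: cvg_shift_pinfty.
Qed.

(** The mass still to come, [sigma i - m i (- t)], plays the role of the mass, and [b] is replaced
    by [A sigma - b]. Every statement about [-oo] can thus be used at [+oo]. *)
Lemma flow_reverse : flow A (fun i => \sum_j A i j * sigma j - b i) sigma
  (fun i t => sigma i - m i (- t)) (fun i t => w i (- t)).
Proof.
move=> i; have [dm dw m0 mS] := mw i; split.
- move=> t; have := is_derive_sub (is_derive_const (sigma i) t) (is_derive_reflect (dm (- t))).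
  by rewrite sub0r opprK.
- move=> t; have := is_derive_reflect (dw (- t)).
  set X := (X in is_derive _ _ _ X -> _); set Y := (Y in _ -> is_derive _ _ _ Y).
  suff -> : X = Y by [].
  rewrite /X /Y; under [X in _ = _ - X]eq_bigr do rewrite mulrBr.
  by rewrite sumrB; lra.
- rewrite -(subrr (sigma i)); apply: cvgB; first exact: cvg_cst.
  exact: cvg_reflect_ninfty.
- rewrite -[X in _ --> X]subr0; apply: cvgB; first exact: cvg_cst.
  exact: cvg_reflect_pinfty.
Qed.

End FlowSymmetries.

Section LeftEnd.
Context {R : realType} {n : nat}.
Variables (A : 'M[R]_n) (b sigma : 'I_n -> R) (m w : 'I_n -> R -> R).
Hypothesis A_ge0 : forall i j, 0 <= A i j.
Hypothesis b_gt0 : forall i, 0 < b i.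
Hypothesis mw : flow A b sigma m w.
Implicit Types (i j : 'I_n) (s t T : R).

(** Near [-oo] the logarithmic slope of the density is close to [b i > 0], hence at least [b i / 2];
    integrating [expR (w i) - b i / 2 * m i] from [-oo] gives the bound there. On the remaining
    bounded interval the density is bounded below and the mass by [sigma i]. *)
Lemma flow_mass_le_density T :
  exists2 K, 0 <= K & forall i t, t <= T -> m i t <= K * expR (w i t).
Proof.
suff H i : exists2 K, 0 <= K & forall t, t <= T -> m i t <= K * expR (w i t).
  have {}H i : exists K, 0 <= K /\ forall t, t <= T -> m i t <= K * expR (w i t).
    by have [K K0 HK] := H i; exists K.
  have [K HK] := boolp.choice H.
  exists (\sum_i K i); first by apply: sumr_ge0 => i _; have [] := HK i.
  move=> i t tT; have [_ /(_ _ tT) h] := HK i; apply: le_trans h _.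
  rewrite ler_wpM2r ?expR_ge0// (bigD1 i)//= lerDl sumr_ge0// => j _.
  by have [] := HK j.
have [C C0 wC] := flow_slope_bound A_ge0 mw.
have cm : \sum_j A i j * m j t @[t --> -oo] --> 0.
  rewrite -[X in _ --> X](_ : \sum_j A i j * 0 = _); last by rewrite big1// => j _; rewrite mulr0.
  apply: cvg_bigsum => j; apply: cvgM; first exact: cvg_cst.
  by have [] := mw j.
have [T0 [_ HT0]] : \forall t \near -oo, \sum_j A i j * m j t <= b i / 2.
  by apply: cvgr_le cm _ _; rewrite divr_gt0.
have {}HT0 t : t <= T0 - 1 -> \sum_j A i j * m j t <= b i / 2.
  by move=> tT; apply: HT0; lra.
have left t : t <= T0 - 1 -> b i / 2 * m i t <= expR (w i t).
  move=> tT; rewrite -subr_ge0.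
  pose g s := expR (w i s) * (b i - \sum_j A i j * m j s) - b i / 2 * expR (w i s).
  apply: (@derive_ge0_ge_limN _ (fun s => expR (w i s) - b i / 2 * m i s) g (T0 - 1)) => //.
  - move=> s _; exact: is_derive_sub (flow_density_derive mw i s)
      (is_derive_scale _ (flow_mass_derive mw i s)).
  - move=> s /HT0 sb; rewrite /g mulrC -mulrBl mulr_ge0 ?expR_ge0//; lra.
  - rewrite -[X in _ --> X](subr0 0); apply: cvgB; first exact: flow_density_cvgN A_ge0 mw i.
    rewrite -[X in _ --> X](mulr0 (b i / 2)); apply: cvgM; first exact: cvg_cst.
    by have [] := mw i.
have sig0 : 0 <= sigma i by apply: le_trans (flow_ge0 mw i 0) (flow_le mw i 0).
pose t1 := T0 - 1.
(* The first summand covers [t <= t1], the second the times between [t1] and [T], where the density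
   is at least [expR (w i t1 - C * |T - t1|)]. *)
exists (2 / b i + sigma i * expR (- w i t1 + C * `|T - t1|)).
  by rewrite addr_ge0// ?divr_ge0 ?(ltW (b_gt0 i))// mulr_ge0// expR_ge0.
move=> t tT; rewrite mulrDl; have [tt|tt] := leP t t1.
  apply: (@le_trans _ _ (2 / b i * expR (w i t))); last first.
    by rewrite lerDl mulr_ge0 ?expR_ge0// mulr_ge0// expR_ge0.
  rewrite -(ler_pM2l (x := b i / 2)) ?divr_gt0// mulrA.
  have -> : b i / 2 * (2 / b i) = 1 by field; rewrite gt_eqF.
  by rewrite mul1r; exact: left.
apply: (@le_trans _ _ (sigma i)); first exact: flow_le mw _ _.
apply: (@le_trans _ _ (sigma i * (expR (- w i t1 + C * `|T - t1|) * expR (w i t)))); last first.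
  by rewrite mulrA lerDr mulr_ge0 ?expR_ge0// divr_ge0// ltW.
rewrite -expRD -[X in X <= _]mulr1 ler_wpM2l// -expR0 ler_expR.
have := derive_lipschitz (ltW tt) (fun s _ => flow_log_derive mw i s) (fun s _ => wC i s).
rewrite ler_norml => /andP[h _].
have : C * (t - t1) <= C * `|T - t1|.
  by apply: ler_wpM2l => //; apply: le_trans (ler_norm _); lra.
lra.
Qed.

(** The function [w i t - b i * t] has derivative [- \sum_j A i j * m j t], so it is nonincreasing;
    adding [K * \sum_j A i j * m j t] makes it nondecreasing, because masses are bounded by
    densities. In terms of a solution this is boundedness near the origin. *)
Lemma flow_left_end i :
  exists K, forall t, t <= 0 -> w i 0 <= w i t - b i * t <= K.
Proof.
have [K K0 mK] := flow_mass_le_density 0.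
exists (w i 0 + K * \sum_j A i j * m j 0) => t t0; apply/andP; split.
  have -> : w i 0 = w i 0 - b i * 0 by rewrite mulr0 subr0.
  apply: (@derive_le0_ge _ (fun s => w i s - b i * s)
      (fun s => b i - \sum_j A i j * m j s - b i * 1)) => // s _.
    exact: is_derive_sub (flow_log_derive mw i s) (is_derive_scale _ (is_derive_idfun s)).
  rewrite mulr1 addrAC subrr sub0r oppr_le0 sumr_ge0// => j _.
  by rewrite mulr_ge0// (flow_ge0 mw).
pose f s := w i s - b i * s + K * \sum_j A i j * m j s.
apply: (@le_trans _ _ (f t)).
  by rewrite /f lerDl mulr_ge0// sumr_ge0// => j _; rewrite mulr_ge0// (flow_ge0 mw).
have -> : w i 0 + K * \sum_j A i j * m j 0 = f 0 by rewrite /f mulr0 subr0.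
pose g s := b i - \sum_j A i j * m j s - b i * 1 + K * \sum_j A i j * expR (w j s).
apply: (@derive_ge0_le _ f g) => // s /andP[ts s0].
  exact: is_derive_add (is_derive_sub (flow_log_derive mw i s)
    (is_derive_scale _ (is_derive_idfun s)))
    (is_derive_scale K (is_derive_bigsum _
      (fun j => is_derive_scale (A i j) (flow_mass_derive mw j s)))).
have : \sum_j A i j * m j s <= K * \sum_j A i j * expR (w j s).
  rewrite mulr_sumr; apply: ler_sum => j _.
  by rewrite mulrCA ler_wpM2l// mK.
rewrite /g; lra.
Qed.

End LeftEnd.

Section LeftComparison.
Context {R : realType} {n : nat}.
Variables (A : 'M[R]_n) (b sigma : 'I_n -> R).
Hypothesis A_ge0 : forall i j, 0 <= A i j.
Hypothesis b_gt0 : forall i, 0 < b i.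
Implicit Types (i j : 'I_n) (s t h : R).

(** Up to bounded terms [w i s] and [v i s] both behave like [b i * s] on the left, so a shift by
    [h] gains [b i * h]. For large [h] the densities are ordered, and integration from [-oo] orders
    the masses. *)
Lemma flow_compare_left m w p v :
  flow A b sigma m w -> flow A b sigma p v ->
  \forall h \near +oo, forall i t, t + h <= 0 -> m i t <= p i (t + h).
Proof.
move=> mw pv; apply: filter_forall => i.
have [K HK] := flow_left_end A_ge0 b_gt0 mw i.
have [K' HK'] := flow_left_end A_ge0 b_gt0 pv i.
near=> h.
have h0 : 0 <= h by near: h; exact: nbhs_pinfty_ge (num_real _).
have hK : (K - v i 0) / b i <= h by near: h; exact: nbhs_pinfty_ge (num_real _).
rewrite ler_pdivrMr// in hK.
move=> t th; rewrite -subr_ge0.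
apply: (@derive_ge0_ge_limN _ (fun s => p i (s + h) - m i s)
   (fun s => expR (v i (s + h)) - expR (w i s)) (- h)) => [s _|s sh||]; last lra.
- exact: is_derive_sub (is_derive_shiftr (flow_mass_derive pv i _)) (flow_mass_derive mw i s).
- rewrite subr_ge0 ler_expR.
  have /andP[_ h1] : w i 0 <= w i s - b i * s <= K by apply: HK; lra.
  have /andP[h2 _] : v i 0 <= v i (s + h) - b i * (s + h) <= K' by apply: HK'; lra.
  lra.
- rewrite -[X in _ --> X](subr0 0); have [_ _ p0 _] := pv i; have [_ _ m0 _] := mw i.
  by apply: cvgB => //; exact: cvg_shift_ninfty.
Unshelve. all: by end_near. Qed.

(** Otherwise [w i] would be nondecreasing on the whole line, while the density has to vanish at
    [+oo]. This is the positivity required of the coefficients of the reversed system. *)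
Lemma flow_slope_end m w : flow A b sigma m w -> forall i, 0 < \sum_j A i j * sigma j - b i.
Proof.
move=> mw i; rewrite ltNge; apply/negP => le0.
have wh : {homo w i : x y / x <= y}.
  apply: derive_homo (flow_log_derive mw i) _ => t.
  have : \sum_j A i j * m j t <= \sum_j A i j * sigma j.
    by apply: ler_sum => j _; rewrite ler_wpM2l// (flow_le mw).
  lra.
have : expR (w i 0) <= 0; last by rewrite leNgt expR_gt0.
apply: (cvg_ge_of_near (flow_density_cvgy A_ge0 mw i)); near=> t.
by rewrite ler_expR; apply: wh; near: t; exact: nbhs_pinfty_ge (num_real _).
Unshelve. all: by end_near. Qed.

End LeftComparison.

Section Uniqueness.
Context {R : realType} {n : nat}.
Variables (A : 'M[R]_n) (b sigma : 'I_n -> R).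
Hypothesis A_ge0 : forall i j, 0 <= A i j.
Hypothesis b_gt0 : forall i, 0 < b i.
Implicit Types (i j : 'I_n) (s t h : R).

(** The left comparison, applied to the orbits and to their reversals, settles [t + h <= 0] and
    [0 <= t]. What lies between is settled by monotonicity alone. *)
Lemma flow_compare m w p v :
  flow A b sigma m w -> flow A b sigma p v ->
  exists h, forall i t, m i t <= p i (t + h).
Proof.
move=> mw pv; have L := flow_compare_left A_ge0 b_gt0 mw pv.
have g0 := flow_slope_end A_ge0 mw.
have L' := flow_compare_left A_ge0 g0 (flow_reverse pv) (flow_reverse mw).
(* The middle range is cut at [- h / 2]: on its left part [m i] is at most [m i (- h / 2)], which
   tends to [0], and [p i (t + h)] is at least [p i 0]; on its right part [m i] is at most [m i 0]
   and [p i (t + h)] at least [p i (h / 2)], which tends to [sigma i]. *)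
have M : \forall h \near +oo, forall i, m i (- h / 2) <= p i 0 /\ m i 0 <= p i (h / 2).
  apply: filter_forall => i; have [_ _ m0 _] := mw i; have [_ _ _ pS] := pv i.
  near=> h; split.
    near: h; have : m i (- h / 2) @[h --> +oo] --> 0.
      apply: (cvg_comp (fun h => - h / 2) (m i) _ m0); apply/cvgrNyPle => B.
      near=> h; rewrite ler_pdivrMr// lerNl; near: h; exact: nbhs_pinfty_ge (num_real _).
    by move=> /cvgr_le; apply; exact: (flow_gt0 pv).
  near: h; have : p i (h / 2) @[h --> +oo] --> sigma i.
    apply: (cvg_comp (fun h => h / 2) (p i) _ pS); apply/cvgryPge => B.
    near=> h; rewrite ler_pdivlMr//; near: h; exact: nbhs_pinfty_ge (num_real _).
  by move=> /cvgr_ge; apply; exact: (flow_lt_total mw).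
near (pinfty_nbhs R) => h; exists h => i t.
have h0 : 0 <= h by near: h; exact: nbhs_pinfty_ge (num_real _).
have Mh : forall i, m i (- h / 2) <= p i 0 /\ m i 0 <= p i (h / 2) by near: h.
have [Mh1 Mh2] := Mh i.
have [tl|tl] := leP (t + h) 0.
  have Lh : forall i t, t + h <= 0 -> m i t <= p i (t + h) by near: h.
  exact: Lh.
have [tr|tr] := leP 0 t.
  have Lh' : forall i t, t + h <= 0 -> sigma i - p i (- t) <= sigma i - m i (- (t + h)) by near: h.
  have := Lh' i (- (t + h)); rewrite opprK (_ : - (- (t + h) + h) = t); last lra.
  by move=> /(_ ltac:(lra)); lra.
have [tm|tm] := leP t (- h / 2).
  apply: (le_trans (flow_homo mw i tm)); apply: (le_trans Mh1).
  by apply: (flow_homo pv i); lra.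
apply: (le_trans (flow_homo mw i (ltW tr))); apply: (le_trans Mh2).
by apply: (flow_homo pv i); lra.
Unshelve. all: by end_near. Qed.

(* Where m i <= p i, the ratio of the densities is monotone, so m i - p i first
   decreases and then increases; either it vanishes identically or it stays
   away from 0 in the quantitative sense needed to move p a little further. *)
Lemma flow_touch m w p v i :
  flow A b sigma m w -> flow A b sigma p v ->
  (forall j t, m j t <= p j t) ->
  (forall t, w i t = v i t) \/
  \forall e \near 0^'+, forall t, m i t <= p i (t - e).
Proof.
move=> mw pv mp.
pose d t := w i t - v i t.
have dd (t : R) : is_derive t 1 d (\sum_j A i j * (p j t - m j t)).
  have := is_derive_sub (flow_log_derive mw i t) (flow_log_derive pv i t).
  set X := (X in is_derive _ _ _ X -> _); set Y := (Y in _ -> is_derive _ _ _ Y).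
  suff -> : X = Y by [].
  rewrite /X /Y; under [RHS]eq_bigr do rewrite mulrBr.
  by rewrite sumrB; lra.
have dh : {homo d : x y / x <= y}.
  apply: derive_homo dd _ => t; apply: sumr_ge0 => j _.
  by rewrite mulr_ge0// subr_ge0.
have dg (t : R) : is_derive t 1 (fun s => p i s - m i s) (expR (v i t) - expR (w i t)).
  exact: is_derive_sub (flow_mass_derive pv i t) (flow_mass_derive mw i t).
have [_ _ m0 mS] := mw i; have [_ _ p0 pS] := pv i.
have g0 : p i t - m i t @[t --> -oo] --> 0.
  by rewrite -[X in _ --> X](subr0 0); apply: cvgB.
have gS : p i t - m i t @[t --> +oo] --> 0.
  by rewrite -[X in _ --> X](subrr (sigma i)); apply: cvgB.
have eq_case : (forall t, p i t - m i t = 0) -> forall t, w i t = v i t.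
  move=> gE t; apply/expR_inj/esym/eqP; rewrite -subr_eq0.
  have := dg t; under eq_fun do rewrite gE.
  move=> [_ <-]; apply/eqP; exact: (@derive_val _ _ _ _ _ _ _ (is_derive_const 0 t)).
(* If [d] has a constant sign, [p i - m i] is monotone; being nonnegative and tending to [0] at both
   ends, it vanishes identically. *)
have [[t1 d1]|N1] := pselect (exists t1, d t1 < 0); last first.
  left; apply: eq_case => t; apply/eqP; rewrite eq_le subr_ge0 mp andbT.
  have d0 s : 0 <= d s by rewrite leNgt; apply/negP => ?; apply: N1; exists s.
  rewrite -oppr_ge0.
  apply: (@derive_ge0_ge_limN _ (fun t => - (p i t - m i t))
    (fun t => - (expR (v i t) - expR (w i t))) t) => //.
  - by move=> s _; rewrite oppr_ge0 subr_le0 ler_expR -subr_ge0; exact: d0.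
  - by rewrite -[X in _ --> X]oppr0; exact: cvgN.
have [[t2 d2]|N2] := pselect (exists t2, 0 < d t2); last first.
  left; apply: eq_case => t; apply/eqP; rewrite eq_le subr_ge0 mp andbT.
  have d0 s : d s <= 0 by rewrite leNgt; apply/negP => ?; apply: N2; exists s.
  rewrite -oppr_ge0.
  apply: (@derive_le0_ge_limy _ (fun t => - (p i t - m i t))
    (fun t => - (expR (v i t) - expR (w i t))) t) => //.
  - by move=> s _; rewrite oppr_le0 subr_ge0 ler_expR -subr_le0; exact: d0.
  - by rewrite -[X in _ --> X]oppr0; exact: cvgN.
right.
have gt1 : 0 < p i t1 - m i t1.
  apply: (@le_lt_trans _ _ (p i (t1 - 1) - m i (t1 - 1))); first by rewrite subr_ge0.
  apply: (@derive_gt0_lt _ _ _ (t1 - 1) t1 _ (fun s _ => dg s)); first lra.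
  move=> s /andP[_ st]; rewrite subr_gt0 ltr_expR -subr_lt0.
  exact: le_lt_trans (dh _ _ st) d1.
have gt2 : 0 < p i t2 - m i t2.
  rewrite -oppr_lt0.
  apply: (@lt_le_trans _ _ (- (p i (t2 + 1) - m i (t2 + 1)))); last by rewrite oppr_le0 subr_ge0.
  apply: (@derive_gt0_lt _ (fun s => - (p i s - m i s)) _ t2 (t2 + 1) _
    (fun s _ => is_derive_opp (dg s))); first lra.
  move=> s /andP[st _]; rewrite oppr_gt0 subr_lt0 ltr_expR -subr_gt0.
  exact: lt_le_trans d2 (dh _ _ st).
have [C C0 vC] := flow_slope_bound A_ge0 pv.
(* A bound for the density of [p i]: it is at most [expR C] times an increment of mass, and
   increments do not exceed [sigma i]. *)
pose B := expR C * sigma i.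
have vB s : `|expR (v i s)| <= B.
  rewrite ger0_norm ?expR_ge0// /B mulrC -ler_pdivrMr ?expR_gt0// -expRN.
  apply: le_trans (density_le_increment s (flow_mass_derive pv i)
    (flow_density_derive pv i) (fun t => expR_ge0 _) (vC i)) _.
  have := flow_le pv i (s + 1); have := flow_ge0 pv i s; lra.
have B0 : 0 <= B by apply: le_trans (vB 0).
near=> e.
have e0 : 0 < e by near: e; exact: nbhs_right_gt.
(* The conditions [e1] and [e2] preserve the sign of the logarithmic ratio left of [t1] and right of
   [t2] after the shift. Between [t1] and [t2] the gap [p i - m i] is at least the smaller of its
   two end values, and [e3], [e4] keep the loss [B * e] below both. *)
have e1 : C * e <= - d t1 by near: e; apply: near0_mul_le => //; rewrite oppr_gt0.
have e2 : C * e <= d t2 by near: e; exact: near0_mul_le.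
have e3 : B * e <= p i t1 - m i t1 by near: e; exact: near0_mul_le.
have e4 : B * e <= p i t2 - m i t2 by near: e; exact: near0_mul_le.
have ve s : `|v i s - v i (s - e)| <= C * e.
  have se : s - e <= s by rewrite gerBl ltW.
  have := derive_lipschitz se (fun x _ => flow_log_derive pv i x) (fun x _ => vC i x).
  by rewrite (_ : s - (s - e) = e)//; ring.
have dge (t : R) : is_derive t 1 (fun s => p i (s - e) - m i s) (expR (v i (t - e)) - expR (w i t)).
  exact: is_derive_sub (is_derive_shiftr (flow_mass_derive pv i _)) (flow_mass_derive mw i t).
move=> t; rewrite -subr_ge0.
have [tt1|tt1] := leP t t1.
  apply: (derive_ge0_ge_limN (fun s _ => dge s) _ _ tt1).
    move=> s st; rewrite subr_ge0 ler_expR.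
    have := dh _ _ st; have := ve s; rewrite ler_norml => /andP[_]; rewrite /d; move: e1; rewrite /d; lra.
  by rewrite -[X in _ --> X](subr0 0); apply: cvgB => //; exact: cvg_shift_ninfty.
have [tt2|tt2] := leP t2 t.
  apply: (derive_le0_ge_limy (fun s _ => dge s) _ _ tt2).
    move=> s st; rewrite subr_le0 ler_expR.
    have := dh _ _ st; have := ve s; rewrite ler_norml => /andP[+ _]; rewrite /d; move: e2; rewrite /d; lra.
  by rewrite -[X in _ --> X](subrr (sigma i)); apply: cvgB => //; exact: cvg_shift_pinfty.
have pe : p i t - p i (t - e) <= B * e.
  have te : t - e <= t by rewrite gerBl ltW.
  have := derive_lipschitz te (fun x _ => flow_mass_derive pv i x) (fun x _ => vB x).
  by rewrite (_ : t - (t - e) = e) ?ler_norml => [/andP[_]//|]; ring.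
have [dt|dt] := leP (d t) 0.
  have : p i t1 - m i t1 <= p i t - m i t.
    apply: (derive_ge0_le (ltW tt1) (fun s _ => dg s)) => s /andP[_ st].
    by rewrite subr_ge0 ler_expR -subr_le0; exact: le_trans (dh _ _ st) dt.
  lra.
have : p i t2 - m i t2 <= p i t - m i t.
  apply: (derive_le0_ge (ltW tt2) (fun s _ => dg s)) => s /andP[st _].
  by rewrite subr_le0 ler_expR -subr_ge0; exact: le_trans (ltW dt) (dh _ _ st).
lra.
Unshelve. all: by end_near. Qed.

(** The admissible shifts form a closed set bounded below. At the infimum some component coincides,
    since otherwise all components would allow a slightly smaller shift; irreducibility then spreads
    the coincidence along an edge leaving the set [T] of coinciding components. *)
Lemma flow_unique m w p v : (0 < n)%N -> irreducible_mx A ->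
  flow A b sigma m w -> flow A b sigma p v ->
  exists h, forall i t, w i t = v i (t + h).
Proof.
move=> n0 irr mw pv.
pose S : set R := [set h | forall i t, m i t <= p i (t + h)].
have [h1 Sh1] : S !=set0 by have [h] := flow_compare mw pv; exists h.
pose i0 := Ordinal n0.
have [L SL] : has_lbound S.
  have [_ _ p0 _] := pv i0.
  have [L [_ HL]] : \forall t \near -oo, p i0 t < m i0 0.
    by apply: cvgr_lt p0 _ _; exact: flow_gt0 mw i0 0.
  exists (L - 1) => h Sh; rewrite leNgt; apply/negP => hL.
  have hL' : h < L by lra.
  have : p i0 h < m i0 0 by exact: HL.
  by have := Sh i0 0; rewrite add0r leNgt => /negbTE ->.
pose h0 := inf S.
have infS : has_inf S by split; [exists h1|exists L].
have Sh0 : S h0.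
  move=> i t; have /is_derive_continuous cp := flow_mass_derive pv i (t + h0).
  have cp' : p i (t + h) @[h --> h0^'+] --> p i (t + h0).
    apply: cvg_at_right_filter; apply: (continuous_comp (f := fun h => t + h)) cp.
    by apply: cvgD; [exact: cvg_cst|exact: cvg_id].
  apply: (cvg_ge_of_near cp'); near=> h.
  have hh : h0 < h by near: h; exact: nbhs_right_gt.
  have [h' Sh' h'h] := inf_adherent (ltac:(by rewrite subr_gt0) : 0 < h - h0) infS.
  apply: le_trans (Sh' i t) _; apply: (flow_homo pv i).
  by rewrite lerD2l ltW// (lt_le_trans h'h)// -/h0 addrC subrK.
have mp j t : m j t <= p j (t + h0) by exact: Sh0.
have pv' := flow_shift pv h0.
exists h0; pose T := [set i | `[< forall t, w i t = v i (t + h0) >]]%SET.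
have [TT|TT] := eqVneq T [set: 'I_n]%SET.
  by move=> i; have := finset.in_setT i; rewrite -TT inE => /asboolP.
exfalso; have [T0|T0] := eqVneq T finset.set0.
  have H : \forall e \near 0^'+, forall i t, m i t <= p i (t - e + h0).
    apply: filter_forall => i; have [H|//] := flow_touch i mw pv' mp.
    by have := finset.in_set0 i; rewrite -T0 inE; move/asboolPn.
  near (at_right (0 : R)) => e.
  have e0 : 0 < e by near: e; exact: nbhs_right_gt.
  suff : S (h0 - e) by move=> /(ge_inf (proj2 infS)); rewrite -/h0; lra.
  have H' : forall i t, m i t <= p i (t - e + h0) by near: e.
  by move=> i t; rewrite (_ : t + (h0 - e) = t - e + h0); [exact: H'|ring].
have [i [j [iT jT Aij]]] := irreducible_edge A_ge0 irr T0 TT.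
move: iT; rewrite inE => /asboolP iT; move: jT; rewrite inE => /asboolP; apply => t.
(* Since [w i] and the shifted [v i] agree, so do their slopes: the nonnegative terms
   [A i k * (p k (s + h0) - m k s)] add up to [0], and [A i j > 0] forces equality for [j]. *)
have mpj s : m j s = p j (s + h0).
  have d1 := flow_log_derive mw i s; have d2 := flow_log_derive pv' i s.
  have E : b i - \sum_k A i k * m k s = b i - \sum_k A i k * p k (s + h0).
    have [_ <-] := d1; have [_ <-] := d2.
    by rewrite (funext iT).
  have : \sum_k A i k * (p k (s + h0) - m k s) = 0.
    under eq_bigr do rewrite mulrBr.
    by rewrite sumrB; lra.
  move=> /psumr_eq0P H; have /eqP := H (fun k _ => mulr_ge0 (A_ge0 i k)
    (ltac:(by rewrite subr_ge0) : 0 <= p k (s + h0) - m k s)) j isT.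
  by rewrite mulf_eq0 gt_eqF//= subr_eq0 => /eqP.
apply: expR_inj.
have [_ <-] := flow_mass_derive mw j t; have [_ <-] := flow_mass_derive pv' j t.
by rewrite (funext mpj).
Unshelve. all: by end_near. Qed.

End Uniqueness.

(** * Existence of orbits *)

Section Box.
Context {R : realType} {n : nat}.
Variables (A : 'M[R]_n) (beta sigma : 'I_n -> R).
Hypothesis A_ge0 : forall i j, 0 <= A i j.
Hypothesis A_unit : A \in unitmx.
Hypothesis sigma_gt0 : forall i, 0 < sigma i.
Hypothesis sigmaL : Lambda_cond A beta sigma.
Implicit Types (i j : 'I_n) (x p q : 'I_n -> R).

Let Lam x := Lambda A beta [set: 'I_n]%SET x.

Lemma Lambda_setT x :
  Lam x = 2 * \sum_i (beta i + 2) * x i - \sum_i \sum_j A i j * x i * x j.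
Proof.
rewrite /Lam /Lambda; congr (2 * _ - _).
  by apply: eq_bigl => i; rewrite inE.
apply: eq_big => [i|i _]; first by rewrite inE.
by apply: eq_bigl => j; rewrite inE.
Qed.

(** The last term is the exact deviation of a quadratic function from its linear interpolation. It
    is nonnegative when [q - p] has entries of one sign, in particular along a coordinate
    direction. *)
Lemma Lambda_segment p q (th : R) :
  Lam (fun i => (1 - th) * p i + th * q i) = (1 - th) * Lam p + th * Lam q
   + th * (1 - th) * \sum_i \sum_j A i j * (q i - p i) * (q j - p j).
Proof.
rewrite !Lambda_setT.
have E1 : \sum_i (beta i + 2) * ((1 - th) * p i + th * q i) =
    (1 - th) * (\sum_i (beta i + 2) * p i) + th * (\sum_i (beta i + 2) * q i).
  by rewrite !mulr_sumr -big_split/=; apply: eq_bigr => i _; ring.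
have E2 : \sum_i \sum_j A i j * ((1 - th) * p i + th * q i) * ((1 - th) * p j + th * q j) =
    (1 - th) * (\sum_i \sum_j A i j * p i * p j) + th * (\sum_i \sum_j A i j * q i * q j)
    - th * (1 - th) * \sum_i \sum_j A i j * (q i - p i) * (q j - p j).
  rewrite !mulr_sumr -big_split/= -sumrB; apply: eq_bigr => i _.
  by rewrite !mulr_sumr -big_split/= -sumrB; apply: eq_bigr => j _; ring.
by rewrite E1 E2; ring.
Qed.

Let in_box x := forall i, 0 <= x i <= sigma i.

Let vertex x : (forall i, x i = 0 \/ x i = sigma i) ->
  Lam x = Lambda A beta [set i | x i == sigma i]%SET sigma.
Proof.
move=> xv; rewrite Lambda_setT /Lambda; congr (2 * _ - _).
  rewrite [RHS]big_mkcond/=; apply: eq_bigr => i _; rewrite inE.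
  by case: eqP => [->//|]; case: (xv i) => // -> _; rewrite mulr0.
rewrite [RHS]big_mkcond/=; apply: eq_bigr => i _; rewrite inE.
case: eqP => [->|]; last first.
  by case: (xv i) => // -> _; rewrite big1// => j _; rewrite mulr0 mul0r.
rewrite [RHS]big_mkcond/=; apply: eq_bigr => j _; rewrite inE.
by case: eqP => [->//|]; case: (xv j) => // -> _; rewrite mulr0.
Qed.

(* Lambda is concave in each coordinate separately, and its values at the
   vertices of the box are the Lambda_J(sigma). *)
Lemma Lambda_box x : in_box x ->
  0 <= Lam x /\ (Lam x = 0 -> x = (fun=> 0) \/ x = sigma).
Proof.
(* Induction on the number of coordinates strictly inside their interval; moving one of them to both
   of its end points lowers this number by one. *)
suff : forall k, forall x, in_box x ->
    #|[set i | (x i != 0) && (x i != sigma i)]%SET| = k ->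
    0 <= Lam x /\ (x <> (fun=> 0) -> x <> sigma -> 0 < Lam x).
  move=> H /(H _ _) /(_ erefl)[L0 L1]; split => // E.
  apply: contrapT => /not_orP[x0 xs]; have := L1 x0 xs.
  by rewrite E ltxx.
elim=> [|k IH] {}x xb xk.
  have xv i : x i = 0 \/ x i = sigma i.
    move/eqP: xk; rewrite finset.cards_eq0 => /eqP/finset.setP/(_ i).
    by rewrite !inE => /negbT; rewrite negb_and !negbK => /orP[]/eqP; [left|right].
  rewrite vertex//; set J := [set i | _]%SET; have [LI LJ] := sigmaL.
  have [J0|J0] := eqVneq J finset.set0.
    split; first by rewrite J0 /Lambda !finset.big_set0 mulr0 subr0.
    case; apply/funext => i; case: (xv i) => // /eqP xi.
    by have := finset.in_set0 i; rewrite -J0 inE xi.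
  have [JT|JT] := eqVneq J [set: 'I_n]%SET; last by split => [|_ _]; [apply/ltW|]; exact: LJ.
  split; first by rewrite JT LI.
  move=> _; case; apply/funext => i; apply/eqP.
  by have := finset.in_setT i; rewrite -JT inE.
have [i] : exists i, i \in [set i | (x i != 0) && (x i != sigma i)]%SET.
  by apply/finset.set0Pn; rewrite -finset.cards_eq0 xk.
rewrite inE => /andP[xi0 xis].
pose ups (c : R) j := if j == i then c else x j.
pose th := x i / sigma i.
have s0 := sigma_gt0 i.
have th0 : 0 < th by rewrite divr_gt0// lt_neqAle eq_sym xi0; have /andP[] := xb i.
have th1 : th < 1 by rewrite ltr_pdivrMr// mul1r lt_neqAle xis; have /andP[] := xb i.
have ups_card c : (c == 0) || (c == sigma i) ->
    #|[set j | (ups c j != 0) && (ups c j != sigma j)]%SET| = k.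
  move=> cv; move: xk; rewrite (finset.cardsD1 i) inE xi0 xis => -[<-].
  apply: eq_card => j; rewrite !inE /ups; case: (eqVneq j i) => [->|//].
  by case/orP: cv => ->; rewrite ?andbF.
have ups_box c : 0 <= c <= sigma i -> in_box (ups c).
  by move=> cb j; rewrite /ups; case: eqVneq => [->|].
have [Lp0 Lp1] := IH _ (ups_box 0 ltac:(by rewrite lexx ltW)) (ups_card 0 ltac:(by rewrite eqxx)).
have [Lq0 Lq1] := IH _ (ups_box (sigma i) ltac:(by rewrite lexx ltW))
  (ups_card (sigma i) ltac:(by rewrite eqxx orbT)).
have xE : x = (fun j => (1 - th) * ups 0 j + th * ups (sigma i) j).
  apply/funext => j; rewrite /ups; case: eqVneq => [->|_]; last by ring.
  by rewrite mulr0 add0r /th divfK// gt_eqF.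
have dE j : ups (sigma i) j - ups 0 j = if j == i then sigma i else 0.
  by rewrite /ups; case: eqVneq => _; rewrite ?subr0// subrr.
have d0 j : 0 <= ups (sigma i) j - ups 0 j by rewrite dE; case: ifP => // _; exact: ltW.
have D0 : 0 <= \sum_j \sum_l A j l * (ups (sigma i) j - ups 0 j) * (ups (sigma i) l - ups 0 l).
  by rewrite sumr_ge0// => j _; rewrite sumr_ge0// => l _; rewrite mulr_ge0// mulr_ge0.
suff Lx : 0 < Lam x by split; [exact: ltW|].
have th1' : 0 < 1 - th by rewrite subr_gt0.
have thD : 0 <= th * (1 - th) by rewrite mulr_ge0// ltW.
rewrite xE Lambda_segment.
(* One end of the coordinate segment has positive [Lam] unless these ends are the two exceptional
   vertices. That happens only in dimension one, where invertibility makes [A i i] positive and the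
   interpolation term is strict. *)
have [p0|pN] := pselect (ups 0 = (fun=> 0)); last first.
  have ps : ups 0 <> sigma.
    by move=> /(congr1 (fun f => f i)); rewrite /ups eqxx => E; rewrite -E ltxx in s0.
  have Lp := Lp1 pN ps.
  rewrite -addrA ltr_pwDl//; first by rewrite mulr_gt0.
  by rewrite addr_ge0// mulr_ge0// ltW.
have [qs|qN] := pselect (ups (sigma i) = sigma); last first.
  have q0 : ups (sigma i) <> (fun=> 0).
    by move=> /(congr1 (fun f => f i)); rewrite /ups eqxx => E; rewrite E ltxx in s0.
  rewrite -addrA ltr_wpDl//; first by rewrite mulr_ge0// ltW.
  rewrite ltr_pwDl//; first by rewrite mulr_gt0//; exact: Lq1.
  by rewrite mulr_ge0.
have ji j : j = i.
  apply/eqP/negPn/negP => ji.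
  have := congr1 (fun f => f j) p0; have := congr1 (fun f => f j) qs.
  rewrite /ups (negbTE ji) => -> E.
  by have := sigma_gt0 j; rewrite E ltxx.
have Aii : 0 < A i i.
  rewrite lt_neqAle A_ge0 andbT; apply/eqP => Aii.
  have := mulmxV A_unit; move=> /matrixP/(_ i i); rewrite !mxE eqxx => /eqP.
  rewrite big1 => [|j _]; first by rewrite eq_sym oner_eq0.
  by rewrite (ji j) -Aii mul0r.
apply: ltr_wpDl; first by rewrite addr_ge0// mulr_ge0// ltW.
apply: mulr_gt0; first exact: mulr_gt0.
rewrite (bigD1 i)//= [X in _ + X]big1 ?addr0 => [|j /negP[]]; last by rewrite (ji j).
rewrite (bigD1 i)//= [X in _ + X]big1 ?addr0 => [|j /negP[]]; last by rewrite (ji j).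
by rewrite dE eqxx !mulr_gt0.
Qed.

End Box.

(** * The two-point problem on a segment *)

Section BoundaryValue.
Context {R : realType} {n : nat}.
Variables (A : 'M[R]_n) (b sigma : 'I_n -> R) (L : R).
Hypothesis A_ge0 : forall i j, 0 <= A i j.
Hypothesis sigma_gt0 : forall i, 0 < sigma i.
Hypothesis L_gt0 : 0 < L.
Implicit Types (i j : 'I_n) (s t : R) (m p w v : 'I_n -> R -> R).

(** Freezing the coupling outside [[0, L]] poses each iteration step on the whole line, so that
    derivatives at [0] and [L] are two-sided. *)
Let clamp t := Num.max 0 (Num.min t L).

Let clamp_itv t : 0 <= clamp t <= L.
Proof. by rewrite /clamp le_max lexx/= ge_max (ltW L_gt0) ge_min lexx orbT. Qed.

Let clamp_id t : 0 <= t <= L -> clamp t = t.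
Proof. by move=> /andP[t0 tL]; rewrite /clamp (min_idPl tL) (max_idPr t0). Qed.

Let clamp_lip s t : `|clamp t - clamp s| <= `|t - s|.
Proof.
have h1 := ler_norm (t - s); have h2 := ler_norm (s - t); rewrite distrC in h2.
have L0 := L_gt0; rewrite /clamp /Num.max /Num.min.
by case: (ltP t L) => ?; case: (ltP s L) => ?;
  repeat (case: ifPn; rewrite -?leNgt => ?); rewrite ler_norml; apply/andP; split; lra.
Qed.

Let clamp_continuous : continuous clamp.
Proof.
move=> x; apply: (@continuous_max _ _ (cst 0) (fun t => Num.min t L)); first exact: cvg_cst.
by apply: (@continuous_min _ _ id (cst L)); [exact: cvg_id|exact: cvg_cst].
Qed.

Definition bvp_step m m' w' := forall i,
  [/\ forall t : R, is_derive t 1 (m' i) (expR (w' i t)),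
      forall t : R, is_derive t 1 (w' i) (b i - \sum_j A i j * m j (clamp t)),
      m' i 0 = 0 & m' i L = sigma i].

Let in_box m := forall i t, 0 <= t <= L -> 0 <= m i t <= sigma i.

(** With the coupling given by the previous iterate, [w'] is a primitive [G] up to a constant, and
    the constant [ln k] is the one that makes the mass on [[0, L]] equal to [sigma i]. *)
Let step_exists m : (forall i, continuous (m i)) -> exists m' w', bvp_step m m' w'.
Proof.
move=> cm.
suff H i : exists mw : (R -> R) * (R -> R),
  [/\ forall t : R, is_derive t 1 mw.1 (expR (mw.2 t)),
      forall t : R, is_derive t 1 mw.2 (b i - \sum_j A i j * m j (clamp t)),
      mw.1 0 = 0 & mw.1 L = sigma i].
  have [mw Hmw] := boolp.choice H.
  by exists (fun i => (mw i).1), (fun i => (mw i).2).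
have [G dG] : exists G : R -> R, forall t : R,
    is_derive t 1 G (b i - \sum_j A i j * m j (clamp t)).
  apply: continuous_primitive => x; apply: cvgB; first exact: cvg_cst.
  apply: cvg_bigsum => j; apply: cvgM; first exact: cvg_cst.
  by apply: (continuous_comp (f := clamp)); [exact: clamp_continuous|exact: cm].
have [E dE] : exists E : R -> R, forall t : R, is_derive t 1 E (expR (G t)).
  apply: continuous_primitive => x.
  by apply: continuous_comp; [exact: is_derive_continuous (dG x)|exact: continuous_expR].
have E0 : 0 < E L - E 0.
  by rewrite subr_gt0; apply: (derive_gt0_lt L_gt0 (fun t _ => dE t)) => t _; exact: expR_gt0.
pose k := sigma i / (E L - E 0).
have k0 : 0 < k by rewrite divr_gt0.
exists (fun t => k * (E t - E 0), fun t => G t + ln k) => /=; split.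
- move=> t; rewrite expRD lnK ?posrE// mulrC.
  have := is_derive_scale k (is_derive_sub (dE t) (is_derive_const (E 0) t)).
  by rewrite subr0.
- move=> t; have := is_derive_add (dG t) (is_derive_const (ln k) t).
  by rewrite addr0.
- by rewrite subrr mulr0.
- by rewrite /k divfK// gt_eqF.
Qed.

Let step_homo m m' w' i : bvp_step m m' w' -> {homo m' i : x y / x <= y}.
Proof. by move=> /(_ i)[dm _ _ _]; apply: derive_homo dm _ => t; exact: expR_ge0. Qed.

Let step_box m m' w' : bvp_step m m' w' -> in_box m'.
Proof.
move=> st i t /andP[t0 tL]; have [_ _ m0 mL] := st i.
by rewrite -m0 -{1}mL !(step_homo i st).
Qed.

(** A larger coupling makes [w' i - v' i] nondecreasing, so [p' i - m' i] increases and then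
    decreases; it is [0] at both [0] and [L]. *)
Let step_mono m m' w' p p' v' : bvp_step m m' w' -> bvp_step p p' v' ->
  (forall i t, 0 <= t <= L -> m i t <= p i t) ->
  forall i t, 0 <= t <= L -> m' i t <= p' i t.
Proof.
move=> stm stp mp i t /andP[t0 tL].
have [dm dw m0 mL] := stm i; have [dp dv p0 pL] := stp i.
pose d s := w' i s - v' i s.
have dh : {homo d : x y / x <= y}.
  apply: (@derive_homo _ d (fun s => \sum_j A i j * (p j (clamp s) - m j (clamp s)))) => s.
    have := is_derive_sub (dw s) (dv s).
    set X := (X in is_derive _ _ _ X -> _); set Y := (Y in _ -> is_derive _ _ _ Y).
    suff -> : X = Y by [].
    rewrite /X /Y; under [RHS]eq_bigr do rewrite mulrBr.
    by rewrite sumrB; lra.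
  by apply: sumr_ge0 => j _; rewrite mulr_ge0// subr_ge0 mp.
have dg (s : R) : is_derive s 1 (fun s => p' i s - m' i s) (expR (v' i s) - expR (w' i s)).
  exact: is_derive_sub (dp s) (dm s).
rewrite -subr_ge0; have [dt|dt] := leP (d t) 0.
  have := derive_ge0_le t0 (fun s _ => dg s).
  rewrite m0 p0 subrr; apply=> s /andP[_ st].
  by rewrite subr_ge0 ler_expR -subr_le0; exact: le_trans (dh _ _ st) dt.
have := derive_le0_ge tL (fun s _ => dg s).
rewrite mL pL subrr; apply=> s /andP[st _].
by rewrite subr_le0 ler_expR -subr_ge0; exact: le_trans (ltW dt) (dh _ _ st).
Qed.

Let slope_bound : exists2 C, 0 <= C & forall m, in_box m -> forall i t,
  `|b i - \sum_j A i j * m j (clamp t)| <= C.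
Proof.
pose B i := `|b i| + \sum_j A i j * sigma j.
have B0 i : 0 <= B i.
  by rewrite addr_ge0// sumr_ge0// => j _; rewrite mulr_ge0// ltW.
exists (\sum_i B i); first exact: sumr_ge0.
move=> m mb i t; apply: (@le_trans _ _ (B i)); last first.
  by rewrite (bigD1 i)//= lerDl sumr_ge0.
have mb' j := mb j _ (clamp_itv t).
rewrite (le_trans (ler_normB _ _))// lerD2l ger0_norm.
  by apply: ler_sum => j _; rewrite ler_wpM2l//; have /andP[] := mb' j.
by apply: sumr_ge0 => j _; rewrite mulr_ge0//; have /andP[] := mb' j.
Qed.

(** Somewhere in [[0, L]] the density equals its mean [sigma i / L], and the slope bound propagates
    this value. The window exceeds [[0, L]] by [1] on each side to leave room for two-sided
    derivatives of the limit. *)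
Let log_bound : exists B, forall m m' w', in_box m -> bvp_step m m' w' ->
  forall i t, -1 <= t <= L + 1 -> w' i t <= B.
Proof.
have [C C0 HC] := slope_bound.
exists (\sum_i `|ln (sigma i / L)| + C * (L + 2)) => m m' w' mb st i t /andP[t0 tL].
have [dm dw m0 mL] := st i.
have [s /andP[s0 sL]] := mean_value (ltW L_gt0) (fun s _ => dm s).
rewrite m0 mL !subr0 => E.
have ws : w' i s = ln (sigma i / L) by rewrite E mulfK ?gt_eqF// expRK.
have := @derive_lipschitz_sym _ (w' i) _ C s t (fun x _ => dw x) (fun x _ => HC _ mb i x).
rewrite ler_norml => /andP[_ wt].
have st' : `|t - s| <= L + 2 by rewrite ler_norml; lra.
have : C * `|t - s| <= C * (L + 2) by exact: ler_wpM2l.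
have : ln (sigma i / L) <= \sum_i `|ln (sigma i / L)|.
  rewrite (bigD1 i)//= (le_trans (ler_norm _))// lerDl sumr_ge0//.
rewrite -ws; lra.
Qed.

(* Monotone iteration: a larger m makes the normalised profile of the next
   iterate more concentrated at the left, so the iterates started at 0 increase. *)
Lemma boundary_value_problem : exists m w, forall i,
  [/\ forall t, 0 <= t <= L -> is_derive (t : R) 1 (m i) (expR (w i t)),
      forall t, 0 <= t <= L -> is_derive (t : R) 1 (w i) (b i - \sum_j A i j * m j t),
      m i 0 = 0 & m i L = sigma i].
Proof.
have H m : exists mw : ('I_n -> R -> R) * ('I_n -> R -> R),
    (forall i, continuous (m i)) -> bvp_step m mw.1 mw.2.
  (* The value [(m, m)] only makes the iteration map total; all iterates from [0] are continuous. *)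
  have [cm|ncm] := pselect (forall i, continuous (m i)); last by exists (m, m).
  by have [m' [w' H]] := step_exists cm; exists (m', w').
have [F HF] := boolp.choice H.
pose mk k := iter k (fun m => (F m).1) (fun _ _ => 0).
pose wk k := (F (mk k)).2.
have st k : bvp_step (mk k) (mk k.+1) (wk k).
  have : forall i, continuous (mk k i).
    elim: k => [|k IH] i x; first exact: cvg_cst.
    by have [dm _ _ _] := HF _ IH i; exact: is_derive_continuous (dm x).
  exact: HF.
have box k : in_box (mk k).
  case: k => [|k]; last exact: step_box (st k).
  by move=> i t _; rewrite lexx ltW.
have mono k : forall i t, 0 <= t <= L -> mk k i t <= mk k.+1 i t.
  elim: k => [|k IH]; first by move=> i t /(box 1 i)/andP[].
  exact: step_mono (st k) (st k.+1) IH.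
have [C C0 HC] := slope_bound; have [B HB] := log_bound.
have wB k i t : -1 <= t <= L + 1 -> expR (wk k i t) <= expR B.
  by move=> tL; rewrite ler_expR; exact: HB (box k) (st k) i t tL.
have lip1 k i s t : -1 <= s <= L + 1 -> -1 <= t <= L + 1 ->
    `|mk k.+1 i t - mk k.+1 i s| <= expR B * `|t - s|.
  move=> sL tL; have [dm _ _ _] := st k i.
  apply: (derive_lipschitz_sym (fun x _ => dm x)) => x xst.
  rewrite ger0_norm ?expR_ge0//; apply: wB.
  by move: xst sL tL; case: (leP s t) => _ /andP[? ?] /andP[? ?] /andP[? ?]; lra.
have lip k i s t : 0 <= s <= L -> 0 <= t <= L ->
    `|mk k i t - mk k i s| <= expR B * `|t - s|.
  case: k => [|k] /andP[? ?] /andP[? ?]; first by rewrite /mk/= subrr normr0 mulr_ge0// expR_ge0.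
  by apply: lip1; apply/andP; split; lra.
have [U [UU Uoo]] := @ultraFilterLemma nat \oo _.
have FU : ProperFilter U by exact: ultra_proper.
have [M HM] : exists M : 'I_n -> R -> R, forall i t, -1 <= t <= L + 1 ->
    mk k.+1 i t @[k --> U] --> M i t.
  suff H' (it : 'I_n * R) : exists l : R, -1 <= it.2 <= L + 1 -> mk k.+1 it.1 it.2 @[k --> U] --> l.
    have [M HM] := boolp.choice H'.
    by exists (fun i t => M (i, t)) => i t; exact: (HM (i, t)).
  case: it => i t /=; have [tL|//] := boolP (-1 <= t <= L + 1); last by exists 0.
  have [|l Hl] := @ultra_bounded_cvg R U UU (fun k => mk k.+1 i t) (expR B * `|t - 0|).
    apply: nearW => k; have [_ _ m0 _] := st k i.
    have z : -1 <= (0 : R) <= L + 1 by have L0 := L_gt0; apply/andP; split; lra.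
    by have := lip1 k i 0 t z tL; rewrite m0 subr0.
  by exists l.
have [W HW] : exists W : 'I_n -> R -> R, forall i t, -1 <= t <= L + 1 ->
    wk k i t @[k --> U] --> W i t.
  suff H' (it : 'I_n * R) : exists l : R, -1 <= it.2 <= L + 1 -> wk k it.1 it.2 @[k --> U] --> l.
    have [W HW] := boolp.choice H'.
    by exists (fun i t => W (i, t)) => i t; exact: (HW (i, t)).
  case: it => i t /=; have [tL|//] := boolP (-1 <= t <= L + 1); last by exists 0.
  have [|l Hl] := @ultra_bounded_cvg R U UU (fun k => wk k i t)
      (`|ln (sigma i / L)| + C * (L + 2)).
    apply: nearW => k; have [dm dw m0 mL] := st k i.
    have [s /andP[s0 sL]] := mean_value (ltW L_gt0) (fun s _ => dm s).
    rewrite m0 mL !subr0 => E.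
    have ws : wk k i s = ln (sigma i / L) by rewrite E mulfK ?gt_eqF// expRK.
    have := @derive_lipschitz_sym _ (wk k i) _ C s t (fun x _ => dw x)
      (fun x _ => HC _ (box k) i x).
    have st' : `|t - s| <= L + 2 by move: tL => /andP[? ?]; rewrite ler_norml; lra.
    have : C * `|t - s| <= C * (L + 2) by exact: ler_wpM2l.
    rewrite -ws => h1 h2; rewrite -[wk k i t](subrK (wk k i s)).
    by apply: le_trans (ler_normD _ _) _; lra.
  by exists l.
(* [M] is the limit of the successors [mk k.+1], whereas the coupling involves [mk k]. Monotonicity
   in [k] gives a genuine sequential limit on [[0, L]], so the two limits agree and the limiting
   equation is closed. *)
have cvgk i t : 0 <= t <= L -> mk k i t @[k --> U] --> M i t.
  move=> tL.
  have : mk k i t @[k --> \oo] --> limn (fun k => mk k i t).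
    apply: nondecreasing_is_cvgn.
      by apply/nondecreasing_seqP => k; exact: mono.
    by exists (sigma i) => _ [k _ <-]; have /andP[] := box k i t tL.
  set l := limn _ => ml.
  have ml1 : mk k.+1 i t @[k --> U] --> l.
    apply: cvg_trans (cvg_app _ Uoo) _.
    by rewrite (cvg_shiftS (fun k => mk k i t)).
  have ml0 : mk k i t @[k --> U] --> l by apply: cvg_trans (cvg_app _ Uoo) _.
  have E : M i t = l.
    apply: cvg_eq_unique ml1; apply: HM; move: tL => /andP[? ?]; apply/andP; split; lra.
  by rewrite E.
have win (t0 : R) t : 0 <= t0 <= L -> `|t - t0| < 1 -> -1 <= t <= L + 1.
  by move=> /andP[? ?]; rewrite ltr_norml => /andP[? ?]; apply/andP; split; lra.
have win2 (t0 : R) t x : 0 <= t0 <= L -> `|t - t0| < 1 ->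
    Num.min t0 t <= x <= Num.max t0 t -> -1 <= x <= L + 1.
  move=> /andP[? ?]; rewrite ltr_norml => /andP[? ?].
  by case: (leP t0 t) => _ /andP[? ?]; apply/andP; split; lra.
exists M, W => i; split.
- move=> t0 t0L.
  apply: (@ultra_derive R U UU (fun k => mk k.+1 i) (M i) (fun k => expR (wk k i t0)) _ t0
    1 (expR B * C)) => //.
  + by rewrite mulr_ge0// expR_ge0.
  + by move=> t tt; apply: HM; exact: (win _ _ t0L tt).
  + have Wt0 : wk k i t0 @[k --> U] --> W i t0.
      by apply: HW; apply: (win t0) => //; rewrite subrr normr0.
    by apply: (cvg_comp (fun k => wk k i t0) expR Wt0); exact: continuous_expR.
  apply: nearW => k t tt; have [dm dw _ _] := st k i.
  apply: (@taylor_bound _ (mk k.+1 i) (fun s => expR (wk k i s))).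
  + by rewrite mulr_ge0// expR_ge0.
  move=> x xt.
  apply: (@derive_lipschitz_sym _ (fun s => expR (wk k i s))
    (fun s => expR (wk k i s) * (b i - \sum_j A i j * mk k j (clamp s)))) => y yx.
  rewrite normrM (ger0_norm (expR_ge0 _)); apply: ler_pM => //.
    apply: wB; apply: (win2 t0 t) => //.
    move: xt yx; case: (leP t0 t) => _; case: (leP t0 x) => ? /andP[? ?] /andP[? ?]; apply/andP; split; lra.
  exact: HC (box k) i y.
- move=> t0 t0L.
  have SA0 : 0 <= \sum_j A i j * expR B.
    by apply: sumr_ge0 => j _; rewrite mulr_ge0// expR_ge0.
  apply: (@ultra_derive R U UU (fun k => wk k i) (W i)
    (fun k => b i - \sum_j A i j * mk k j t0) _ t0 1 (\sum_j A i j * expR B)) => //.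
  + by move=> t tt; apply: HW; exact: (win _ _ t0L tt).
  + apply: cvgB; first exact: cvg_cst.
    by apply: cvg_bigsum => j; apply: cvgM; [exact: cvg_cst|exact: cvgk].
  apply: nearW => k t tt; have [_ dw _ _] := st k i.
  have := @taylor_bound _ (wk k i) (fun s => b i - \sum_j A i j * mk k j (clamp s))
    (\sum_j A i j * expR B) t0 t SA0 (fun x _ => dw x).
  rewrite (clamp_id t0L); apply => x _.
  have E (c x1 x2 : R) : c - x1 - (c - x2) = x2 - x1 by ring.
  rewrite E -sumrB mulr_suml.
  apply: le_trans (ler_norm_sum _ _ _) _; apply: ler_sum => j _.
  rewrite -mulrBr normrM (ger0_norm (A_ge0 i j)) -mulrA ler_wpM2l//.
  have := lip k j _ _ (clamp_itv t0) (clamp_itv x).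
  have := clamp_lip t0 x; rewrite (clamp_id t0L) => h1 h2.
  by rewrite distrC; apply: le_trans h2 _; rewrite ler_wpM2l ?expR_ge0.
- apply: (@cvg_eq_unique _ _ U _ (fun k => mk k.+1 i 0)).
    by apply: HM; have L0 := L_gt0; apply/andP; split; lra.
  have -> : (fun k => mk k.+1 i 0) = cst 0 by apply/funext => k; have [] := st k i.
  exact: cvg_cst.
- apply: (@cvg_eq_unique _ _ U _ (fun k => mk k.+1 i L)).
    by apply: HM; have L0 := L_gt0; apply/andP; split; lra.
  have -> : (fun k => mk k.+1 i L) = cst (sigma i) by apply/funext => k; have [] := st k i.
  exact: cvg_cst.
Qed.

End BoundaryValue.

(** * Passage to the limit of long segments *)

Section Existence.
Context {R : realType} {n : nat}.
Variables (A : 'M[R]_n) (beta sigma : 'I_n -> R).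
Hypothesis A_sym : A^T = A.
Hypothesis A_ge0 : forall i j, 0 <= A i j.
Hypothesis A_unit : A \in unitmx.
Hypothesis sigma_gt0 : forall i, 0 < sigma i.
Hypothesis sigmaL : Lambda_cond A beta sigma.
Hypothesis n_gt0 : (0 < n)%N.
Implicit Types (i j : 'I_n) (s t : R) (m w : 'I_n -> R -> R).

Let Lam (x : 'I_n -> R) := Lambda A beta [set: 'I_n]%SET x.
Let b i := beta i + 2.
Let S := \sum_i sigma i.

Let S_gt0 : 0 < S.
Proof.
rewrite /S (bigD1 (Ordinal n_gt0))//= ltr_pwDl// sumr_ge0// => i _.
exact: ltW.
Qed.

Let S_half : ~ (S <= S / 2) /\ ~ (S / 2 <= 0).
Proof. by have := S_gt0; split; lra. Qed.

Let box_slope : exists2 C, 0 <= C & forall x : 'I_n -> R,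
  (forall i, 0 <= x i <= sigma i) -> forall i, `|b i - \sum_j A i j * x j| <= C.
Proof.
pose B i := `|b i| + \sum_j A i j * sigma j.
have B0 i : 0 <= B i.
  by rewrite addr_ge0// sumr_ge0// => j _; rewrite mulr_ge0// ltW.
exists (\sum_i B i); first exact: sumr_ge0.
move=> x xb i; apply: (@le_trans _ _ (B i)); last first.
  by rewrite (bigD1 i)//= lerDl sumr_ge0.
rewrite (le_trans (ler_normB _ _))// lerD2l ger0_norm.
  by apply: ler_sum => j _; rewrite ler_wpM2l//; have /andP[] := xb j.
by apply: sumr_ge0 => j _; rewrite mulr_ge0//; have /andP[] := xb j.
Qed.

(** Along the system [Lam] varies at twice the rate of the total density; the constant value of the
    difference is the energy [E]. *)
Lemma energy_derive m (V : 'I_n -> R -> R) t :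
  (forall i, is_derive t 1 (m i) (V i t)) ->
  (forall i, is_derive t 1 (V i) (V i t * (b i - \sum_j A i j * m j t))) ->
  is_derive t 1 (fun s => \sum_i V i s - 2^-1 * Lam (fun i => m i s)) 0.
Proof.
move=> dm dV.
have d1 := is_derive_bigsum (fun i => true) dV.
have d2 := is_derive_scale 2^-1 (is_derive_Lambda beta A_sym [set: 'I_n]%SET dm).
have := is_derive_sub d1 d2; rewrite mulrA mulVf ?mul1r ?pnatr_eq0//.
set X := (X in is_derive _ _ _ X -> _); suff -> : X = 0 by [].
apply/eqP; rewrite subr_eq0; apply/eqP; apply: eq_big => [i|i _]; first by rewrite inE.
by congr (_ * (_ - _)); apply: eq_bigl => j; rewrite inE.
Qed.

(** Since [Lam] is nonnegative on the box, the total density is at least [E] everywhere, whence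
    [E * L <= S]. At both ends it equals [E] and can grow only by the factor [expR (C * X)] within
    time [X]. Hence little mass lies near the ends, and the time of half mass is farther than [X]
    from both. *)
Lemma normalised_segment (X e : R) : 0 < X -> 0 < e -> exists m w E,
  [/\ forall i t, `|t| <= X -> is_derive (t : R) 1 (m i) (expR (w i t)) /\
        is_derive (t : R) 1 (w i) (b i - \sum_j A i j * m j t),
      forall i t, `|t| <= X -> 0 <= m i t <= sigma i,
      \sum_i m i 0 = S / 2,
      0 <= E <= e &
      forall t, `|t| <= X -> \sum_i expR (w i t) = E + 2^-1 * Lam (fun i => m i t)].
Proof.
move=> X0 e0; have [C C0 HC] := box_slope.
(* The term [S / e] gives [E <= e], and the term [2 * X * expR (C * X)] gives
   [X * expR (C * X) < L / 2]. *)
pose L := S / e + 2 * X * expR (C * X) + 1.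
have L1 : 0 < S / e by rewrite divr_gt0.
have L2 : 0 < 2 * X * expR (C * X) by rewrite mulr_gt0 ?expR_gt0// mulr_gt0.
have L0 : 0 < L by rewrite /L; lra.
have [m [w H]] := boundary_value_problem b A_ge0 sigma_gt0 L0.
have dm i t : 0 <= t <= L -> is_derive (t : R) 1 (m i) (expR (w i t)) by have [h _ _ _] := H i; exact: h.
have dw i t : 0 <= t <= L -> is_derive (t : R) 1 (w i) (b i - \sum_j A i j * m j t).
  by have [_ h _ _] := H i; exact: h.
have m0 i : m i 0 = 0 by have [] := H i.
have mL i : m i L = sigma i by have [] := H i.
have box i t : 0 <= t <= L -> 0 <= m i t <= sigma i.
  move=> /andP[t0 tL]; rewrite -{1}(m0 i) -(mL i); apply/andP; split.
    apply: (derive_ge0_le t0 (g := fun s => expR (w i s))) => s /andP[? ?]; last exact: expR_ge0.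
    by apply: dm; apply/andP; split => //; apply: le_trans tL.
  apply: (derive_ge0_le tL (g := fun s => expR (w i s))) => s /andP[? ?]; last exact: expR_ge0.
  by apply: dm; apply/andP; split => //; apply: le_trans t0 _.
pose E := \sum_i expR (w i 0).
have HE t : 0 <= t <= L -> \sum_i expR (w i t) = E + 2^-1 * Lam (fun i => m i t).
  move=> /andP[t0 tL].
  have [|c _] := @mean_value _ (fun s => \sum_i expR (w i s) - 2^-1 * Lam (fun i => m i s))
     (fun=> 0) 0 t t0.
    move=> s /andP[? ?]; have sL : 0 <= s <= L by apply/andP; split => //; apply: le_trans tL.
    apply: (energy_derive (V := fun i s => expR (w i s))) => i; first exact: dm.
    exact: is_derive_exp (dw i s sL).
  rewrite mul0r (_ : (fun i => m i 0) = (fun=> 0)) ?[Lam (fun=> 0)]Lambda0; last exact/funext.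
  by rewrite -/E; lra.
have E0 : 0 <= E by apply: sumr_ge0 => i _; exact: expR_ge0.
(* [Lam] vanishes at [sigma] as it does at [0], so the total density is the same at both ends. *)
have EL : \sum_i expR (w i L) = E.
  rewrite HE ?lexx ?ltW// (_ : (fun i => m i L) = sigma); last exact/funext.
  by have [L_0 _] := sigmaL; rewrite /Lam L_0 mulr0 addr0.
pose M t := \sum_i m i t.
have dM t : 0 <= t <= L -> is_derive (t : R) 1 M (\sum_i expR (w i t)).
  by move=> tL; apply: is_derive_bigsum => i; exact: dm.
have M0 : M 0 = 0 by rewrite /M big1// => i _.
have ML : M L = S by apply: eq_bigr => i _; exact: mL.
have ELS : E * L <= S.
  have [c cL] := mean_value (ltW L0) dM; rewrite M0 ML !subr0 => ->.
  apply: ler_wpM2r; first exact: ltW.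
  rewrite HE// lerDl mulr_ge0//.
  by have [] := Lambda_box A_ge0 A_unit sigma_gt0 sigmaL (fun i => box i c cL).
have Ee : E <= e.
  have : S < e * L by rewrite mulrC -ltr_pdivrMr// /L; lra.
  move=> SL; rewrite -(ler_pM2r L0); exact: le_trans ELS (ltW SL).
have [tL tL0 MtL] : exists2 t, 0 <= t <= L & M t = S / 2.
  have [||c] := @IVT R M 0 L (S / 2) (ltW L0).
  - apply: continuous_in_subspaceT => x; rewrite inE/= in_itv/= => xL.
    exact: is_derive_continuous (dM x xL).
  - by rewrite M0 ML; have S0 := S_gt0; case: (leP 0 S) => ?; apply/andP; split; lra.
  - by rewrite in_itv/= => ? ?; exists c.
have XL : X * expR (C * X) < L / 2 by rewrite /L; lra.
have wlip i s t : 0 <= s <= L -> 0 <= t <= L -> `|t - s| <= X ->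
    expR (w i t) <= expR (w i s) * expR (C * X).
  move=> sL tL' ts; rewrite -expRD ler_expR -lerBlDl.
  apply: le_trans (ler_norm _) _; apply: (@le_trans _ _ (C * `|t - s|)); last exact: ler_wpM2l.
  have sub x : Num.min s t <= x <= Num.max s t -> 0 <= x <= L.
    move: sL tL' => /andP[? ?] /andP[? ?].
    by case: (leP s t) => _ /andP[? ?]; apply/andP; split; lra.
  apply: (derive_lipschitz_sym (g := fun t => b i - \sum_j A i j * m j t)) => x /sub xL.
    exact: dw.
  by apply: HC => j; exact: box.
(* Within time [X] of an end the total density is at most [E * expR (C * X)], so less than half of
   the mass is found there. *)
have half (q : R) : 0 < q -> q <= X -> E * expR (C * X) * q < S / 2.
  move=> q0 qX; have h : E * expR (C * X) * q <= E * (X * expR (C * X)).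
    by rewrite -mulrA [X in _ <= _ * X]mulrC ler_wpM2l// ler_wpM2l// expR_ge0.
  apply: le_lt_trans h _; have [->|EN] := eqVneq E 0; first by rewrite mul0r divr_gt0.
  have Ep : 0 < E by rewrite lt_neqAle eq_sym EN.
  have := ltr_pM2l Ep (X * expR (C * X)) (L / 2); rewrite XL => h.
  by apply: (@lt_le_trans _ _ (E * (L / 2))) => //; lra.
have tX : X < tL.
  rewrite ltNge; apply/negP => tX; move: (tL0) => /andP[t0 tL1].
  have sub x : 0 <= x <= tL -> 0 <= x <= L.
    by move=> /andP[x0 xt]; rewrite x0 (le_trans xt).
  have [c ct] := mean_value t0 (fun x xt => dM x (sub x xt)).
  rewrite M0 MtL !subr0 => SE.
  have tp : 0 < tL.
    by rewrite lt_neqAle t0 andbT; apply/eqP => tE; move: SE; rewrite -tE mulr0; have := S_gt0; lra.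
  have := half _ tp tX; rewrite SE ltNge => /negP; apply.
  rewrite ler_wpM2r// /E mulr_suml; apply: ler_sum => i _; apply: wlip.
  - by rewrite lexx ltW.
  - exact: sub.
  - by move: ct => /andP[? ?]; rewrite subr0 ger0_norm//; lra.
have tLX : X < L - tL.
  rewrite ltNge; apply/negP => tX'; move: (tL0) => /andP[t0 tL1].
  have sub x : tL <= x <= L -> 0 <= x <= L.
    by move=> /andP[x0 xt]; rewrite xt (le_trans t0).
  have [c ct] := mean_value tL1 (fun x xt => dM x (sub x xt)).
  rewrite ML MtL => SE; have {}SE : S / 2 = (\sum_i expR (w i c)) * (L - tL) by lra.
  have tp : 0 < L - tL.
    rewrite lt_neqAle subr_ge0 tL1 andbT; apply/eqP => tE.
    by move: SE; rewrite -tE mulr0; have := S_gt0; lra.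
  have := half _ tp tX'; rewrite SE ltNge => /negP; apply.
  rewrite ler_wpM2r ?(ltW tp)// -EL mulr_suml; apply: ler_sum => i _; apply: wlip.
  - by rewrite lexx ltW.
  - exact: sub.
  - by move: ct => /andP[? ?]; rewrite ler0_norm; lra.
have win t : `|t| <= X -> 0 <= t + tL <= L.
  by rewrite ler_norml => /andP[? ?]; apply/andP; split; lra.
exists (fun i t => m i (t + tL)), (fun i t => w i (t + tL)), E; split.
- by move=> i t /win tw; split; apply: is_derive_shiftr; [exact: dm|exact: dw].
- by move=> i t /win tw; exact: box.
- by under eq_bigr do rewrite add0r.
- by rewrite E0.
- by move=> t /win tw; exact: HE.
Qed.

(** Limits are taken of the densities [V], which are uniformly bounded, and not of [w], which has no
    uniform lower bound a priori. Positivity of the limit densities, needed to take logarithms, is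
    recovered once the end points are known to be [0] and [sigma]. *)
Lemma flow_exists : exists m w, flow A b sigma m w.
Proof.
have [C C0 HC] := box_slope.
have H (k : nat) : exists mwE : (('I_n -> R -> R) * ('I_n -> R -> R)) * R,
  [/\ forall i t, `|t| <= k.+1%:R -> is_derive (t : R) 1 (mwE.1.1 i) (expR (mwE.1.2 i t)) /\
        is_derive (t : R) 1 (mwE.1.2 i) (b i - \sum_j A i j * mwE.1.1 j t),
      forall i t, `|t| <= k.+1%:R -> 0 <= mwE.1.1 i t <= sigma i,
      \sum_i mwE.1.1 i 0 = S / 2,
      0 <= mwE.2 <= k.+1%:R^-1 &
      forall t, `|t| <= k.+1%:R -> \sum_i expR (mwE.1.2 i t) =
        mwE.2 + 2^-1 * Lam (fun i => mwE.1.1 i t)].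
  have X0 : 0 < k.+1%:R :> R by rewrite ltr0n.
  have e0 : 0 < k.+1%:R^-1 :> R by rewrite invr_gt0.
  by have [m [w [E HE]]] := normalised_segment X0 e0; exists (m, w, E).
have [F HF] := boolp.choice H.
pose m k i t := (F k).1.1 i t.
pose w k i t := (F k).1.2 i t.
pose E k := (F k).2.
pose V k i t := expR (w k i t).
have dm k i (t : R) : `|t| <= k.+1%:R -> is_derive t 1 (m k i) (V k i t).
  by have [h _ _ _ _] := HF k; move=> /h-/(_ i)[].
have dV k i (t : R) : `|t| <= k.+1%:R ->
    is_derive t 1 (V k i) (V k i t * (b i - \sum_j A i j * m k j t)).
  by have [h _ _ _ _] := HF k; move=> /h-/(_ i)[_ dw]; exact: is_derive_exp.
have box k i t : `|t| <= k.+1%:R -> 0 <= m k i t <= sigma i.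
  by have [_ h _ _ _] := HF k; exact: h.
have Sm k : \sum_i m k i 0 = S / 2 by have [] := HF k.
have EV k t : `|t| <= k.+1%:R -> \sum_i V k i t = E k + 2^-1 * Lam (fun i => m k i t).
  by have [_ _ _ _ h] := HF k; exact: h.
have Ek k : 0 <= E k <= k.+1%:R^-1 by have [] := HF k.
(* Bounds the total density uniformly in [k]: the energy is at most [1], and half of [Lam] is at
   most the sum on the box. *)
pose B := 1 + \sum_i `|b i| * sigma i.
have B0 : 0 <= B by rewrite addr_ge0// sumr_ge0// => i _; rewrite mulr_ge0// ltW.
have VB k i t : `|t| <= k.+1%:R -> `|V k i t| <= B.
  move=> tk; rewrite ger0_norm ?expR_ge0//.
  apply: (@le_trans _ _ (\sum_i V k i t)).
    by rewrite (bigD1 i)//= lerDl sumr_ge0// => j _; exact: expR_ge0.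
  rewrite EV//; apply: lerD.
    have /andP[_ h] := Ek k; apply: le_trans h _.
    by rewrite invf_le1 ?ltr0n// ler1n.
  rewrite [Lam _]Lambda_setT mulrBr mulrA mulVf ?mul1r ?pnatr_eq0//.
  apply: (@le_trans _ _ (\sum_i b i * m k i t)).
    rewrite gerBl mulr_ge0// sumr_ge0// => j _; rewrite sumr_ge0// => l _.
    by rewrite mulr_ge0 ?mulr_ge0//; [have /andP[] := box k j t tk|have /andP[] := box k l t tk].
  apply: ler_sum => j _; have /andP[h1 h2] := box k j t tk.
  apply: (@le_trans _ _ (`|b j| * m k j t)); first by rewrite ler_wpM2r// ler_norm.
  by rewrite ler_wpM2l.
have [U [UU Uoo]] := @ultraFilterLemma nat \oo _.
have FU : ProperFilter U by exact: ultra_proper.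
have near_win (r : R) : \forall k \near U, r <= k.+1%:R.
  apply: Uoo; near=> k; apply: (@le_trans _ _ k%:R); last by rewrite ler_nat.
  by near: k; exact: nbhs_infty_ger.
have [M HM] : exists M : 'I_n -> R -> R, forall i t, m k i t @[k --> U] --> M i t.
  have H' (it : 'I_n * R) : exists l : R, m k it.1 it.2 @[k --> U] --> l.
    apply: (ultra_bounded_cvg UU (B := sigma it.1)).
    apply: filterS (near_win `|it.2|) => k kt; have /andP[h0 h1] := box k it.1 it.2 kt.
    by rewrite ger0_norm.
  have [M HM] := boolp.choice H'.
  by exists (fun i t => M (i, t)) => i t; exact: (HM (i, t)).
have [W HW] : exists W : 'I_n -> R -> R, forall i t, V k i t @[k --> U] --> W i t.
  have H' (it : 'I_n * R) : exists l : R, V k it.1 it.2 @[k --> U] --> l.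
    apply: (ultra_bounded_cvg UU (B := B)).
    by apply: filterS (near_win `|it.2|) => k; exact: VB.
  have [W HW] := boolp.choice H'.
  by exists (fun i t => W (i, t)) => i t; exact: (HW (i, t)).
have win t0 t x k : `|t0| + 1 <= k.+1%:R -> `|t - t0| < 1 ->
    Num.min t0 t <= x <= Num.max t0 t -> `|x| <= k.+1%:R.
  move=> tk tt xt; apply: le_trans tk; rewrite -[x](subrK t0) addrC.
  apply: le_trans (ler_normD _ _) _; rewrite lerD2l; apply: le_trans (ltW tt).
  move: xt; case: (leP t0 t) => h /andP[h1 h2].
    by rewrite !ger0_norm ?subr_ge0// lerB.
  by rewrite !ler0_norm ?subr_le0// ?(ltW h)// lerN2 lerB.
have sub (t0 t x y : R) : Num.min t0 t <= x <= Num.max t0 t -> Num.min t0 x <= y <= Num.max t0 x ->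
    Num.min t0 t <= y <= Num.max t0 t.
  by case: (leP t0 t) => ? /andP[? ?]; case: (leP t0 x) => ? /andP[? ?]; apply/andP; split; lra.
have dM i (t0 : R) : is_derive t0 1 (M i) (W i t0).
  apply: (ultra_derive (f := fun k => m k i) (g := fun k => V k i t0) (d := 1) (C := B * C) UU) => //.
    by rewrite mulr_ge0.
  apply: filterS (near_win (`|t0| + 1)) => k kt t tt.
  apply: (taylor_bound (g := V k i)) => [|x /(win _ _ _ _ kt tt) xk|x xt].
  - by rewrite mulr_ge0.
  - exact: dm.
  pose g s := V k i s * (b i - \sum_j A i j * m k j s).
  apply: (derive_lipschitz_sym (f := V k i) (g := g)) => y /(sub _ _ _ _ xt)/(win _ _ _ _ kt tt) yk.
    exact: dV.
  rewrite normrM; apply: ler_pM => //; first exact: VB.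
  by apply: HC => j; exact: box.
have dW i (t0 : R) : is_derive t0 1 (W i) (W i t0 * (b i - \sum_j A i j * M j t0)).
  (* [D] bounds the second derivative of [V k i]: one summand for the derivative of the slope, one
     for that of the density. *)
  pose D := B * \sum_j A i j * B + C * (B * C).
  have D0 : 0 <= D.
    by rewrite addr_ge0 ?mulr_ge0// sumr_ge0// => j _; rewrite mulr_ge0.
  apply: (ultra_derive (f := fun k => V k i)
    (g := fun k => V k i t0 * (b i - \sum_j A i j * m k j t0)) (d := 1) (C := D) UU) => //.
    apply: cvgM => //; apply: cvgB; first exact: cvg_cst.
    by apply: cvg_bigsum => j; apply: cvgM => //; exact: cvg_cst.
  apply: filterS (near_win (`|t0| + 1)) => k kt t tt.
  pose g s := b i - \sum_j A i j * m k j s.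
  apply: (taylor_bound (f := V k i) (g := fun s => V k i s * g s) D0)
    => [x /(win _ _ _ _ kt tt) xk|x xt]; first exact: dV.
  apply: (derive_lipschitz_sym (f := fun s => V k i s * g s)
    (g := fun s => V k i s * (0 - \sum_j A i j * V k j s) + g s * (V k i s * g s)))
    => y /(sub _ _ _ _ xt)/(win _ _ _ _ kt tt) yk.
    exact: is_derive_mul (dV _ _ _ yk) (is_derive_sub (is_derive_const _ _)
      (is_derive_bigsum _ (fun j => is_derive_scale _ (dm _ _ _ yk)))).
  have gC : `|g y| <= C by apply: HC => j; exact: box.
  have VBy j := VB k j y yk.
  apply: le_trans (ler_normD _ _) _; rewrite !normrM sub0r normrN; apply: lerD; last first.
    by apply: ler_pM => //; rewrite ?mulr_ge0//; exact: ler_pM.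
  apply: ler_pM => //; apply: le_trans (ler_norm_sum _ _ _) _; apply: ler_sum => j _.
  by rewrite normrM (ger0_norm (A_ge0 i j)) ler_wpM2l.
have Mbox i t : 0 <= M i t <= sigma i.
  apply/andP; split.
    apply: (cvg_ge_of_near (HM i t)); apply: filterS (near_win `|t|) => k kt.
    by have /andP[] := box k i t kt.
  apply: (cvg_le_of_near (HM i t)); apply: filterS (near_win `|t|) => k kt.
  by have /andP[] := box k i t kt.
have W0 i t : 0 <= W i t.
  by apply: (cvg_ge_of_near (HW i t)); apply: nearW => k; exact: expR_ge0.
have SM : \sum_i M i 0 = S / 2.
  apply: (@cvg_eq_unique _ _ U _ (fun k => \sum_i m k i 0)).
    by apply: cvg_bigsum => i; exact: HM.
  by under eq_fun do rewrite Sm; exact: cvg_cst.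
have E0 : E k @[k --> U] --> 0.
  apply: cvg_trans (cvg_app _ Uoo) _.
  apply: (squeeze_cvgr _ (cvg_cst 0) (@cvg_harmonic R)).
  by apply: nearW => k; exact: Ek.
have WL t : \sum_i W i t = 2^-1 * Lam (fun i => M i t).
  apply: (@cvg_eq_unique _ _ U _ (fun k => \sum_i V k i t)).
    by apply: cvg_bigsum => i; exact: HW.
  have : E k + 2^-1 * Lam (fun i => m k i t) @[k --> U] --> 0 + 2^-1 * Lam (fun i => M i t).
    apply: cvgD => //; apply: cvgM; first exact: cvg_cst.
    by apply: cvg_Lambda => i; exact: HM.
  rewrite add0r; apply: cvg_trans; apply: near_eq_cvg.
  by apply: filterS (near_win `|t|) => k /EV.
have MC i t : `|b i - \sum_j A i j * M j t| <= C by apply: HC => j; exact: Mbox.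
have Mh i : {homo M i : x y / x <= y} by exact: derive_homo (dM i) (W0 i).
have HN i : exists l : R, M i t @[t --> -oo] --> l.
  have [|l Hl _] := nondecreasing_bounded_cvgN (Mh i) (B := 0); last by exists l.
  by move=> t; have /andP[] := Mbox i t.
have HP i : exists l : R, M i t @[t --> +oo] --> l.
  have [|l Hl _] := nondecreasing_bounded_cvg (Mh i) (B := sigma i); last by exists l.
  by move=> t; have /andP[] := Mbox i t.
have [lN HlN] := boolp.choice HN; have [lP HlP] := boolp.choice HP.
have zero (G : set_system R) (FG : ProperFilter G) (l : 'I_n -> R) :
    (forall i, M i t @[t --> G] --> l i) -> (forall i, M i (t + 1) @[t --> G] --> l i) ->
    l = (fun=> 0) \/ l = sigma.
  move=> Ml Ml1.
  have lbox i : 0 <= l i <= sigma i.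
    apply/andP; split.
      by apply: (cvg_ge_of_near (Ml i)); apply: nearW => t; have /andP[] := Mbox i t.
    by apply: (cvg_le_of_near (Ml i)); apply: nearW => t; have /andP[] := Mbox i t.
  have [_] := Lambda_box A_ge0 A_unit sigma_gt0 sigmaL lbox; apply.
  have h : 2^-1 * Lam (fun i => M i t) @[t --> G] --> 2^-1 * Lam l.
    by apply: cvgM; [exact: cvg_cst|apply: cvg_Lambda => i; exact: Ml].
  have h' : 2^-1 * Lam (fun i => M i t) @[t --> G] --> 0.
    rewrite -[X in _ --> X](_ : \sum_(i < n) 0 = 0 :> R); last by rewrite big1.
    under eq_fun do rewrite -WL.
    apply: cvg_bigsum => i.
    exact: density_cvg0 (dM i) (dW i) (W0 i) (MC i) (Ml i) (Ml1 i).
  by have /(_ FG)/eqP := cvg_eq_unique h h'; rewrite mulf_eq0 invr_eq0 pnatr_eq0 => /eqP.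
(* The normalisation decides between the two candidates: half of the mass at time [0] excludes
   [sigma] at [-oo] and [0] at [+oo]. *)
have lN0 i : lN i = 0.
  have [->//|lNs] := zero _ _ lN HlN (fun i => cvg_shift_ninfty 1 (HlN i)).
  exfalso; move: S_half => [+ _]; apply.
  rewrite -SM /S -lNs; apply: ler_sum => j _; exact: nondecreasing_ge_lim (Mh j) (HlN j) 0.
have lPs i : lP i = sigma i.
  have [lP0|->//] := zero _ _ lP HlP (fun i => cvg_shift_pinfty 1 (HlP i)).
  exfalso; move: S_half => [_]; apply.
  rewrite -SM -[X in _ <= X](_ : \sum_(i < n) 0 = 0 :> R); last by rewrite big1.
  apply: ler_sum => j _; have lPj : lP j = 0 by rewrite lP0.
  by rewrite (le_trans (nondecreasing_le_lim (Mh j) (HlP j) 0))// lPj.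
have Wpos i t : 0 < W i t.
  rewrite lt_neqAle W0 andbT; apply/eqP => Wt.
  (* A zero of [W i] spreads over the line, because [W i x * expR (c * x)] is nondecreasing for
     [c = C] and nonincreasing for [c = - C]. Then [M i] would be constant, against its two
     different limits. *)
  have Wz s : W i s = 0.
    have dWe c (x : R) : is_derive x 1 (fun x => W i x * expR (c * x))
        (W i x * expR (c * x) * (c + (b i - \sum_j A i j * M j x))).
      have := is_derive_mul (dW i x) (is_derive_exp (is_derive_scale c (is_derive_idfun x))).
      set X := (X in is_derive _ _ _ X -> _); set Y := (Y in _ -> is_derive _ _ _ Y).
      by suff -> : X = Y by []; rewrite /X /Y; ring.
    have We0 c x : 0 <= W i x * expR (c * x) by rewrite mulr_ge0// expR_ge0.
    have Wle c : W i s * expR (c * s) <= W i t * expR (c * t) -> W i s = 0.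
      rewrite -Wt mul0r pmulr_lle0 ?expR_gt0// => Ws.
      by apply/eqP; rewrite eq_le Ws W0.
    have [st|/ltW st] := leP s t.
      apply: (Wle C); apply: (derive_ge0_le st (fun x _ => dWe C x)) => x _.
      by rewrite mulr_ge0//; have := MC i x; rewrite ler_norml => /andP[? _]; lra.
    apply: (Wle (- C)); apply: (derive_le0_ge st (fun x _ => dWe (- C) x)) => x _.
    by rewrite mulr_ge0_le0//; have := MC i x; rewrite ler_norml => /andP[_ ?]; lra.
  have Mc s : M i s = M i 0.
    by apply: derive0_const => x; rewrite -(Wz x).
  have cst0 : 0 = M i 0.
    apply: (@cvg_eq_unique _ _ (ninfty_nbhs R) _ (M i)); first by have := HlN i; rewrite lN0.
    by under eq_fun do rewrite Mc; exact: cvg_cst.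
  have : sigma i = M i 0.
    apply: (@cvg_eq_unique _ _ (pinfty_nbhs R) _ (M i)); first by have := HlP i; rewrite lPs.
    by under eq_fun do rewrite Mc; exact: cvg_cst.
  by rewrite -cst0 => s0; have := sigma_gt0 i; rewrite s0 ltxx.
exists M, (fun i t => ln (W i t)) => i; split.
- by move=> t; rewrite lnK ?posrE.
- move=> t; have := is_derive_comp (is_derive1_ln (Wpos i t)) (dW i t).
  by rewrite mulrA mulVf ?mul1r// gt_eqF.
- by have := HlN i; rewrite lN0.
- by have := HlP i; rewrite lPs.
Unshelve. all: by end_near. Qed.

End Existence.

(** * From radial solutions to orbits *)

Section Polar.
Context {R : realType}.
Local Open Scope ereal_scope.
Notation mu := (@lebesgue_measure R).
Implicit Types (f g : R -> \bar R) (c x y r s : R).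

Let D : set R := `]0%R, +oo[.

Let mD : measurable D. Proof. exact: measurable_itv. Qed.

Let scale c : measurableTypeR R -> measurableTypeR R := fun x => (c * x)%R.

Let measurable_scale c : measurable_fun setT (scale c).
Proof. exact: mulrl_measurable. Qed.

Let image_measure c : {measure set (measurableTypeR R) -> \bar R} :=
  measure_function_pushforward__canonical__measure_function_Measure mu (measurable_scale c).

(** Lebesgue measure is determined by its values on half-open intervals; the preimage of []a, b]]
    has length [(b - a) / c], and the factor [c] restores it. *)
Let lebesgue_measure_scale c (c0 : (0 < c)%R) (A : set R) : measurable A ->
  mscale (NngNum (ltW c0)) (image_measure c) A = mu A.
Proof.
move=> mA; apply/esym/lebesgue_measure_unique => //= _ [[a b]] _ <-.
rewrite /mscale/= /pushforward.
have -> : scale c @^-1` `]a, b] = `](a / c)%R, (b / c)%R]%classic.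
  apply/seteqP; split => x /=; rewrite !in_itv/= /scale;
    by rewrite ltr_pdivrMr// ler_pdivlMr// (mulrC c).
rewrite !lebesgue_measure_itv/= !lte_fin ltr_pM2r ?invr_gt0//.
case: ifP => _; last by rewrite mule0.
by rewrite -!EFinB -EFinM; congr (_%:E); field; rewrite gt_eqF.
Qed.

Lemma ge0_integral_scale f c : (0 < c)%R ->
  measurable_fun setT f -> (forall x, 0 <= f x) ->
  \int[mu]_(x in D) f x = c%:E * \int[mu]_(x in D) f (c * x)%R.
Proof.
move=> c0 mf f0.
transitivity (\int[mscale (NngNum (ltW c0)) (image_measure c)]_(x in D) f x).
  by apply: eq_measure_integral => A mA _; exact/esym/lebesgue_measure_scale.
rewrite ge0_integral_mscale//=; last exact: measurable_funTS.
congr (_ * _).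
rewrite (ge0_integral_pushforward (measurable_scale c))//=; last exact: measurable_funTS.
suff -> : scale c @^-1` D = D by [].
by apply/seteqP; split => x; rewrite /D/= !in_itv/= /scale !andbT pmulr_rgt0.
Qed.

Lemma ge0_integral_even f : measurable_fun setT f -> (forall x, 0 <= f x) ->
  (forall x, f (- x)%R = f x) -> \int[mu]_x f x = 2%:E * \int[mu]_(x in D) f x.
Proof.
move=> mf f0 fN.
have DE : D = ~` `]-oo, 0%R] by rewrite setCitvl.
have -> : [set: R] = `]-oo, 0%R] `|` D by rewrite DE setUv.
rewrite ge0_integral_setU//=; last 2 first.
- by apply: measurable_funTS.
- by rewrite DE; apply/disj_setPCl.
rewrite -[2%:E]/((1 + 1)%:E) EFinD ge0_muleDl// mul1e; congr (_ + _).
rewrite integral_itv_obnd_cbnd; last exact: measurable_funTS.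
rewrite ge0_integration_by_substitution0//.
by apply: eq_integral => x _; rewrite fN.
Qed.

Let measurable_sqrt : measurable_fun [set: R] (@Num.sqrt R).
Proof. by apply: continuous_measurable_fun; exact: sqrt_continuous. Qed.

Lemma measurable_enorm : measurable_fun [set: R * R] (@enorm R).
Proof.
apply: (measurableT_comp measurable_sqrt).
by apply: measurable_funD; apply: measurable_funX;
  [exact: measurable_fst|exact: measurable_snd].
Qed.

(** The integrand after [y = x s], with Jacobian [x], extended by [0] off the open first quadrant so
    that both iterated integrals run over the whole line. *)
Let h (f : R -> R) (z : R * R) : R :=
  if (0 < z.1)%R && (0 < z.2)%R then (z.1 * f (z.1 * Num.sqrt (1 + z.2 ^+ 2)))%R else 0%R.

Let measurable_h (f : R -> R) : measurable_fun setT f -> measurable_fun setT (EFin \o h f).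
Proof.
move=> mf; apply/measurable_EFinP.
apply: measurable_fun_ifT.
- apply: measurable_and; apply: measurable_fun_ltr => //.
- apply: measurable_funM; first exact: measurable_fst.
  apply: (measurableT_comp mf); apply: measurable_funM; first exact: measurable_fst.
  apply: (measurableT_comp measurable_sqrt); apply: measurable_funD => //.
  by apply: measurable_funX; exact: measurable_snd.
- exact: measurable_cst.
Qed.

(* On the half plane x > 0 the substitution y = x s replaces polar coordinates:
   it only needs the scaling of one-dimensional integrals. *)
Lemma integral_enorm (f : R -> R) : measurable_fun setT f -> (forall x, 0 <= f x)%R ->
  \int[lebesgue2 R]_z (f (enorm z))%:E =
  (2 * pi)%:E * \int[mu]_(r in D) (r * f r)%:E.
Proof.
move=> mf f0.
have mF : measurable_fun [set: R * R] (fun z => (f (enorm z))%:E).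
  by apply/measurable_EFinP; exact: (measurableT_comp mf measurable_enorm).
have mxF x : measurable_fun setT (fun y => (f (enorm (x, y)))%:E).
  by apply: (measurable_fun_pair2 (f := fun z => (f (enorm z))%:E)).
have sq0 s : (0 < Num.sqrt (1 + s ^+ 2))%R.
  by rewrite sqrtr_gt0 ltr_pwDl// sqr_ge0.
have mh := measurable_h mf.
have h0 (f' : R -> R) : (forall x, 0 <= f' x)%R -> forall z, 0 <= (h f' z)%:E.
  by move=> f'0 z; rewrite lee_fin /h; case: ifP => // /andP[z1 _]; rewrite mulr_ge0// ltW.
have F0 (z : R * R) : 0 <= (f (enorm z))%:E by rewrite lee_fin.
have mFF : measurable_fun setT (fubini_F mu (fun z => (f (enorm z))%:E)).
  exact: measurable_fun_fubini_tonelli_F.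
have mhF : measurable_fun setT (fubini_F mu (EFin \o h f)).
  by apply: measurable_fun_fubini_tonelli_F => //; exact: h0.
rewrite fubini_tonelli1//=.
rewrite /fubini_F/= ge0_integral_even; last 3 first.
- exact: mFF.
- by move=> x; apply: integral_ge0 => y _; rewrite lee_fin.
- by move=> x; apply: eq_integral => y _; rewrite /enorm/= sqrrN.
have -> : \int[mu]_(x in D) \int[mu]_y (f (enorm (x, y)))%:E =
          2%:E * \int[mu]_x \int[mu]_s (h f (x, s))%:E.
  rewrite -ge0_integralZl//; last first.
    by move=> x _; apply: integral_ge0 => y _; exact: h0.
  rewrite [LHS]integral_mkcond. apply: eq_integral => x _; rewrite patchE.
  case: ifPn => [|/negP xD]; last first.
    rewrite integral0_eq ?mule0// => s _; rewrite /h/=; case: ifP => // /andP[x0 _].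
    by exfalso; apply: xD; rewrite inE /D/= in_itv/= x0.
  rewrite inE /D/= in_itv/= andbT => x0.
  rewrite (ge0_integral_even (mxF x)); last 2 first.
  - by move=> y; rewrite lee_fin.
  - by move=> y; rewrite /enorm/= sqrrN.
  apply: (congr1 (mule 2)); rewrite (ge0_integral_scale x0 (mxF x)); last by move=> y; rewrite lee_fin.
  have m1 : measurable_fun D (fun s => (f (enorm (x, x * s)%R))%:E).
    by apply: measurable_funTS; apply: (measurableT_comp (mxF x)); exact: mulrl_measurable.
  rewrite -(ge0_integralZl mu mD m1); last 2 first.
  - by move=> y _; rewrite lee_fin.
  - by rewrite lee_fin ltW.
  rewrite [LHS]integral_mkcond; apply: eq_integral => s _; rewrite patchE.
  case: ifPn => [|/negP sD]; last first.
    rewrite /h/= x0/=; case: ifP => // s0.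
    by exfalso; apply: sD; rewrite inE /D/= in_itv/= s0.
  rewrite inE /D/= in_itv/= andbT => s0.
  rewrite /h/= x0 s0/= -EFinM /enorm/=; congr ((_ * f _)%:E).
  have -> : (x ^+ 2 + (x * s) ^+ 2 = x ^+ 2 * (1 + s ^+ 2))%R by ring.
  by rewrite sqrtrM ?sqr_ge0// sqrtr_sqr gtr0_norm.
have -> : \int[mu]_x \int[mu]_s (h f (x, s))%:E = \int[mu]_s \int[mu]_x (h f (x, s))%:E.
  exact: (fubini_tonelli (m1 := mu) (m2 := mu) (EFin \o h f) mh (h0 _ f0)).
set K := \int[mu]_(r in D) (r * f r)%:E.
have K0 : 0 <= K.
  apply: integral_ge0 => r; rewrite /D/= in_itv/= andbT => r0.
  by rewrite lee_fin mulr_ge0// ltW.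
(* For fixed [s] the variable [x] is rescaled by [Num.sqrt (1 + s ^+ 2)], which separates the
   variables. *)
have inner s : \int[mu]_x (h f (x, s))%:E =
    if (0 < s)%R then (oneDsqr s)^-1%:E * K else 0.
  case: ifPn => s0; last first.
    by rewrite integral0_eq// => x _; rewrite /h/= (negbTE s0) andbF.
  pose c := Num.sqrt (1 + s ^+ 2).
  have c0 : (0 < c)%R by exact: sq0.
  have -> : \int[mu]_x (h f (x, s))%:E = \int[mu]_(x in D) (x * f (c * x))%:E.
    rewrite [RHS]integral_mkcond; apply: eq_integral => x _; rewrite patchE /h/= s0 andbT.
    case: ifPn => [x0|xN0]; first by rewrite ifT ?(mulrC c)// inE /D/= in_itv/= x0.
    by rewrite ifF//; apply/negP; rewrite inE /D/= in_itv/= andbT; exact/negP.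
  have E : K = (c ^+ 2)%:E * \int[mu]_(x in D) (x * f (c * x))%:E.
    have -> : K = \int[mu]_(r in D) (`|r| * f r)%:E.
      apply: eq_integral => r; rewrite inE /D/= in_itv/= andbT => r0.
      by rewrite gtr0_norm.
    have m0 : measurable_fun setT (fun r => (`|r| * f r)%:E).
      by apply/measurable_EFinP; apply: measurable_funM => //; exact: measurable_normr.
    rewrite (ge0_integral_scale c0 m0); last by move=> x; rewrite lee_fin mulr_ge0.
    rewrite expr2 EFinM -muleA; apply: (congr1 (mule c%:E)).
    have m1 : measurable_fun D (fun x => (x * f (c * x))%:E).
      apply: measurable_funTS; apply/measurable_EFinP; apply: measurable_funM => //.
      by apply: (measurableT_comp mf); exact: mulrl_measurable.
    rewrite -(ge0_integralZl mu mD m1); last 2 first.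
    - by move=> r; rewrite /D/= in_itv/= andbT => r0; rewrite lee_fin mulr_ge0// ltW.
    - by rewrite lee_fin ltW.
    apply: eq_integral => r; rewrite inE /D/= in_itv/= andbT => r0.
    by rewrite -EFinM gtr0_norm ?mulr_gt0// mulrA.
  have c2 : (c ^+ 2 = oneDsqr s)%R.
    by rewrite /c sqr_sqrtr// addr_ge0// sqr_ge0.
  rewrite E c2 muleA -EFinM mulVf ?mul1e// gt_eqF//.
under eq_integral do rewrite inner.
have -> : \int[mu]_s (if (0 < s)%R then (oneDsqr s)^-1%:E * K else 0) =
          \int[mu]_(s in D) ((oneDsqr s)^-1%:E * K).
  rewrite [RHS]integral_mkcond; apply: eq_integral => s _; rewrite patchE.
  case: ifPn => [s0|sN0]; first by rewrite ifT// inE /D/= in_itv/= s0.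
  by rewrite ifF//; apply/negP; rewrite inE /D/= in_itv/= andbT; exact/negP.
have mone : measurable_fun setT (fun s => (oneDsqr s)^-1%:E : \bar R).
  by apply/measurable_EFinP; apply: continuous_measurable_fun; exact: continuous_oneDsqrV.
have one_ge0 s : D s -> 0 <= (oneDsqr s)^-1%:E.
  by move=> _; rewrite lee_fin invr_ge0 addr_ge0// sqr_ge0.
rewrite (ge0_integralZr mu mD (measurable_funTS mone) one_ge0 K0).
rewrite integral_itv_obnd_cbnd; last exact: measurable_funTS.
(* The arctangent integral [pi / 2] and the factor 4 from the two reflections give [2 * pi]. *)
rewrite integral0y_oneDsqr !muleA -!EFinM; congr (_%:E * _).
by field.
Qed.

End Polar.

(** * The substitution [t = ln r] in integrals *)

Section LogIntegral.
Context {R : realType}.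
Notation mu := (@lebesgue_measure R).
Variables (m V : R -> R).
Hypothesis dm : forall t : R, is_derive t 1 m (V t).
Hypothesis cV : continuous V.
Hypothesis V_ge0 : forall t, 0 <= V t.
Implicit Types (s t r : R).

Let f r := V (ln r) / r.

Let cf r : 0 < r -> {for r, continuous f}.
Proof.
move=> r0; apply: cvgM; last by apply: cvgV; [rewrite gt_eqF|exact: cvg_id].
by apply: continuous_comp; [exact: continuous_ln|exact: cV].
Qed.

Let f_ge0 r : 0 < r -> 0 <= f r.
Proof. by move=> r0; rewrite divr_ge0// ltW. Qed.

Let dF r : 0 < r -> is_derive r 1 (fun r => m (ln r)) (f r).
Proof. by move=> r0; apply: is_derive_comp (dm _) (is_derive1_ln r0). Qed.

Let segment s t : s < t ->
  (\int[mu]_(r in `[expR s, expR t]) (f r)%:E = (m t - m s)%:E)%E.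
Proof.
move=> st.
have pos r : expR s <= r -> 0 < r by apply: lt_le_trans; exact: expR_gt0.
rewrite (@continuous_FTC2 _ f (fun r => m (ln r)))//.
- by rewrite !expRK EFinB.
- by rewrite ltr_expR.
- apply: continuous_in_subspaceT => r; rewrite inE/= in_itv/= => /andP[h _].
  by apply: cf; exact: pos.
- split.
  + by move=> r; rewrite in_itv/= => /andP[h _]; have [] := dF (pos _ (ltW h)).
  + by apply: cvg_at_right_filter; apply: is_derive_continuous (dF _); exact: expR_gt0.
  + by apply: cvg_at_left_filter; apply: is_derive_continuous (dF _); exact: expR_gt0.
- move=> r; rewrite in_itv/= => /andP[h _]; rewrite derive1E.
  by have [_ ->] := dF (pos _ (ltW h)).
Qed.

Let mD : measurable (`]0, +oo[ : set R). Proof. exact: measurable_itv. Qed.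

Let mf : measurable_fun (`]0, +oo[ : set R) (EFin \o f).
Proof.
apply/measurable_EFinP; apply: open_continuous_measurable_fun => //.
by move=> r; rewrite inE/= in_itv/= andbT; exact: cf.
Qed.

(** Serves before [m] is known to have limits: a finite integral bounds all increments of [m], and
    this makes the limits exist. *)
Lemma le_integral_log s t : s < t ->
  ((m t - m s)%:E <= \int[mu]_(r in `]0%R, +oo[) (V (ln r) / r)%:E)%E.
Proof.
move=> st; rewrite -segment//; apply: ge0_subset_integral => //=.
- by move=> r; rewrite /= in_itv/= andbT lee_fin; exact: f_ge0.
- move=> r; rewrite /= !in_itv/= andbT => /andP[h _].
  exact: lt_le_trans (expR_gt0 s) h.
Qed.

(** Monotone convergence over the segments with end points [expR (- k.+1%:R)] and [expR k.+1%:R], on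
    which the integral is an increment of [m]. *)
Lemma integral_log l0 l1 : m t @[t --> -oo] --> l0 -> m t @[t --> +oo] --> l1 ->
  (\int[mu]_(r in `]0%R, +oo[) (V (ln r) / r)%:E = (l1 - l0)%:E)%E.
Proof.
move=> m0 m1.
pose F (k : nat) : set R := `[expR (- k.+1%:R), expR k.+1%:R]%classic.
have UF : `]0, +oo[%classic = \bigcup_k F k.
  apply/seteqP; split => [r|r [k _]] /=; rewrite !in_itv/= ?andbT; last first.
    by move=> /andP[h _]; exact: lt_le_trans (expR_gt0 _) h.
  move=> r0; exists (Num.truncn `|ln r|) => //=; rewrite /F/= in_itv/=.
  have h : `|ln r| <= (Num.truncn `|ln r|).+1%:R.
    by apply/ltW/truncnS_gt; exact: num_real.
  move: h; rewrite ler_norml -[X in _ -> _ <= X <= _](lnK r0).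
  by rewrite !ler_expR.
have cvg_int : (\int[mu]_(r in F k) (f r)%:E @[k --> \oo] -->
    \int[mu]_(r in `]0%R, +oo[) (f r)%:E)%E.
  rewrite UF; apply: ge0_nondecreasing_set_cvg_integral => //.
  - move=> k l kl; apply/subsetPset => r; rewrite /F/= !in_itv/= => /andP[h1 h2].
    apply/andP; split; [apply: le_trans h1|apply: le_trans h2 _];
      by rewrite ler_expR ?lerN2 ler_nat.
  - by move=> k; exact: measurable_itv.
  - move=> k; apply: measurable_funS mf => //.
    by rewrite UF; exact: bigcup_sup.
  - by move=> k r; rewrite /F/= in_itv/= => /andP[h _]; rewrite lee_fin f_ge0// (lt_le_trans (expR_gt0 _) h).
have Fk k : (\int[mu]_(r in F k) (f r)%:E = (m k.+1%:R - m (- k.+1%:R))%:E)%E.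
  by rewrite segment// (@lt_trans _ _ 0) ?ltr0n// oppr_lt0 ltr0n.
have cvg_m : m k.+1%:R - m (- k.+1%:R) @[k --> \oo] --> l1 - l0.
  have cy : (k.+1%:R : R) @[k --> \oo] --> +oo.
    apply/cvgryPge => B; near=> k; apply: (@le_trans _ _ k%:R); last by rewrite ler_nat.
    by near: k; exact: nbhs_infty_ger.
  apply: cvgB; first exact: (cvg_comp _ m cy).
  exact: (cvg_comp _ (fun t => m (- t)) cy (cvg_reflect_pinfty m0)).
rewrite (_ : (fun k => _) = EFin \o (fun k => m k.+1%:R - m (- k.+1%:R))) in cvg_int; last first.
  by apply/funext => k; rewrite Fk.
apply: (cvg_unique _ cvg_int); first exact: ereal_hausdorff.
by apply: cvg_EFin => //; exact: nearW.
Unshelve. all: by end_near. Qed.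

End LogIntegral.

(** * Partial derivatives as derivatives of slices, and the Euclidean norm *)

Section PlaneSections.
Context {R : realType}.
Implicit Types (f : R * R -> R) (x y d : R) (z : R * R).

Let e1E f x y : (fun h : R => f (h *: e1 R + (x, y))) = (fun h : R => f (h *: 1 + x, y)).
Proof.
by apply/funext => h; congr (f (_, _)); rewrite /= /GRing.scale/= mulr0 add0r.
Qed.

Let e2E f x y : (fun h : R => f (h *: e2 R + (x, y))) = (fun h : R => f (x, h *: 1 + y)).
Proof.
by apply/funext => h; congr (f (_, _)); rewrite /= /GRing.scale/= mulr0 add0r.
Qed.

Let quot1 f x y : (fun h => h^-1 *: ((f \o shift (x, y)) (h *: e1 R) - f (x, y))) =
  (fun h => h^-1 *: (((fun s => f (s, y)) \o shift x) (h *: 1) - f (x, y))).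
Proof.
apply/funext => h; congr (_ *: (_ - _)).
exact: (congr1 (fun g => g h) (e1E f x y)).
Qed.

Let quot2 f x y : (fun h => h^-1 *: ((f \o shift (x, y)) (h *: e2 R) - f (x, y))) =
  (fun h => h^-1 *: (((fun s => f (x, s)) \o shift y) (h *: 1) - f (x, y))).
Proof.
apply/funext => h; congr (_ *: (_ - _)).
exact: (congr1 (fun g => g h) (e2E f x y)).
Qed.

Lemma is_derive_e1 f x y d :
  is_derive (x, y) (e1 R) f d <-> is_derive x 1 (fun s => f (s, y)) d.
Proof.
by split => -[df <-]; apply: DeriveDef;
  move: df; rewrite /derivable /derive ?quot1.
Qed.

Lemma is_derive_e2 f x y d :
  is_derive (x, y) (e2 R) f d <-> is_derive y 1 (fun s => f (x, s)) d.
Proof.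
by split => -[df <-]; apply: DeriveDef;
  move: df; rewrite /derivable /derive ?quot2.
Qed.

Lemma enorm_x0 x : 0 <= x -> enorm (x, 0 : R) = x.
Proof. by move=> x0; rewrite /enorm/= expr0n addr0 sqrtr_sqr ger0_norm. Qed.

Lemma sqr_enorm z : enorm z ^+ 2 = z.1 ^+ 2 + z.2 ^+ 2.
Proof. by rewrite /enorm sqr_sqrtr// addr_ge0// sqr_ge0. Qed.

Lemma enorm_ge0 z : 0 <= enorm z.
Proof. exact: sqrtr_ge0. Qed.

Lemma enorm_gt0 z : z != 0 -> 0 < enorm z.
Proof.
case: z => x y z0; rewrite sqrtr_gt0 lt_neqAle addr_ge0 ?sqr_ge0// andbT eq_sym.
rewrite paddr_eq0 ?sqr_ge0// !sqrf_eq0 /=.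
by apply: contra_neqN z0 => /andP[/eqP -> /eqP ->].
Qed.

Lemma continuous_enorm : continuous (@enorm R).
Proof.
move=> z; apply: (cvg_comp (fun z : R * R => z.1 ^+ 2 + z.2 ^+ 2) Num.sqrt);
  last exact: sqrt_continuous.
apply: cvgD; apply: (cvg_comp _ (fun x : R => x ^+ 2) _ (@exprn_continuous _ 2 _)).
  exact: cvg_fst.
exact: cvg_snd.
Qed.

End PlaneSections.

Section RadialDensity.
Context {R : realType} {n : nat}.
Variables (beta : 'I_n -> R) (u : 'I_n -> R * R -> R) (i : 'I_n).
Hypothesis u_rad : is_radial u.
Hypothesis cu : continuous (u i).
Implicit Types (r t : R) (z : R * R).

Notation mu := (@lebesgue_measure R).

Lemma radial_profile z : u i z = profile u i (enorm z).
Proof. by apply: u_rad; rewrite enorm_x0// enorm_ge0. Qed.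

Lemma continuous_profile : continuous (profile u i).
Proof.
move=> r.
have h : (s, 0 : R) @[s --> r] --> ((r, 0) : R * R).
  by apply: (cvg_pair (G := nbhs r) (H := nbhs (0 : R))); [exact: cvg_id|exact: cvg_cst].
exact: (cvg_comp _ (u i) h (@cu (r, 0))).
Qed.

Lemma powR_of_expR t (c : R) : expR t `^ c = expR (c * t).
Proof. by rewrite /powR gt_eqF ?expR_gt0// expRK. Qed.

(** Origin of the exponent [beta i + 2]: one factor [r] comes from polar coordinates and one from
    [dr = r dt]. *)
Lemma radial_integrand r : 0 < r ->
  r * (r `^ beta i * expR (profile u i r)) =
  expR (profile u i (expR (ln r)) + (beta i + 2) * ln r) / r.
Proof.
move=> r0; have [t ->] : exists t, r = expR t by exists (ln r); rewrite lnK.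
rewrite powR_of_expR expRK -expRN -!expRD; congr expR; ring.
Qed.

Lemma integral_density :
  (\int[lebesgue2 R]_x (density beta u i x)%:E = (2 * pi)%:E *
   \int[mu]_(r in `]0%R, +oo[)
     (expR (profile u i (expR (ln r)) + (beta i + 2) * ln r) / r)%:E)%E.
Proof.
pose f r := r `^ beta i * expR (profile u i r).
have mf : measurable_fun setT f.
  apply: measurable_funM; first exact: measurable_powR.
  apply: (measurableT_comp (@measurable_expR R)); apply: continuous_measurable_fun.
  exact: continuous_profile.
have f0 x : 0 <= f x by rewrite mulr_ge0 ?powR_ge0 ?expR_ge0.
transitivity (\int[lebesgue2 R]_x (f (enorm x))%:E)%E.
  by apply: eq_integral => x _; rewrite /density radial_profile.
rewrite (integral_enorm mf f0); apply: (congr1 (mule (2 * pi)%:E)).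
apply: eq_integral => r; rewrite inE/= in_itv/= andbT => r0.
by rewrite radial_integrand.
Qed.

End RadialDensity.

(** * The autonomous system satisfied by a radial solution *)

Section RadialToFlow.
Context {R : realType} {n : nat}.
Variables (A : 'M[R]_n) (beta : 'I_n -> R) (u : 'I_n -> R * R -> R).
Hypothesis u_sol : is_solution A beta u.
Hypothesis u_rad : is_radial u.
Implicit Types (i j : 'I_n) (r s t y : R).

Notation mu := (@lebesgue_measure R).
Let b i := beta i + 2.
Let p := profile u.
Let p1 i r : R := 'D_(e1 R) (u i) (r, 0).
Let p2 i r : R := 'D_(e1 R) (fun z => 'D_(e1 R) (u i) z) (r, 0).
Let w i t : R := p i (expR t) + b i * t.
Let W1 i t : R := p1 i (expR t) * expR t.

Let nz r y : 0 < r -> ((r, y) : R * R) != 0.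
Proof. by move=> r0; apply/eqP => -[E _]; rewrite E ltxx in r0. Qed.

Let dp i r : 0 < r -> is_derive r 1 (p i) (p1 i r).
Proof.
move=> r0; have [_ [_ cku] _ _ _] := u_sol i.
have [du _] := cku (e1 R) (or_introl erefl).
exact: (proj1 (is_derive_e1 (u i) r 0 _) (derivableP (du _ (nz 0 r0)))).
Qed.

Let dp1 i r : 0 < r -> is_derive r 1 (p1 i) (p2 i r).
Proof.
move=> r0; have [_ [_ cku] _ _ _] := u_sol i.
have [_ [_ cku1]] := cku (e1 R) (or_introl erefl).
have [du _] := cku1 (e1 R) (or_introl erefl).
exact: (proj1 (is_derive_e1 (fun z => 'D_(e1 R) (u i) z) r 0 _) (derivableP (du _ (nz 0 r0)))).
Qed.

Let d_enorm r y : 0 < r -> is_derive y 1 (fun s => enorm (r, s)) (y / enorm (r, y)).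
Proof.
move=> r0; have q0 : 0 < r ^+ 2 + y ^+ 2 by rewrite ltr_pwDl ?sqr_ge0// exprn_gt0.
have d1 : is_derive y 1 (fun s : R => r ^+ 2 + s * s) (0 + (y * 1 + y * 1)).
  exact: is_derive_add (is_derive_const _ _) (is_derive_mul (is_derive_idfun _) (is_derive_idfun _)).
have d2 := is_derive_comp (g := fun s => r ^+ 2 + s * s)
    (is_derive1_sqrt (q0 : 0 < r ^+ 2 + y * y)) d1.
have E : (2 * Num.sqrt (r ^+ 2 + y * y))^-1 * (0 + (y * 1 + y * 1)) = y / enorm (r, y).
  rewrite /enorm/= -expr2; field.
  by rewrite gt_eqF// sqrtr_gt0.
by rewrite -E; exact: d2.
Qed.

Let u_e2 i r y : 0 < r ->
  'D_(e2 R) (u i) (r, y) = p1 i (enorm (r, y)) * (y / enorm (r, y)).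
Proof.
move=> r0; suff /is_derive_e2[_ //] :
  is_derive y 1 (fun s => u i (r, s)) (p1 i (enorm (r, y)) * (y / enorm (r, y))).
have -> : (fun s => u i (r, s)) = (fun s => p i (enorm (r, s))).
  by apply/funext => s; exact: radial_profile.
apply: is_derive_comp (d_enorm y r0).
by apply: dp; apply: enorm_gt0; exact: nz.
Qed.

(** On the horizontal axis the second derivative across the radius is the first-order term of the
    Laplacian in polar coordinates: the derivative of [enorm (r, s)] vanishes at [s = 0], so only
    the factor [s] is differentiated. *)
Let u_e22 i r : 0 < r ->
  'D_(e2 R) (fun z => 'D_(e2 R) (u i) z) (r, 0) = p1 i r / r.
Proof.
move=> r0; suff /(is_derive_e2 (fun z => 'D_(e2 R) (u i) z))[_ //] :
  is_derive (0 : R) 1 (fun s => 'D_(e2 R) (u i) (r, s)) (p1 i r / r).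
have -> : (fun s => 'D_(e2 R) (u i) (r, s)) =
    (fun s => p1 i (enorm (r, s)) * (s * (enorm (r, s))^-1)).
  by apply/funext => s; exact: u_e2.
have er : enorm (r, 0) = r by rewrite enorm_x0// ltW.
have dr : is_derive (0 : R) 1 (fun s => enorm (r, s)) 0.
  by have := d_enorm 0 r0; rewrite mul0r.
have d1 : is_derive (0 : R) 1 (fun s => p1 i (enorm (r, s))) (p2 i r * 0).
  by apply: is_derive_comp dr; rewrite er; exact: dp1.
have d2 : is_derive (0 : R) 1 (fun s => (enorm (r, s))^-1) (- (enorm (r, 0)) ^- 2 *: 0).
  by apply: is_deriveV => //; rewrite er gt_eqF.
have := is_derive_mul d1 (is_derive_mul (is_derive_idfun 0) d2).
set X := (X in is_derive _ _ _ X -> _); suff -> : X = p1 i r / r by [].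
by rewrite /X er scaler0; ring.
Qed.

Let ode i r : 0 < r ->
  p2 i r + p1 i r / r + \sum_j A i j * (r `^ beta j * expR (p j r)) = 0.
Proof.
move=> r0; have [_ _ eq _ _] := u_sol i.
have := eq (r, 0) (nz 0 r0); rewrite /laplacian (u_e22 i r0).
suff -> : \sum_j A i j * density beta u j (r, 0) =
  \sum_j A i j * (r `^ beta j * expR (p j r)) by [].
by apply: eq_bigr => j _; rewrite /density enorm_x0// ltW.
Qed.

Let dW i t : is_derive t 1 (fun t => p i (expR t)) (W1 i t).
Proof. by apply: is_derive_comp; apply: dp; exact: expR_gt0. Qed.

(** Multiplying the radial equation by [r ^+ 2] turns [u'' + u' / r] into the second derivative with
    respect to [t] and absorbs the weights into [expR (w j t)]. *)
Let dW1 i t : is_derive t 1 (W1 i) (- \sum_j A i j * expR (w j t)).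
Proof.
have et := expR_gt0 t.
have d1 : is_derive t 1 (fun t => p1 i (expR t)) (p2 i (expR t) * expR t).
  by apply: is_derive_comp; exact: dp1.
have := is_derive_mul d1 (is_derive_expR t).
set X := (X in is_derive _ _ _ X -> _); set Y := (Y in _ -> is_derive _ _ _ Y).
suff -> : X = Y by [].
have H := ode i et.
have E : \sum_j A i j * expR (w j t) =
    expR t ^+ 2 * \sum_j A i j * (expR t `^ beta j * expR (p j (expR t))).
  rewrite mulr_sumr; apply: eq_bigr => j _.
  have -> : w j t = t + t + (beta j * t + p j (expR t)) by rewrite /w /b; ring.
  by rewrite powR_of_expR 2!expRD (expRD (beta j * t)) expr2; ring.
rewrite /Y E /X; move: H; set Q := \sum_j _ => H.
have -> : Q = - (p2 i (expR t) + p1 i (expR t) / expR t) by lra.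
by field; rewrite gt_eqF.
Qed.

Let cu i : continuous (u i). Proof. by have [] := u_sol i. Qed.

Let cp i : continuous (p i). Proof. exact: continuous_profile. Qed.

Let dw i t : is_derive t 1 (w i) (W1 i t + b i).
Proof. by have := is_derive_add (dW i t) (is_derive_scale (b i) (is_derive_idfun t)); rewrite mulr1. Qed.

Let cw i : continuous (fun t => expR (w i t)).
Proof.
by move=> t; apply: continuous_comp; [exact: is_derive_continuous (dw i t)|exact: continuous_expR].
Qed.

Let I i := (\int[mu]_(r in `]0%R, +oo[) (expR (w i (ln r)) / r)%:E)%E.

Let density_integral i :
  (\int[lebesgue2 R]_x (density beta u i x)%:E = (2 * pi)%:E * I i)%E.
Proof. exact: integral_density. Qed.

(** Finite energy makes a primitive of each density converge at both ends, and [m] is normalised to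
    vanish at [-oo]. The equation then says that [W1 i t + \sum_j A i j * m j t] is constant;
    continuity at the origin forces this constant to be [0], since another value would mean a
    logarithmic singularity. *)
Lemma radial_flow : exists (m : 'I_n -> R -> R) (sigma : 'I_n -> R),
  [/\ flow A (fun i => beta i + 2) sigma m
        (fun i t => profile u i (expR t) + (beta i + 2) * t),
      energy beta u = sigma &
    forall i, (\int[mu]_(r in `[0%R, +oo[) (r `^ (beta i + 1) * expR (profile u i r))%:E
      = (sigma i)%:E)%E].
Proof.
have prim i : exists M : R -> R, forall t : R, is_derive t 1 M (expR (w i t)).
  by apply: continuous_primitive; exact: cw.
have [M dM] := boolp.choice prim.
have Mh i : {homo M i : x y / x <= y}.
  by apply: derive_homo (dM i) _ => t; exact: expR_ge0.
have pi0 : 0 < 2 * pi :> R by rewrite mulr_gt0// pi_gt0.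
have Ifin i : (I i < +oo)%E.
  have [_ _ _ _] := u_sol i; rewrite density_integral.
  rewrite ltey => H; rewrite ltey; apply: contra_neq H => ->.
  by rewrite gt0_muley// lte_fin.
have I0 i : (0 <= I i)%E.
  apply: integral_ge0 => r; rewrite /= in_itv/= andbT => r0.
  by rewrite lee_fin divr_ge0 ?expR_ge0// ltW.
have Mlip i s t : s < t -> M i t - M i s <= fine (I i).
  move=> st; have := le_integral_log (dM i) (@cw i) (fun t => expR_ge0 _) st.
  by rewrite -/(I i) -lee_fin fineK// ge0_fin_numE.
have lim0 i : exists l : R, M i t @[t --> -oo] --> l.
  have [|l Hl _] := nondecreasing_bounded_cvgN (Mh i) (B := M i 0 - fine (I i)); last by exists l.
  move=> t; have [t0|t0] := ltP t 0; first by have := Mlip i _ _ t0; lra.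
  have := Mh i _ _ t0; have : 0 <= fine (I i) by exact: fine_ge0.
  lra.
have lim1 i : exists l : R, M i t @[t --> +oo] --> l.
  have [|l Hl _] := nondecreasing_bounded_cvg (Mh i) (B := M i 0 + fine (I i)); last by exists l.
  move=> t; have [t0|t0] := ltP 0 t; first by have := Mlip i _ _ t0; lra.
  have := Mh i _ _ t0; have : 0 <= fine (I i) by exact: fine_ge0.
  lra.
have [L0 HL0] := boolp.choice lim0; have [L1 HL1] := boolp.choice lim1.
pose m i t := M i t - L0 i.
pose sigma i := L1 i - L0 i.
have dm i (t : R) : is_derive t 1 (m i) (expR (w i t)).
  by have := is_derive_sub (dM i t) (is_derive_const (L0 i) t); rewrite subr0.
have m0 i : m i t @[t --> -oo] --> 0.
  by rewrite -[X in _ --> X](subrr (L0 i)); apply: cvgB => //; exact: cvg_cst.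
have m1 i : m i t @[t --> +oo] --> sigma i by apply: cvgB => //; exact: cvg_cst.
have IE i : (I i = (sigma i)%:E)%E.
  by rewrite /I (integral_log (dM i) (@cw i) (fun t => expR_ge0 _) (HL0 i) (HL1 i)).
have W1E i t : W1 i t = - \sum_j A i j * m j t.
  pose G t := W1 i t + \sum_j A i j * m j t.
  have dG (s : R) : is_derive s 1 G 0.
    rewrite -(addNr (\sum_j A i j * expR (w j s))).
    exact: is_derive_add (dW1 i s)
      (is_derive_bigsum _ (fun j => is_derive_scale (A i j) (dm j s))).
  have Gc s : G s = G 0 by exact: derive0_const.
  have Sm : \sum_j A i j * m j t @[t --> -oo] --> 0.
    rewrite -[X in _ --> X](_ : \sum_j A i j * 0 = 0); last by rewrite big1// => j _; rewrite mulr0.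
    by apply: cvg_bigsum => j; apply: cvgM => //; exact: cvg_cst.
  have W1c : W1 i t @[t --> -oo] --> G 0.
    have : G 0 - \sum_j A i j * m j t @[t --> -oo] --> G 0 - 0 by apply: cvgB => //; exact: cvg_cst.
    rewrite subr0; apply: cvg_trans; apply: near_eq_cvg; apply: nearW => s.
    by rewrite -(Gc s) /G addrK.
  have Wc : p i (expR t) @[t --> -oo] --> p i 0.
    have e0 : expR t @[t --> -oo] --> (0 : R) by exact/cvgNy_compNP/cvgr_expR.
    exact: (cvg_comp _ (p i) e0 (@cp i 0)).
  suff G0 : G 0 = 0.
    by have := Gc t; rewrite G0 /G => ?; lra.
  have Wd : p i (expR (t + 1)) - p i (expR t) @[t --> -oo] --> 0.
    rewrite -[X in _ --> X](subrr (p i 0)); apply: cvgB => //.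
    exact: (@cvg_shift_ninfty _ (fun t => p i (expR t))).
  apply/esym; apply: (cvg_eq_unique Wd).
  (* The increment of [u] over a unit of [t] tends to [0] by continuity at the origin; it is also a
     value of [W1 i] at a time tending to [-oo], hence tends to [G 0]. *)
  have Hmv s : exists c, s <= c <= s + 1 /\ p i (expR (s + 1)) - p i (expR s) = W1 i c.
    have ss : s <= s + 1 by rewrite lerDl.
    have [c cs] := mean_value ss (fun x _ => dW i x).
    by rewrite [X in _ * X](_ : s + 1 - s = 1) ?mulr1 => [E|]; [exists c|ring].
  have [c Hc] := boolp.choice Hmv.
  have -> : (fun t => p i (expR (t + 1)) - p i (expR t)) = (fun t => W1 i (c t)).
    by apply/funext => s; have [_ ->] := Hc s.
  apply: (cvg_comp c (W1 i) _ W1c); apply/cvgrNyPle => B; near=> s.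
  have [/andP[_ cs] _] := Hc s; apply: le_trans cs _.
  rewrite -lerBrDr; near: s; exact: nbhs_ninfty_le (num_real _).
exists m, sigma; split.
- move=> i; split => // t.
  by have := dw i t; rewrite W1E addrC.
- apply/funext => i; rewrite /energy /Rintegral density_integral IE /=.
  by rewrite mulrA mulVf ?mul1r// gt_eqF.
- move=> i; rewrite -integral_itv_obnd_cbnd; last first.
    apply: measurable_funTS; apply/measurable_EFinP; apply: measurable_funM.
      exact: measurable_powR.
    apply: (measurableT_comp (@measurable_expR R)); apply: continuous_measurable_fun.
    exact: cp.
  rewrite -IE /I; apply: eq_integral => r; rewrite inE/= in_itv/= andbT => r0.
  rewrite /w /p /b -radial_integrand// mulrA; congr (_ * _)%:E.
  rewrite powRD; last by rewrite (gt_eqF r0) implybT.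
  by rewrite powRr1 ?(ltW r0)// mulrC.
Unshelve. all: by end_near. Qed.

End RadialToFlow.

(** * From orbits to radial solutions *)

Section PlaneCalculus.
Context {R : realType}.
Implicit Types (f : R * R -> R) (v z : R * R) (O : set (R * R)).

(** Lets the rules of one-variable calculus handle directional derivatives in the plane. *)
Lemma is_derive_line f z v d :
  is_derive z v f d <-> is_derive (0 : R) 1 (fun h : R => f (h *: v + z)) d.
Proof.
have E : (fun h => h^-1 *: ((f \o shift z) (h *: v) - f z)) =
    (fun h : R => h^-1 *: (((fun h : R => f (h *: v + z)) \o shift 0) (h *: 1) -
      (fun h : R => f (h *: v + z)) 0)).
  apply/funext => h /=; congr (_ *: (f (_ *: v + z) - f _)).
    by rewrite /GRing.scale/= mulr1 addr0.
  by rewrite scale0r add0r.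
by split => -[df <-]; apply: DeriveDef; move: df; rewrite /derivable /derive ?E.
Qed.

Let near_open O z (P : R * R -> Prop) : open O -> O z -> (forall z, O z -> P z) ->
  \forall z \near z, P z.
Proof. by move=> oO Oz H; apply: filterS H _; exact: open_nbhs_nbhs. Qed.

Lemma continuous_near_eq f g z : (\forall z \near z, f z = g z) ->
  {for z, continuous f} -> {for z, continuous g}.
Proof.
move=> fg cf; have E := nbhs_singleton fg.
rewrite /prop_for /continuous_at -E; apply: cvg_trans cf; exact: near_eq_cvg.
Qed.

(** On an open set the candidates [D1] and [D2] coincide with the actual derivatives near each
    point, so their differentiability and continuity carry over to them. *)
Lemma Ck2_intro O f (D1 : R * R -> R * R -> R) (D2 : R * R -> R * R -> R * R -> R) :
  open O ->
  (forall v z, O z -> is_derive z v f (D1 v z)) ->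
  (forall v v' z, O z -> is_derive z v' (D1 v) (D2 v v' z)) ->
  (forall z, O z -> {for z, continuous f}) ->
  (forall v z, O z -> {for z, continuous (D1 v)}) ->
  (forall v v' z, O z -> {for z, continuous (D2 v v')}) ->
  Ck 2 O f /\ forall z v v', O z -> 'D_v' (fun z => 'D_v f z) z = D2 v v' z.
Proof.
move=> oO d1 d2 c0 c1 c2.
have E1 z v : O z -> 'D_v f z = D1 v z by move=> /(d1 v)[].
have near1 z v : O z -> \forall z \near z, D1 v z = 'D_v f z.
  by move=> Oz; apply: (near_open oO Oz) => y /E1.
have d2' z v v' : O z -> is_derive z v' (fun z => 'D_v f z) (D2 v v' z).
  by move=> Oz; apply: near_eq_is_derive (near1 _ _ Oz) _; exact: d2.
have E2 z v v' : O z -> 'D_v' (fun z => 'D_v f z) z = D2 v v' z by move=> /(d2' _ v v')[].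
split => //; split => // v _; split; first by move=> z /(d1 v)[].
split => [z Oz|v' _]; first by apply: continuous_near_eq (near1 _ _ Oz) _; exact: c1.
split; first by move=> z /(d2' _ v v')[].
split => // z Oz; apply: (@continuous_near_eq (D2 v v')); last exact: c2.
by apply: (near_open oO Oz) => y /E2.
Qed.

End PlaneCalculus.

(** * Functions of the logarithm of the radius *)

Definition dot {R : realType} (z v : R * R) : R := z.1 * v.1 + z.2 * v.2.

(** The logarithm of the Euclidean norm, written with its square so that no square root has to be
    differentiated. *)
Definition log_radius {R : realType} (z : R * R) : R := 2^-1 * ln (dot z z).

(** When [W1] is the derivative of [W], the gradient of [W (log_radius z)] is this factor times
    [z]. *)
Definition radial_slope {R : realType} (W1 : R -> R) (z : R * R) : R :=
  W1 (log_radius z) / dot z z.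

(** When [W2] is the derivative of [W1], the gradient of [radial_slope W1] is this factor times
    [z]. *)
Definition radial_curvature {R : realType} (W1 W2 : R -> R) (z : R * R) : R :=
  (W2 (log_radius z) - 2 * W1 (log_radius z)) / dot z z ^+ 2.

Definition log_radial_hessian {R : realType} (W1 W2 : R -> R) (v v' z : R * R) : R :=
  radial_curvature W1 W2 z * dot z v * dot z v' + radial_slope W1 z * dot v v'.

Section LogRadial.
Context {R : realType}.
Variables (W W1 W2 : R -> R).
Hypothesis dW : forall t : R, is_derive t 1 W (W1 t).
Hypothesis dW1 : forall t : R, is_derive t 1 W1 (W2 t).
Hypothesis cW2 : continuous W2.
Implicit Types (v z : R * R).

Let q z : R := dot z z.
Local Notation G := (radial_slope W1).
Local Notation H := (radial_curvature W1 W2).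
Local Notation D2 := (log_radial_hessian W1 W2).

Lemma dot_gt0 z : z != 0 -> 0 < dot z z.
Proof. by move=> z0; rewrite /dot -!expr2 -sqr_enorm exprn_gt0// enorm_gt0. Qed.

Lemma log_radiusE z : z != 0 -> log_radius z = ln (enorm z).
Proof.
move=> z0; rewrite /log_radius /dot -!expr2 -sqr_enorm lnXn ?enorm_gt0//.
by field.
Qed.

Lemma expR_log_radius z : z != 0 -> expR (2 * log_radius z) = dot z z.
Proof. by move=> z0; rewrite /log_radius mulrA mulfV ?pnatr_eq0// mul1r lnK// posrE dot_gt0. Qed.

Let line_dot z v a : is_derive (0 : R) 1 (fun h : R => dot (h *: v + z) a) (dot v a).
Proof.
have d (c x k : R) : is_derive (0 : R) 1 (fun h : R => (h * c + x) * k) (c * k).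
  have -> : c * k = k * (c * 1 + 0) by ring.
  have -> : (fun h : R => (h * c + x) * k) = (fun h => k * (c * h + x)) by apply/funext => h; ring.
  exact: is_derive_scale (is_derive_add (is_derive_scale c (is_derive_idfun 0)) (is_derive_const x 0)).
exact: is_derive_add (d _ _ _) (d _ _ _).
Qed.

Let line0 z v : (0 : R) *: v + z = z. Proof. by rewrite scale0r add0r. Qed.

Let line_q z v : is_derive (0 : R) 1 (fun h : R => q (h *: v + z)) (2 * dot z v).
Proof.
have d (c x : R) : is_derive (0 : R) 1 (fun h : R => (h * c + x) * (h * c + x)) (2 * (x * c)).
  have d1 := is_derive_add (is_derive_scale c (is_derive_idfun 0)) (is_derive_const x 0).
  have -> : 2 * (x * c) = (c * 0 + x) * (c * 1 + 0) + (c * 0 + x) * (c * 1 + 0) by ring.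
  have -> : (fun h : R => (h * c + x) * (h * c + x)) = (fun h => (c * h + x) * (c * h + x)).
    by apply/funext => h; ring.
  exact: (is_derive_mul d1 d1).
have := is_derive_add (d v.1 z.1) (d v.2 z.2).
by rewrite -mulrDr.
Qed.

Let line_T z v : z != 0 ->
  is_derive (0 : R) 1 (fun h : R => log_radius (h *: v + z)) (dot z v / q z).
Proof.
move=> z0; have q0 := dot_gt0 z0.
have q0' : 0 < dot ((0 : R) *: v + z) ((0 : R) *: v + z) by rewrite line0.
have := is_derive_scale 2^-1 (is_derive_comp (g := fun h : R => q (h *: v + z))
  (is_derive1_ln q0') (line_q z v)).
rewrite !line0; set X := (X in is_derive _ _ _ X -> _); suff -> : X = dot z v / q z by [].
by rewrite /X /q; field; rewrite gt_eqF.
Qed.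

Let line_comp (g g' : R -> R) z v : z != 0 -> (forall t : R, is_derive t 1 g (g' t)) ->
  is_derive (0 : R) 1 (fun h : R => g (log_radius (h *: v + z)))
    (g' (log_radius z) * (dot z v / q z)).
Proof.
move=> z0 dg; apply: is_derive_comp (line_T v z0).
by rewrite line0.
Qed.

Let line_qV z v : z != 0 ->
  is_derive (0 : R) 1 (fun h : R => (q (h *: v + z))^-1) (- (2 * dot z v) / q z ^+ 2).
Proof.
move=> z0; have q0 := dot_gt0 z0.
have qN0 : q ((0 : R) *: v + z) != 0 by rewrite line0 gt_eqF.
have := is_deriveV (f := fun h : R => q (h *: v + z)) qN0 (line_q z v).
rewrite line0; set X := (X in is_derive _ _ _ X -> _).
suff -> : X = - (2 * dot z v) / q z ^+ 2 by [].
by rewrite /X /GRing.scale/=; field; rewrite gt_eqF.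
Qed.

Lemma is_derive_log_radial z v : z != 0 ->
  is_derive z v (fun z => W (log_radius z)) (G z * dot z v).
Proof.
move=> z0; apply/is_derive_line; have := line_comp v z0 dW.
have -> : W1 (log_radius z) * (dot z v / q z) = G z * dot z v by rewrite /radial_slope /q; ring.
by [].
Qed.

Lemma is_derive_log_radial2 z v v' : z != 0 ->
  is_derive z v' (fun z => G z * dot z v) (H z * dot z v * dot z v' + G z * dot v v').
Proof.
move=> z0; apply/is_derive_line; have q0 := dot_gt0 z0.
have := is_derive_mul (is_derive_mul (line_comp v' z0 dW1) (line_qV v' z0)) (line_dot z v' v).
rewrite !line0; set X := (X in is_derive _ _ _ X -> _); set Y := (Y in _ -> is_derive _ _ _ Y).
suff -> : X = Y by [].
have vv : dot v' v = dot v v' by rewrite /dot; ring.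
rewrite /X /Y /radial_curvature /radial_slope vv /q; field.
by rewrite gt_eqF.
Qed.

Let continuous_dot v : continuous (fun z => dot z v).
Proof.
move=> z; apply: cvgD; (apply: cvgM; last exact: cvg_cst); [exact: cvg_fst|exact: cvg_snd].
Qed.

Let continuous_q : continuous q.
Proof.
move=> z; apply: cvgD; apply: cvgM; by [exact: cvg_fst|exact: cvg_snd].
Qed.

Lemma continuous_log_radius z : z != 0 -> {for z, continuous log_radius}.
Proof.
move=> z0; apply: cvgM; first exact: cvg_cst.
exact: (cvg_comp q (@ln R) (@continuous_q z) (continuous_ln (dot_gt0 z0))).
Qed.

Let continuous_comp_T (g : R -> R) z : continuous g -> z != 0 ->
  {for z, continuous (fun z => g (log_radius z))}.
Proof. by move=> cg z0; exact: (cvg_comp log_radius g (continuous_log_radius z0) (cg _)). Qed.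

Let cW : continuous W. Proof. by move=> t; exact: is_derive_continuous (dW t). Qed.
Let cW1 : continuous W1. Proof. by move=> t; exact: is_derive_continuous (dW1 t). Qed.

Let cG z : z != 0 -> {for z, continuous G}.
Proof.
move=> z0; apply: cvgM; first exact: continuous_comp_T.
by apply: cvgV; [rewrite gt_eqF// dot_gt0|exact: continuous_q].
Qed.

Let cH z : z != 0 -> {for z, continuous H}.
Proof.
move=> z0; apply: cvgM.
  apply: cvgB; first exact: continuous_comp_T.
  by apply: cvgM; [exact: cvg_cst|exact: continuous_comp_T].
apply: cvgV; first by rewrite expf_neq0// gt_eqF// dot_gt0.
exact: (cvg_comp q (fun x => x ^+ 2) (@continuous_q z) (@exprn_continuous _ 2 _)).
Qed.

Let D1 v z := G z * dot z v.

Lemma open_neq0 : open [set z : R * R | z != 0].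
Proof.
rewrite (_ : [set z : R * R | z != 0] = ~` [set 0]); last first.
  by apply/seteqP; split => z /=; [move/eqP|move/eqP].
apply: closed_openC; apply: accessible_closed_set1; apply: hausdorff_accessible.
exact: norm_hausdorff.
Qed.

Variable f : R * R -> R.
Hypothesis fE : forall z, z != 0 -> f z = W (log_radius z).

Let near_f z : z != 0 -> \forall z \near z, W (log_radius z) = f z.
Proof.
move=> z0; apply: filterS (open_nbhs_nbhs (conj open_neq0 z0)) => y /= y0.
by rewrite fE.
Qed.

Lemma log_radial_derive z v : z != 0 -> is_derive z v f (G z * dot z v).
Proof.
by move=> z0; apply: near_eq_is_derive (near_f z0) _; exact: is_derive_log_radial.
Qed.

Lemma log_radial_continuous z : z != 0 -> {for z, continuous f}.
Proof. by move=> z0; apply: continuous_near_eq (near_f z0) _; exact: continuous_comp_T. Qed.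

Lemma log_radial_Ck2 : Ck 2 [set z | z != 0] f /\
  forall z v v', z != 0 -> 'D_v' (fun z => 'D_v f z) z = D2 v v' z.
Proof.
apply: (@Ck2_intro _ _ f D1 D2) open_neq0 _ _ _ _ _.
- by move=> v z z0; exact: log_radial_derive.
- by move=> v v' z z0; exact: is_derive_log_radial2.
- by move=> z; exact: log_radial_continuous.
- by move=> v z z0; apply: cvgM; [exact: cG|exact: continuous_dot].
- move=> v v' z z0; apply: cvgD.
    apply: cvgM; last exact: continuous_dot.
    by apply: cvgM; [exact: cH|exact: continuous_dot].
  by apply: cvgM; [exact: cG|exact: cvg_cst].
Qed.

(** The trace of the Hessian is the curvature times [dot z z] plus twice the slope; in dimension two
    the terms in [W1] cancel. *)
Lemma log_radial_laplacian z : z != 0 -> laplacian f z = W2 (log_radius z) / dot z z.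
Proof.
move=> z0; have [_ E] := log_radial_Ck2; rewrite /laplacian !E// /log_radial_hessian /radial_curvature /radial_slope /q.
have q0 := dot_gt0 z0; move: (q0); rewrite {1 5 9}/dot /e1 /e2 /= => _.
have -> : dot z (1, 0) = z.1 by rewrite /dot/=; ring.
have -> : dot z (0, 1) = z.2 by rewrite /dot/=; ring.
have -> : dot (1, 0) (1, 0) = 1 :> R by rewrite /dot/=; ring.
have -> : dot (0, 1) (0, 1) = 1 :> R by rewrite /dot/=; ring.
have qE : dot z z = z.1 * z.1 + z.2 * z.2 by [].
have qn : z.1 * z.1 + z.2 * z.2 != 0 by rewrite -qE gt_eqF.
by rewrite qE; field.
Qed.

(** For a basis vector, [dot z v * dot z v] is at most [dot z z]; the 3 collects two [W1] terms from
    the curvature and one from the slope. *)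
Lemma log_radial_second_bound z v : z != 0 -> v = e1 R \/ v = e2 R ->
  `|D2 v v z| <= (`|W2 (log_radius z)| + 3 * `|W1 (log_radius z)|) / dot z z.
Proof.
move=> z0 hv; have q0 := dot_gt0 z0.
have dv : dot v v = 1 by case: hv => ->; rewrite /dot/=; ring.
have sq0 : 0 <= dot z v * dot z v by rewrite -expr2 sqr_ge0.
have sq1 : dot z v * dot z v <= dot z z.
  rewrite /dot; case: hv => -> /=; rewrite ?mulr1 ?mulr0 ?addr0 ?add0r -!expr2.
    by rewrite lerDl sqr_ge0.
  by rewrite lerDr sqr_ge0.
have zv : 0 <= dot z v * dot z v / dot z z <= 1.
  by apply/andP; split; [exact: divr_ge0 sq0 (ltW q0)|rewrite ler_pdivrMr// mul1r].
have -> : D2 v v z = ((W2 (log_radius z) - 2 * W1 (log_radius z)) *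
    (dot z v * dot z v / dot z z) + W1 (log_radius z)) / dot z z.
  by rewrite /log_radial_hessian /radial_curvature /radial_slope /q dv; field; rewrite gt_eqF.
rewrite normrM normfV (ger0_norm (ltW q0)) ler_pM2r ?invr_gt0//.
apply: le_trans (ler_normD _ _) _; rewrite normrM (ger0_norm (x := _ / _)); last by case/andP: zv.
have h : `|W2 (log_radius z) - 2 * W1 (log_radius z)| <=
    `|W2 (log_radius z)| + 2 * `|W1 (log_radius z)|.
  by apply: le_trans (ler_normB _ _) _; rewrite normrM ger0_norm.
have : `|W2 (log_radius z) - 2 * W1 (log_radius z)| * (dot z v * dot z v / dot z z) <=
    `|W2 (log_radius z) - 2 * W1 (log_radius z)|.
  by rewrite ler_piMr//; case/andP: zv.
lra.
Qed.

End LogRadial.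

(** * Measurability and integration on the plane *)

Section PlaneMeasure.
Context {R : realType}.
Implicit Types (f g h : R * R -> R) (z : R * R).
Notation mu := (@lebesgue_measure R).

(** An open set is the union of the rational open rectangles it contains, which are countably
    many. *)
Lemma open_measurable_plane (U : set (R * R)) : open U -> measurable U.
Proof.
move=> oU.
pose rect (q : (rat * rat) * (rat * rat)) : set (R * R) :=
  `](ratr q.1.1), (ratr q.1.2)[ `*` `](ratr q.2.1), (ratr q.2.2)[.
have -> : U = \bigcup_(q in [set q | rect q `<=` U]) rect q.
  apply/seteqP; split => [z Uz|z [q /= qU qz]]; last exact: qU.
  have /nbhs_ballP[e /= e0 eU] := open_nbhs_nbhs (conj oU Uz).
  have lt1 (x : R) : x - e < x by rewrite gtrBl.
  have lt2 (x : R) : x < x + e by rewrite ltrDl.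
  have [a1 ha1] := rat_in_itvoo (lt1 z.1); have [b1 hb1] := rat_in_itvoo (lt2 z.1).
  have [a2 ha2] := rat_in_itvoo (lt1 z.2); have [b2 hb2] := rat_in_itvoo (lt2 z.2).
  move: ha1 hb1 ha2 hb2; rewrite !in_itv/=.
  move=> /andP[? ?] /andP[? ?] /andP[? ?] /andP[? ?].
  exists ((a1, b1), (a2, b2)); last by split; rewrite /= in_itv/=; apply/andP; split.
  move=> y [] /=; rewrite !in_itv/= => /andP[? ?] /andP[? ?]; apply: eU.
  by split; rewrite /ball/= ltr_norml; apply/andP; split; lra.
rewrite bigcup_mkcond; apply: countable_bigcupT_measurable; first exact: countableP.
move=> q; case: ifPn => // _; apply: measurableX; exact: measurable_itv.
Qed.

Lemma measurable_origin : measurable [set (0 : R * R)].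
Proof.
rewrite (_ : [set 0] = ~` [set z | z != 0]).
  by apply: measurableC; apply: open_measurable_plane; exact: open_neq0.
by apply/seteqP; split => z /= => [->|/negP]; [rewrite eqxx|rewrite negbK => /eqP].
Qed.

(** Preimages of open intervals are open off the origin, and the origin is a measurable point. This
    covers second derivatives that are continuous only away from [0]. *)
Lemma measurable_fun_continuous_neq0 f : (forall z, z != 0 -> {for z, continuous f}) ->
  measurable_fun setT f.
Proof.
move=> cf; apply: (measurability _ (RGenOpens.measurableE R)) => _ [_ [a [b ->] <-]].
rewrite setTI; set V := f @^-1` _.
have -> : V = (V `&` [set z | z != 0]) `|` (V `&` [set 0]).
  rewrite -setIUr (_ : _ `|` _ = setT) ?setIT//.
  by apply/seteqP; split => z //= _; have [->|] := eqVneq z 0; [right|left].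
apply: measurableU.
  apply: open_measurable_plane; rewrite openE => z [Vz z0].
  apply: filterI; last exact: open_nbhs_nbhs (conj open_neq0 z0).
  by apply: (cf z z0); apply: open_nbhs_nbhs; split => //; exact: interval_open.
have [V0|V0] := pselect (V 0).
  rewrite (_ : V `&` [set 0] = [set 0]); first exact: measurable_origin.
  by apply/seteqP; split => z /= => [[]|->].
rewrite (_ : V `&` [set 0] = set0) //.
by apply/seteqP; split => z //= [] /[swap] ->.
Qed.

Lemma measurable_fun_continuous_plane f : continuous f -> measurable_fun setT f.
Proof. by move=> cf; apply: measurable_fun_continuous_neq0 => z _; exact: cf. Qed.

Let box (r : R) : set (R * R) := `[- r, r] `*` `[- r, r].

Lemma continuous_box_bounded f r : continuous f ->
  exists2 B, 0 <= B & forall z, box r z -> `|f z| <= B.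
Proof.
move=> cf.
have cbox : compact (box r) by apply: compact_setX; exact: segment_compact.
have : compact (f @` box r).
  apply: continuous_compact cbox; exact: continuous_subspaceT.
move=> /compact_bounded[M [Mr HM]].
exists (`|M| + 1) => [|z bz]; first by rewrite addr_ge0.
apply: HM; last by exists z.
by rewrite (le_lt_trans (ler_norm M))// ltrDl.
Qed.

Lemma integrable_continuous_box f r : continuous f -> (forall z, ~ box r z -> f z = 0) ->
  (lebesgue2 R).-integrable setT (EFin \o f).
Proof.
move=> cf f0; have [B B0 fB] := continuous_box_bounded r cf.
have mbox : measurable (box r : set (measurableTypeR R * measurableTypeR R)) by apply: measurableX; exact: measurable_itv.
have -> : EFin \o f = (EFin \o f) \_ (box r).
  apply/funext => z; rewrite patchE; case: ifPn => // /negP bz.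
  by rewrite /= f0// => /mem_set.
have fi : (lebesgue2 R).-integrable (box r) (EFin \o f); last first.
  have [fi' _] := @integrable_mkcond _ (measurableTypeR R * measurableTypeR R)%type R
    (lebesgue2 R) (box r) (EFin \o f) mbox.
  exact: fi'.
apply: measurable_bounded_integrable => //.
- have mi : measurable (`[- r, r]%classic : set (measurableTypeR R)) by exact: measurable_itv.
  rewrite [X in (X < _)%E](_ : _ = mu `[(- r)%R, r] * mu `[(- r)%R, r])%E; last first.
    exact: (product_measure1E _ _ mi mi).
  rewrite lebesgue_measure_itv/= lte_fin.
  by case: ifP => _; rewrite -?EFinB -?EFinM ?mule0 ltry.
- by apply: measurable_funTS; exact: measurable_fun_continuous_plane.
- exists B; split; first exact: num_real.
  by move=> M BM z bz; apply: le_trans (fB z bz) (ltW BM).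
Qed.

Lemma integral_line_zero (P g : R -> R) (r : R) :
  (forall s : R, is_derive s 1 P (g s)) -> continuous g ->
  (forall s, r <= `|s| -> P s = 0 /\ g s = 0) ->
  (\int[mu]_s (g s)%:E = 0)%E.
Proof.
(* The maximum with [1] makes the segment [[- r', r']] nondegenerate whatever the sign of [r]. *)
move=> dP cg H; pose r' := Num.max r 1.
have r0 : 0 < r' by rewrite lt_max ltr01 orbT.
have rr : r <= r' by rewrite le_max lexx.
have -> : (\int[mu]_s (g s)%:E = \int[mu]_(s in `[(- r')%R, r']) (g s)%:E)%E.
  rewrite [RHS]integral_mkcond; apply: eq_integral => s _; rewrite patchE.
  case: ifPn => // sN; have [] := H s; last by move=> _ ->.
  apply: (le_trans rr); rewrite leNgt; apply: contra sN => sr.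
  by rewrite inE/= in_itv/= -ler_norml ltW.
have ab : - r' < r' by lra.
rewrite (@continuous_FTC2 _ g P)//.
- have [-> _] : P r' = 0 /\ g r' = 0 by apply: H; rewrite (ger0_norm (ltW r0)).
  have [-> _] : P (- r') = 0 /\ g (- r') = 0 by apply: H; rewrite normrN (ger0_norm (ltW r0)).
  by rewrite sube0.
- exact: continuous_subspaceT.
- split.
  + by move=> x _; have [] := dP x.
  + by apply: cvg_at_right_filter; exact: is_derive_continuous (dP _).
  + by apply: cvg_at_left_filter; exact: is_derive_continuous (dP _).
- by move=> x _; rewrite derive1E; have [_ ->] := dP x.
Qed.

Let integral_zero_off0 (F : R -> \bar R) : (forall x, x != 0 -> F x = 0%E) ->
  (\int[mu]_x F x = 0)%E.
Proof.
move=> F0; rewrite -(integral_setD1 (r := 0)).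
- apply: integral0_eq => x [_ /= x0]; apply: F0; exact/eqP.
- by apply: measurableD.
- apply: (eq_measurable_fun (cst 0%E)) => // x; rewrite inE => -[_ /= x0].
  by rewrite F0//; exact/eqP.
Qed.

(** Fubini, with the line through the origin discarded as a null set of the parameter [y]. *)
Lemma integral_zero_lines1 h : (lebesgue2 R).-integrable setT (EFin \o h) ->
  (forall y, y != 0 -> (\int[mu]_x (h (x, y))%:E = 0)%E) ->
  (\int[lebesgue2 R]_z (h z)%:E = 0)%E.
Proof.
move=> hi h0; have <- := integral21_prod_meas1 hi.
by apply: integral_zero_off0 => y y0; exact: h0.
Qed.

Lemma integral_zero_lines2 h : (lebesgue2 R).-integrable setT (EFin \o h) ->
  (forall x, x != 0 -> (\int[mu]_y (h (x, y))%:E = 0)%E) ->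
  (\int[lebesgue2 R]_z (h z)%:E = 0)%E.
Proof.
move=> hi h0; have <- := integral12_prod_meas1 hi.
by apply: integral_zero_off0 => x x0; exact: h0.
Qed.

End PlaneMeasure.

(** * The equation in the sense of distributions *)

Section WeakLaplacian.
Context {R : realType}.
Implicit Types (f g phi : R * R -> R) (z v : R * R).

Let box (r : R) : set (R * R) := `[- r, r] `*` `[- r, r].

Let notbox_near r z : ~ box r z -> \forall y \near z, ~ box r y.
Proof.
move=> bz; have cb : closed (box r).
  apply: compact_closed; first exact: norm_hausdorff.
  by apply: compact_setX; exact: segment_compact.
by have := open_nbhs_nbhs (conj (closed_openC cb) bz : open_nbhs z (~` box r)).
Qed.

Let support_box phi : compact (closure [set x | phi x != 0]) ->
  exists r, forall z, ~ box r z -> phi z = 0.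
Proof.
move=> /compact_bounded[M [Mr HM]]; exists (`|M| + 1) => z bz.
apply/eqP/negP => /negP phiz; apply: bz.
have : `|z| <= `|M| + 1.
  apply: HM; last by apply: subset_closure.
  by rewrite (le_lt_trans (ler_norm M))// ltrDl.
rewrite prod_normE/= ge_max => /andP[h1 h2].
by split; rewrite /= in_itv/= -ler_norml.
Qed.

Variables (f F phi : R * R -> R).
Hypothesis cf : continuous f.
Hypothesis ckf : Ck 2 [set z | z != 0] f.
Hypothesis lapf : forall z, z != 0 -> laplacian f z = - F z.
(** An integrable majorant of the pure second derivatives on each box: the form in which mildness of
    the singularity enters. The condition at [0] controls the values assigned to these derivatives
    there. *)
Hypothesis dom : forall r, exists g, [/\ (lebesgue2 R).-integrable setT (EFin \o g),
  `|F 0| <= g 0 & forall z v, z != 0 -> box r z -> v = e1 R \/ v = e2 R ->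
    `|'D_v (fun y => 'D_v f y) z| <= g z].
Hypothesis test : test_function phi.

Let fv v z := 'D_v f z.
Let fvv v z := 'D_v (fun y => 'D_v f y) z.
Let pv v z := 'D_v phi z.
Let pvv v z := 'D_v (fun y => 'D_v phi y) z.

Let basis v := v = e1 R \/ v = e2 R.

Let df v z : basis v -> z != 0 -> is_derive z v f (fv v z).
Proof. by move=> bv z0; have [_ /(_ v bv)[d _]] := ckf; apply: derivableP; exact: d. Qed.

Let dfv v z : basis v -> z != 0 -> is_derive z v (fv v) (fvv v z).
Proof.
move=> bv z0; have [_ /(_ v bv)[_ [_ /(_ v bv)[d _]]]] := ckf.
exact: derivableP (d z z0).
Qed.

Let cfvv v z : basis v -> z != 0 -> {for z, continuous (fvv v)}.
Proof.
by move=> bv z0; have [_ /(_ v bv)[_ [_ /(_ v bv)[_ [c _]]]]] := ckf; exact: c.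
Qed.

Let ckphi : Ck 2 setT phi. Proof. by have [ck _] := test; exact: ck. Qed.

Let cphi : continuous phi.
Proof. by have [ck _] := ckphi; move=> z; exact: ck. Qed.

Let dphi v z : basis v -> is_derive z v phi (pv v z).
Proof. by move=> bv; have [_ /(_ v bv)[d _]] := ckphi; apply: derivableP; exact: d. Qed.

Let dpv v z : basis v -> is_derive z v (pv v) (pvv v z).
Proof.
move=> bv; have [_ /(_ v bv)[_ [_ /(_ v bv)[d _]]]] := ckphi.
exact: derivableP (d z I).
Qed.

Let cpvv v : basis v -> continuous (pvv v).
Proof.
by move=> bv z; have [_ /(_ v bv)[_ [_ /(_ v bv)[_ [c _]]]]] := ckphi; exact: c.
Qed.

(** The second derivative with a chosen value [c] at the origin. The values [- F 0] for [e1] and [0]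
    for [e2] make the splitting of the integrand exact at every point, including [0]. *)
Let D v (c : R) z := if z == 0 then c else fvv v z.

(** The integrand of Green's second identity in the direction [v], an exact derivative along each
    line in this direction that avoids the origin. *)
Let Q v (c : R) z := f z * pvv v z - D v c z * phi z.

Let Q_continuous v c z : basis v -> z != 0 -> {for z, continuous (Q v c)}.
Proof.
move=> bv z0; apply: cvgB.
  by apply: cvgM; [exact: cf|exact: cpvv].
apply: cvgM; last exact: cphi.
apply: (@continuous_near_eq _ (fvv v)); last exact: cfvv.
by apply: filterS (open_nbhs_nbhs (conj open_neq0 z0)) => y /negbTE y0; rewrite /D y0.
Qed.

Let Q_derive v c z : basis v -> z != 0 ->
  is_derive z v (fun z => f z * pv v z - fv v z * phi z) (Q v c z).
Proof.
move=> bv z0.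
have d1 : is_derive z v (fun z => f z * pv v z) (f z *: pvv v z + pv v z *: fv v z).
  exact: is_deriveM (df bv z0) (dpv z bv).
have d2 : is_derive z v (fun z => fv v z * phi z) (fv v z *: pv v z + phi z *: fvv v z).
  exact: is_deriveM (dfv bv z0) (dphi z bv).
have d3 : is_derive z v (fun z => f z * pv v z - fv v z * phi z)
    (f z *: pvv v z + pv v z *: fv v z - (fv v z *: pv v z + phi z *: fvv v z)).
  exact: is_deriveB d1 d2.
have E : f z *: pvv v z + pv v z *: fv v z - (fv v z *: pv v z + phi z *: fvv v z) = Q v c z.
  by rewrite /Q /D (negbTE z0) /GRing.scale/=; ring.
by rewrite -E.
Qed.

(* Both second derivatives are integrated along lines avoiding the origin,
   which are almost all lines, so no boundary term at the origin appears. *)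
Lemma weak_laplacian :
  (\int[lebesgue2 R]_x (f x * laplacian phi x + F x * phi x)%:E = 0)%E.
Proof.
have [r phi0] := support_box (proj2 test).
have near0 (h : R * R -> R) z : (forall z, ~ box r z -> h z = 0) -> ~ box r z ->
    \forall y \near z, 0 = h y.
  by move=> h0 /notbox_near; apply: filterS => y /h0.
have zero_derive (h : R * R -> R) v : (forall z, ~ box r z -> h z = 0) ->
    forall z, ~ box r z -> 'D_v h z = 0.
  move=> h0 z bz.
  have := near_eq_is_derive (near0 h z h0 bz) (is_derive_cst (0 : R) z v).
  by case.
have pv0 v : forall z, ~ box r z -> pv v z = 0 by exact: zero_derive.
have pvv0 v : forall z, ~ box r z -> pvv v z = 0 by exact: zero_derive (pv0 v).
have Q0 v c z : ~ box r z -> Q v c z = 0.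
  by move=> bz; rewrite /Q pvv0// phi0// !mulr0 subr0.
have [B B0 phiB] := continuous_box_bounded r cphi.
have [g [gi g0 gD]] := dom r.
have Qi v c : basis v -> `|c| <= g 0 ->
    (lebesgue2 R).-integrable setT (EFin \o Q v c).
  move=> bv cg.
  have i1 : (lebesgue2 R).-integrable setT (EFin \o (fun z => f z * pvv v z)).
    apply: (@integrable_continuous_box _ _ r).
      by move=> z; apply: cvgM; [exact: cf|exact: cpvv].
    by move=> z bz; rewrite pvv0// mulr0.
  have i2 : (lebesgue2 R).-integrable setT (EFin \o (fun z => D v c z * phi z)).
    apply: (@le_integrable _ _ _ (lebesgue2 R) setT measurableT _
        (fun z => B%:E * (EFin \o g) z)%E).
    - apply/measurable_EFinP; apply: measurable_fun_continuous_neq0 => z z0.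
      apply: cvgM; last exact: cphi.
      apply: (@continuous_near_eq _ (fvv v)); last exact: cfvv.
      by apply: filterS (open_nbhs_nbhs (conj open_neq0 z0)) => y /negbTE y0; rewrite /D y0.
    - move=> z _; rewrite /= -?EFinM !lee_fin.
      have [bz|bz] := pselect (box r z); last by rewrite phi0// mulr0 normr0.
      rewrite normrM (normrM B) (ger0_norm B0) mulrC; apply: ler_pM => //; first exact: phiB.
      apply: le_trans (ler_norm _); rewrite /D; case: (eqVneq (z : R * R) 0) => [->//|z0].
      exact: gD.
    - exact: integrableZl.
  exact: integrableB i1 i2.
(* The margin [1] turns a weak inequality into strict exclusion from the box. *)
have shiftr s : r + 1 <= `|s| -> ~ (- r <= s <= r).
  by move=> rs; rewrite -ler_norml; lra.
have I1 c : `|c| <= g 0 -> (\int[lebesgue2 R]_z (Q (e1 R) c z)%:E = 0)%E.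
  have b1 : basis (e1 R) by left.
  move=> cg; apply: integral_zero_lines1; first exact: Qi.
  move=> y y0; have nz (s : R) : ((s, y) : R * R) != 0.
    by apply: contra_neq y0 => -[].
  apply: (@integral_line_zero _ (fun s => f (s, y) * pv (e1 R) (s, y) - fv (e1 R) (s, y) * phi (s, y))
    (fun s => Q (e1 R) c (s, y)) (r + 1)).
  - move=> s; apply: (proj1 (is_derive_e1
      (fun z => f z * pv (e1 R) z - fv (e1 R) z * phi z) s y _)).
    exact: Q_derive.
  - move=> s; apply: (cvg_comp (fun s : R => (s, y)) (Q (e1 R) c)); last exact: (Q_continuous b1 (nz s)).
    by apply: (cvg_pair (G := nbhs s) (H := nbhs y)); [exact: cvg_id|exact: cvg_cst].
  - move=> s /shiftr rs; have bz : ~ box r (s, y) by move=> [/= + _]; rewrite in_itv/=.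
    by rewrite Q0// pv0// phi0// !mulr0 subr0.
have I2 c : `|c| <= g 0 -> (\int[lebesgue2 R]_z (Q (e2 R) c z)%:E = 0)%E.
  have b2 : basis (e2 R) by right.
  move=> cg; apply: integral_zero_lines2; first exact: Qi.
  move=> x x0; have nz (s : R) : ((x, s) : R * R) != 0.
    by apply: contra_neq x0 => -[].
  apply: (@integral_line_zero _ (fun s => f (x, s) * pv (e2 R) (x, s) - fv (e2 R) (x, s) * phi (x, s))
    (fun s => Q (e2 R) c (x, s)) (r + 1)).
  - move=> s; apply: (proj1 (is_derive_e2
      (fun z => f z * pv (e2 R) z - fv (e2 R) z * phi z) x s _)).
    exact: Q_derive.
  - move=> s; apply: (cvg_comp (fun s : R => (x, s)) (Q (e2 R) c)); last exact: (Q_continuous b2 (nz s)).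
    by apply: (cvg_pair (G := nbhs x) (H := nbhs s)); [exact: cvg_cst|exact: cvg_id].
  - move=> s /shiftr rs; have bz : ~ box r (x, s) by move=> [_ /= +]; rewrite in_itv/=.
    by rewrite Q0// pv0// phi0// !mulr0 subr0.
have c1 : `|- F 0| <= g 0 by rewrite normrN.
have c2 : `|0 : R| <= g 0 by rewrite normr0 (le_trans _ g0).
transitivity (\int[lebesgue2 R]_z ((EFin \o Q (e1 R) (- F 0)%R) z + (EFin \o Q (e2 R) 0%R) z))%E.
  apply: eq_integral => z _; rewrite /= -EFinD; congr (_%:E).
  rewrite /Q /D; case: (eqVneq (z : R * R) (0 : R * R)%R) => [->|z0].
    have alg (a b c p d : R) : a * (b + c) + d * p = (a * b - - d * p) + (a * c - 0 * p) by ring.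
    exact: alg.
  have := lapf z0; rewrite /laplacian -/(fvv (e1 R) z) -/(fvv (e2 R) z)
    -/(pvv (e1 R) z) -/(pvv (e2 R) z) => E.
  have -> : F z = - (fvv (e1 R) z + fvv (e2 R) z) by rewrite E opprK.
  have alg (a b c p d e : R) : a * (b + c) + - (d + e) * p = (a * b - d * p) + (a * c - e * p) by ring.
  exact: alg.
have i1 : (lebesgue2 R).-integrable setT (EFin \o Q (e1 R) (- F 0)%R) by apply: Qi => //; left.
have i2 : (lebesgue2 R).-integrable setT (EFin \o Q (e2 R) 0%R) by apply: Qi => //; right.
apply: etrans (integralD measurableT i1 i2) _.
apply: etrans (congr2 (fun x y : \bar R => x + y)%E (I1 _ c1) (I2 _ c2)) _.
by rewrite adde0.
Qed.

End WeakLaplacian.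

(** * The radial solution built from an orbit *)

Section FlowToRadial.
Context {R : realType} {n : nat}.
Variables (A : 'M[R]_n) (beta sigma : 'I_n -> R) (m w : 'I_n -> R -> R).
Hypothesis A_ge0 : forall i j, 0 <= A i j.
Hypothesis beta_gt : forall i, - 2 < beta i.
Hypothesis mw : flow A (fun i => beta i + 2) sigma m w.
Implicit Types (i j : 'I_n) (t : R) (z : R * R).

Let b_gt0 i : 0 < beta i + 2. Proof. by have := beta_gt i; lra. Qed.

Let W i t := w i t - (beta i + 2) * t.
Let W1 i t := - \sum_j A i j * m j t.
Let W2 i t := - \sum_j A i j * expR (w j t).

Let dW i t : is_derive t 1 (W i) (W1 i t).
Proof.
have -> : W1 i t = beta i + 2 - \sum_j A i j * m j t - (beta i + 2) * 1 by rewrite /W1; ring.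
exact: is_derive_sub (flow_log_derive mw i t) (is_derive_scale _ (is_derive_idfun t)).
Qed.

Let dW1 i t : is_derive t 1 (W1 i) (W2 i t).
Proof.
exact: is_derive_opp (is_derive_bigsum _ (fun j => is_derive_scale _ (flow_mass_derive mw j t))).
Qed.

Let cW2 i : continuous (W2 i).
Proof.
move=> t; exact: is_derive_continuous (is_derive_opp (is_derive_bigsum _
  (fun j => is_derive_scale (A i j) (flow_density_derive mw j t)))).
Qed.

(** [W i] is nonincreasing, and the estimate at the left end bounds it above; the limit is the value
    to be assigned at the origin. *)
Let W_limit i : exists c : R, W i t @[t --> -oo] --> c.
Proof.
have NWh : {homo (fun t => - W i t) : x y / x <= y}.
  apply: (derive_homo (fun t => is_derive_opp (dW i t))) => t.
  by rewrite opprK sumr_ge0// => j _; rewrite mulr_ge0// (flow_ge0 mw).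
have [K HK] := flow_left_end A_ge0 b_gt0 mw i.
have [|l Hl _] := nondecreasing_bounded_cvgN NWh (B := - K).
  move=> t; have [t0|/ltW t0] := leP t 0; first by have := HK t t0; rewrite /W; lra.
  by have := NWh _ _ t0; have := HK 0 (lexx 0); rewrite /W; lra.
exists (- l); rewrite (_ : W i = fun t => - - W i t); first exact: cvgN.
by apply/funext => t; rewrite opprK.
Qed.

Let enorm0 : enorm (0 : R * R) = 0. Proof. exact: enorm_x0. Qed.

Let enorm_eq0 z : (enorm z == 0) = (z == 0).
Proof.
apply/idP/idP => [|/eqP ->]; last by rewrite enorm0.
by apply: contraTT => z0; rewrite gt_eqF// enorm_gt0.
Qed.

(** Off the origin the density is [expR (w i (log_radius z)) / dot z z], so the pointwise equation
    is the Laplacian formula for [W i]. Near the origin, [W2 i] is the coupling of the densities up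
    to sign, and [W1 i] is bounded by it since masses are bounded by densities; this dominates the
    second derivatives. *)
Lemma radial_solution_of_flow :
  exists u, [/\ is_solution A beta u, is_radial u & forall i, energy beta u i = sigma i].
Proof.
have [c Hc] := boolp.choice W_limit.
pose u i z := if z == 0 then c i else W i (log_radius z).
have uE i z : z != 0 -> u i z = W i (log_radius z) by move=> /negbTE z0; rewrite /u z0.
have u_rad : is_radial u.
  move=> i x y xy; rewrite /u -(enorm_eq0 x) -(enorm_eq0 y) xy.
  by rewrite /log_radius /dot -!expr2 -!sqr_enorm xy.
have cu i : continuous (u i).
  move=> z; have [->|z0] := eqVneq (z : R * R) 0; last exact: (log_radial_continuous (dW i) (uE i) z0).
  have u0 : u i 0 = c i by rewrite /u eqxx.
  apply/cvgrPdist_lt => e e0; rewrite u0.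
  have [M [_ HM]] : \forall t \near -oo, `|c i - W i t| < e by move/cvgrPdist_lt: (Hc i); exact.
  have : \forall z \near (0 : R * R), enorm z < expR M.
    have /cvgrPdist_lt/(_ (expR M) (expR_gt0 M)) := @continuous_enorm R 0.
    apply: filterS => y; rewrite enorm0 sub0r normrN; exact: le_lt_trans (ler_norm _).
  apply: filterS => y yM; have [->|y0] := eqVneq (y : R * R) 0; first by rewrite u0 subrr normr0.
  rewrite uE//; apply: HM; rewrite log_radiusE// -ltr_expR lnK// posrE; exact: enorm_gt0.
have densE i z : z != 0 -> density beta u i z = expR (w i (log_radius z)) / dot z z.
  move=> z0; rewrite /density uE// -expR_log_radius// -expRN -expRD.
  rewrite -[enorm z]lnK; last by rewrite posrE enorm_gt0.
  rewrite -log_radiusE// powR_of_expR -expRD /W; congr expR; ring.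
have dens0 i z : 0 <= density beta u i z by rewrite /density mulr_ge0 ?powR_ge0 ?expR_ge0.
have dens_int i : (\int[lebesgue2 R]_z (density beta u i z)%:E = (2 * pi * sigma i)%:E)%E.
  rewrite (integral_density beta u_rad (cu i)) (EFinM (2 * pi) (sigma i)); apply: (congr1 (mule (2 * pi)%:E)).
  have [_ _ m0 mS] := mw i.
  have cw : continuous (fun t => expR (w i t)).
    by move=> t; exact: is_derive_continuous (flow_density_derive mw i t).
  have := integral_log (flow_mass_derive mw i) cw (fun t => expR_ge0 _) m0 mS.
  rewrite subr0 => <-; apply: eq_integral => r; rewrite inE/= in_itv/= andbT => r0.
  have r0' : (r, 0 : R) != 0 by apply/eqP => -[E]; rewrite E ltxx in r0.
  congr (expR _ / _)%:E; rewrite /profile lnK//.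
  by rewrite uE// log_radiusE// enorm_x0 ?(ltW r0)// /W; ring.
have dens_m i : measurable_fun setT (density beta u i).
  apply: measurable_funM.
    apply: (measurableT_comp (measurable_powR _)).
    exact: measurable_fun_continuous_plane (@continuous_enorm R).
  apply: (measurableT_comp (@measurable_expR R)).
  exact: measurable_fun_continuous_plane (cu i).
have dens_i i : (lebesgue2 R).-integrable setT (EFin \o density beta u i).
  apply/integrableP; split; first by apply/measurable_EFinP; exact: dens_m.
  rewrite (_ : (fun z => _) = (fun z => (density beta u i z)%:E)); last first.
    by apply/funext => z; rewrite /= ger0_norm.
  by rewrite dens_int ltry.
pose F i z := \sum_j A i j * density beta u j z.
have F_ge0 i z : 0 <= F i z by rewrite sumr_ge0// => j _; rewrite mulr_ge0.
have F_i i : (lebesgue2 R).-integrable setT (EFin \o F i).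
  rewrite (_ : _ \o _ = fun z => \sum_j ((A i j)%:E * (density beta u j z)%:E)%E).
    by apply: integrable_sum => // j _; exact: (integrableZl measurableT (A i j) (dens_i j)).
  apply/funext => z; by rewrite /= /F -sumEFin; apply: eq_bigr => j _; rewrite EFinM.
pose ck i := log_radial_Ck2 (dW i) (dW1 i) (@cW2 i) (uE i).
have lapF i z : z != 0 -> laplacian (u i) z = - F i z.
  move=> z0; rewrite (log_radial_laplacian (dW i) (dW1 i) (@cW2 i) (uE i) z0) /W2 mulNr mulr_suml.
  by congr (- _); apply: eq_bigr => j _; rewrite densE// mulrA.
exists u; split => //; last first.
  move=> i; rewrite /energy /Rintegral dens_int /= mulKf// gt_eqF// mulr_gt0// pi_gt0//.
move=> i; split => //.
- by case: (ck i).
- by move=> z z0; rewrite lapF// addNr.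
- move=> phi test; apply: (weak_laplacian (cu i) (proj1 (ck i)) (@lapF i) _ test) => r.
  (* On the box [dot z z] is at most [2 * r ^+ 2], so [T] bounds the log radius; the [+ 1] keeps the
     logarithm meaningful for [r = 0]. *)
  pose T := 2^-1 * ln (2 * r ^+ 2 + 1).
  have [K K0 HK] := flow_mass_le_density A_ge0 b_gt0 mw T.
  (* The 1 accounts for [W2 i], and [3 * K] for the three occurrences of [W1 i], each at most [K]
     times the same sum. *)
  exists (fun z => (1 + 3 * K) * F i z); split.
  + rewrite (_ : _ \o _ = fun z => ((1 + 3 * K)%:E * (F i z)%:E)%E); last by apply/funext.
    exact: (integrableZl measurableT _ (F_i i)).
  + rewrite ger0_norm// ler_peMl//; lra.
  + move=> z v z0 [z1 z2] bv.
    have zT : log_radius z <= T.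
      rewrite ler_pM2l// ler_ln ?posrE ?dot_gt0//; last by have := sqr_ge0 r; lra.
      have sq (x : R) : `[- r, r]%classic x -> x * x <= r ^+ 2.
        by rewrite /= in_itv/= => /andP[? ?]; nra.
      by have := sq _ z1; have := sq _ z2; rewrite /dot; lra.
    rewrite (proj2 (ck i))//; apply: le_trans (log_radial_second_bound _ _ z0 bv) _.
    have E : F i z = (\sum_j A i j * expR (w j (log_radius z))) / dot z z.
      by rewrite /F mulr_suml; apply: eq_bigr => j _; rewrite densE// mulrA.
    have H1 : `|W1 i (log_radius z)| <= K * \sum_j A i j * expR (w j (log_radius z)).
      rewrite normrN ger0_norm; last by rewrite sumr_ge0// => j _; rewrite mulr_ge0// (flow_ge0 mw).
      rewrite mulr_sumr; apply: ler_sum => j _; rewrite mulrCA ler_wpM2l//; exact: HK.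
    have H2 : `|W2 i (log_radius z)| = \sum_j A i j * expR (w j (log_radius z)).
      by rewrite normrN ger0_norm// sumr_ge0// => j _; rewrite mulr_ge0// expR_ge0.
    rewrite E mulrA ler_pM2r ?invr_gt0 ?dot_gt0// H2; lra.
- by rewrite dens_int ltry.
Qed.

End FlowToRadial.

Theorem theorem1p1 (R : realType) (n : nat) (n_gt0 : (0 < n)%N)
    (A : 'M[R]_n) (A_sym : A^T = A) (A_ge0 : forall i j, 0 <= A i j)
    (A_irr : irreducible_mx A) (A_unit : A \in unitmx)
    (beta : 'I_n -> R) (beta_gt : forall i, - 2 < beta i) :
  [/\ (forall u : 'I_n -> R * R -> R,
         is_solution A beta u -> is_radial u ->
         Lambda_cond A beta (energy beta u)),
      (forall sigma : 'I_n -> R,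
         (forall i, 0 < sigma i) -> Lambda_cond A beta sigma ->
         exists u : 'I_n -> R * R -> R,
           [/\ is_solution A beta u, is_radial u &
               forall i, energy beta u i = sigma i]) &
      (forall u v : 'I_n -> R * R -> R,
         is_solution A beta u -> is_radial u ->
         is_solution A beta v -> is_radial v ->
         (forall i,
            \int[@lebesgue_measure R]_(r in `[0%R, +oo[)
               (r `^ (beta i + 1) * expR (profile u i r))%:E =
            \int[@lebesgue_measure R]_(r in `[0%R, +oo[)
               (r `^ (beta i + 1) * expR (profile v i r))%:E)%E ->
         exists2 delta : R, 0 < delta &
           forall (i : 'I_n) (r : R), 0 <= r ->
             profile u i r = profile v i (delta * r)
                             + (2 + beta i) * ln delta)].
Proof.
split.
- move=> u u_sol u_rad; have [m [sigma [mw -> _]]] := radial_flow u_sol u_rad.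
  exact: flow_Lambda_cond A_sym A_ge0 mw A_irr.
- move=> sigma sigma_gt0 sigmaL.
  have [m [w mw]] := flow_exists A_sym A_ge0 A_unit sigma_gt0 sigmaL n_gt0.
  exact: radial_solution_of_flow A_ge0 beta_gt mw.
- move=> u v u_sol u_rad v_sol v_rad uv.
  have b_gt0 i : 0 < beta i + 2 by have := beta_gt i; lra.
  have [m [sigma [mw _ su]]] := radial_flow u_sol u_rad.
  have [p [tau [pw _ sv]]] := radial_flow v_sol v_rad.
  have st : tau = sigma by apply/funext => i; have := uv i; rewrite su sv => -[].
  rewrite st in pw.
  have [h uvh] := flow_unique A_ge0 b_gt0 n_gt0 A_irr mw pw.
  have cu i : continuous (profile u i) by apply: continuous_profile; have [] := u_sol i.
  have cv i : continuous (profile v i) by apply: continuous_profile; have [] := v_sol i.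
  (* A translation by [h] in [t] is a dilation by [expR h] in [r]; the terms linear in [t] leave
     [(2 + beta i) * h]. *)
  have E i t : profile u i (expR t) = profile v i (expR h * expR t) + (2 + beta i) * h.
    by have := uvh i t; rewrite addrC [t + h]addrC expRD; lra.
  exists (expR h); first exact: expR_gt0.
  (* The radius [0] is not of the form [expR t]; there the identity follows by continuity as
     [t -> -oo]. *)
  move=> i r; rewrite expRK le_eqVlt => /predU1P[<-|r0]; last by rewrite -(lnK r0) E.
  have e0 : expR t @[t --> -oo] --> (0 : R) by exact/cvgNy_compNP/cvgr_expR.
  have Hu : profile u i (expR t) @[t --> -oo] --> profile u i 0.
    exact: (cvg_comp _ (profile u i) e0 (@cu i 0)).
  apply: (cvg_eq_unique Hu); under eq_fun do rewrite E.
  apply: cvgD; last exact: cvg_cst.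
  apply: (cvg_comp (fun t => expR h * expR t) (profile v i) _ (@cv i _)).
  by apply: cvgM => //; exact: cvg_cst.
Qed.
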